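(* Let $W$ be a complex vector space of dimension 6, let $e_1,\ldots,e_6$ be a basis of $W^*$, and let $\mathbb{P}(A)\subset \mathrm{Pf}\subset\mathbb{P}(\bigwedge^2W^* )$ be a stable linear space of dimension three. Then $\mathbb{P}(A)$ is $SL(W)$-equivalent to the space $$\langle e_1\wedge e_4+e_2\wedge e_5,\ e_1\wedge e_6+e_3\wedge e_5,\ e_2\wedge e_6-e_3\wedge e_4,\ (e_1-e_5)\wedge(e_2+e_4)\rangle,$$ and $\mathbb{P}(A)\cap\mathrm{Gr}(2,W^* )$ consists of two distinct points.
   Context: The base field is $\mathbb{C}$. $\mathbb{P}(\bigwedge^2 W^* )\simeq\mathbb{P}^{14}$ is the projective space of lines in the space $\bigwedge^2W^*$ of skew-symmetric bilinear forms on $W$. The rank of a form is the (even) rank of the corresponding $6\times 6$ skew-symmetric matrix. $\mathrm{Pf}=\{\omega\in\mathbb{P}(\bigwedge^2W^* ): \mathrm{rk}(\omega)\le 4\}$ is the Pfaffian hypersurface, and $\mathrm{Gr}(2,W^* )=\{\omega: \mathrm{rk}(\omega)=2\}$ is the Plücker-embedded Grassmannian of 2-dimensional subspaces of $W^*$. An $n$-dimensional linear space (linear system of skew-symmetric forms) is $\mathbb{P}(A)\subset \mathbb{P}(\bigwedge^2W^* )$ with $A\subset\bigwedge^2W^*$ a linear subspace of dimension $n+1$. Angle brackets denote (projective) linear span. Action and stability: $g\in GL(W)$ acts on forms by $M_\omega\mapsto gM_\omega g^T$ on the representing skew-symmetric matrices, hence on linear subspaces; two linear spaces are $SL(W)$-equivalent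 if they lie in the same $SL(W)$-orbit. Let $V_{n+1}$ be a complex vector space of dimension $n+1$. Choosing an injective linear map $\phi:V_{n+1}\to\bigwedge^2W^*$ with image $A$, one regards $A$ as a vector of $V_{n+1}^*\otimes\bigwedge^2W^*$, on which $SL(W)$ acts through the second factor. $\mathbb{P}(A)$ is stable if the orbit $SL(W)\cdot A$ is closed in $V_{n+1}^*\otimes\bigwedge^2W^*$ and the stabilizer of $A$ (as a vector of this space) in $SL(W)$ is finite; this does not depend on the choice of $\phi$. *)

(* Defs.v *)
From HB Require Import structures.
From mathcomp Require Import all_boot all_order all_algebra.
From mathcomp Require Import classical_sets cardinality reals complex.
From mathcomp Require Import mpoly.

Set Implicit Arguments.
Unset Strict Implicit.
Unset Printing Implicit Defensive.

Import GRing.Theory.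

Local Open Scope classical_set_scope.
Local Open Scope ring_scope.

Notation dual K W := 'Hom(W, K^o).

(* A bilinear form w on W is encoded as the linear map u |-> w(u, -). *)
Notation bilform K W := 'Hom(W, dual K W).

Section Zariski.
Variables (K : fieldType) (U : vectType K).

Definition eval_mpoly (p : {mpoly K[\dim {:U}]}) (u : U) : K :=
  p.@[fun i => coord (vbasis {:U}) i u].

(* X is a Zariski closed subset of S: it is cut out in S by polynomials in the
   linear coordinates of U. *)
Definition zariski_closed_in (S X : set U) : Prop :=
  exists I : set {mpoly K[\dim {:U}]},
    X = S `&` [set u | forall p, I p -> eval_mpoly p u = 0].

(* Points of the projective space P(U) are the lines <[u]>, u != 0, of U. *)
Definition proj (A : {vspace U}) : set {vspace U} :=
  [set <[u]>%VS | u in [set u | u \in A /\ u != 0]].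

End Zariski.

Section Forms.
Variables (K : fieldType) (W : vectType K).
Implicit Types (w : bilform K W) (f h : dual K W) (g : 'End(W)) (u v : W).

(* The space \bigwedge^2 W^*, as a subset of all bilinear forms. *)
Definition skew_forms : set (bilform K W) :=
  [set w : bilform K W | forall u v, w u v = - w v u].

Definition form_mx w : 'M[K]_(\dim {:W}) :=
  \matrix_(i, j) w (vbasis {:W})`_i (vbasis {:W})`_j.

Definition form_rank w : nat := \rank (form_mx w).

Definition Pf : set {vspace bilform K W} :=
  [set <[w]>%VS | w in
     [set w | skew_forms w /\ w != 0 /\ (form_rank w <= 4)%N]].

Definition Gr2 : set {vspace bilform K W} :=
  [set <[w]>%VS | w in [set w | skew_forms w /\ form_rank w = 2%N]].

Definition wedge_fun f h u : dual K W := f u *: h - h u *: f.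

Fact wedge_fun_is_linear f h : linear (wedge_fun f h).
Proof.
have scaleE (a b : K) : a *: (b : K^o) = a * b by [].
move=> a u v; rewrite /wedge_fun (linearP f) (linearP h) /= !scaleE.
by rewrite !scalerDl -!scalerA scalerBr opprD addrACA.
Qed.
HB.instance Definition _ f h :=
  GRing.isLinear.Build K W (dual K W) _ (wedge_fun f h)
    (wedge_fun_is_linear f h).

Definition wedge f h : bilform K W := linfun (wedge_fun f h).

Lemma wedgeE f h u v : wedge f h u v = f u * h v - h u * f v.
Proof. by rewrite lfunE /= /wedge_fun add_lfunE opp_lfunE !scale_lfunE. Qed.

(* f o g^-1, the contragredient action of g on W^*. *)
Definition dual_act_fun g f : dual K W := (f \o g^-1)%VF.

Fact dual_act_fun_is_linear g : linear (dual_act_fun g).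
Proof. by move=> a f h; rewrite /dual_act_fun comp_lfunDl comp_lfunZl. Qed.
HB.instance Definition _ g :=
  GRing.isLinear.Build K (dual K W) (dual K W) _ (dual_act_fun g)
    (dual_act_fun_is_linear g).

Definition dual_act g : 'End(dual K W) := linfun (dual_act_fun g).

Definition act_fun g w : bilform K W := (dual_act g \o (w \o g^-1))%VF.

Fact act_fun_is_linear g : linear (act_fun g).
Proof.
move=> a w1 w2; apply/lfunP=> u; rewrite /act_fun.
by rewrite !(comp_lfunE, add_lfunE, scale_lfunE) linearP.
Qed.
HB.instance Definition _ g :=
  GRing.isLinear.Build K (bilform K W) (bilform K W) _ (act_fun g)
    (act_fun_is_linear g).

(* The action of g in GL(W) on bilinear forms; see actE. If (x_i) is a basis of
   W^* and g x_i = \sum_k G k i x_k for the contragredient action, a form with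
   matrix M in this basis is sent to the form with matrix G M G^T. *)
Definition act g : 'End(bilform K W) := linfun (act_fun g).

Lemma actE g w u v : act g w u v = w (g^-1%VF u) (g^-1%VF v).
Proof. by rewrite lfunE /= /act_fun comp_lfunE lfunE /= !comp_lfunE. Qed.

Definition SL : set 'End(W) :=
  [set g | \det (passmx.mxof (vbasis {:W}) (vbasis {:W}) g) = 1].

Definition SL_equivalent (A B : {vspace bilform K W}) : Prop :=
  exists2 g, SL g & B = (act g @: A)%VS.

Section Tensors.
Variable V : vectType K.
Implicit Type phi : 'Hom(V, bilform K W).

(* V^* \otimes \bigwedge^2 W^*, as the space of linear maps from V to
   \bigwedge^2 W^*; SL(W) acts by composition on the left. *)
Definition skew_tensors : set 'Hom(V, bilform K W) :=
  [set phi : 'Hom(V, bilform K W) | forall x, skew_forms (phi x)].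

Definition SL_orbit phi : set 'Hom(V, bilform K W) :=
  [set (act g \o phi)%VF | g in SL].

Definition SL_stabilizer phi : set 'End(W) :=
  [set g | SL g /\ (act g \o phi)%VF = phi].

End Tensors.

Definition stable (A : {vspace bilform K W}) : Prop :=
  exists phi : 'Hom('rV[K]_(\dim A), bilform K W),
    [/\ lker phi = 0%VS, limg phi = A,
        zariski_closed_in (@skew_tensors _) (SL_orbit phi) &
        finite_set (SL_stabilizer phi)].

End Forms.

Arguments skew_forms {K} W.
Arguments Pf {K} W.
Arguments Gr2 {K} W.

(* Main.v *)
(* Stability is used through the easy half of the Hilbert-Mumford criterion: if a
   nontrivial one-parameter subgroup of SL(W) has a limit on A, this limit lies in the
   closed orbit and has an infinite stabilizer.  The weights (1,1,1,-1,-1,-1) and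
   (1,0,0,0,0,-1) show that no 3-space of W is isotropic for all of A, and that
   A(v, -) has dimension at least 2 for every nonzero v.

   A contains a form of rank 2: if w in A has rank 4 and kernel K, polarizing Pf = 0
   makes the restrictions A -> K^* (x) (W/K)^* isotropic, and the vanishing of the Gram
   Pfaffian of six vectors of a symplectic 4-space yields a form h outside <w> killing
   some nonzero k in K.  Either the pencil <w, h> on W/k contains a form of rank 2, or
   its kernels span with k a 4-space on which the pencil vanishes; in the latter case
   the other two forms of A have a common isotropic plane modulo k in it, which gives an
   isotropic 3-space.

   Let r in A have rank 2 and kernel N.  All forms of A are degenerate on N, hence some
   n in N satisfies A(n, N) = 0 and A/<r> is the space of skew forms on N/n.  The
   vanishing of the Pfaffian then determines the remaining coefficients up to a change
   of basis. *)

Require Import Defs.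
From HB Require Import structures.
From mathcomp Require Import all_boot all_order all_algebra.
From mathcomp Require Import boolp classical_sets cardinality reals complex.
From mathcomp Require Import mpoly.
From mathcomp Require Import ring.

Set Implicit Arguments.
Unset Strict Implicit.
Unset Printing Implicit Defensive.

Import GRing.Theory.

Local Open Scope classical_set_scope.
Local Open Scope ring_scope.

(** * Spans, free families and bilinear forms *)

(** No element of SL(W) is computed. Both A and the target get a basis of forms and a basis of W
    whose values agree with one table, [std_table]. The map between the two bases of W carries one
    space to the other, and a sixth root rescales it to determinant 1, which only multiplies all
    forms by a common factor. The same table gives the points of rank 2. In the geometric part the
    coefficients of a vanishing Pfaffian in auxiliary parameters are read off by finite differences
    at 0, 1 and -1, whence the invertibility of 2. Characteristic 0 serves the one-parameter
    subgroups: their weights are at most 1 in absolute value, so the curve of transformed tensors is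
    quadratic in t, and a polynomial vanishing at all nonzero t is zero. *)

Section LinearAlgebra.
Variables (K : fieldType) (W : vectType K).
Implicit Types (U : {vspace W}) (X Y : seq W) (v : W).

Lemma span_seqP X v : v \in <<X>>%VS ->
  exists c : nat -> K, v = \sum_(i < size X) c i *: X`_i.
Proof.
elim: X v => [|x X IH] v.
  by rewrite span_nil memv0 => /eqP ->; exists (fun=> 0); rewrite big_ord0.
rewrite span_cons => /memv_addP[_ /vlineP[k ->]] [v' /IH[c ->] ->].
by exists (fun i => if i is j.+1 then c j else k); rewrite /= big_ord_recl.
Qed.

Lemma free_seqP X :
  free X <-> forall c : nat -> K, \sum_(i < size X) c i *: X`_i = 0 ->
             forall i, (i < size X)%N -> c i = 0.
Proof.
split=> [/(freeP (X := in_tuple X)) fX c c0 i ltiX|fX].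
  by have := fX (fun j => c j) c0 (Ordinal ltiX).
apply/(freeP (X := in_tuple X)) => c c0 i.
pose c' j := if insub j is Some j' then c j' else 0.
have c'E (j : 'I_(size X)) : c' j = c j by rewrite /c' valK.
by rewrite -c'E; apply: fX (ltn_ord i); rewrite -[RHS]c0; apply: eq_bigr => j _; rewrite c'E.
Qed.

Lemma free_extend U X : free X -> (<<X>> <= U)%VS ->
  exists Y, basis_of U (X ++ Y).
Proof.
move=> fX sXU; exists (vbasis (U :\: <<X>>)).
have {1}-> : U = (<<X>> + (U :\: <<X>>))%VS.
  by rewrite addvC addv_diff; apply/esym/addv_idPl.
apply: cat_basis; last exact: vbasisP.
  by apply/directv_addP; rewrite capvC capv_diff.
by rewrite /basis_of eqxx.
Qed.

Lemma basis_size U X : basis_of U X -> size X = \dim U.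
Proof. by move=> /[dup] /span_basis <- /basis_free /eqP. Qed.

Lemma free_basis U X : free X -> (<<X>> <= U)%VS -> size X = \dim U -> basis_of U X.
Proof. by move=> fX sXU sX; rewrite basisEfree fX sXU sX leqnn. Qed.

End LinearAlgebra.

(* [F] is a vector space of bilinear forms on [W], known only through evaluation. *)
Record form_family (K : fieldType) (F W : vectType K) := FormFamily {
  ev : F -> W -> W -> K;
  ev_lin_form : forall a w w' u v, ev (a *: w + w') u v = a * ev w u v + ev w' u v;
  ev_linl : forall w a u u' v, ev w (a *: u + u') v = a * ev w u v + ev w u' v;
  ev_linr : forall w a u v v', ev w u (a *: v + v') = a * ev w u v + ev w u v';
  ev_ext : forall w w', (forall u v, ev w u v = ev w' u v) -> w = w' }.

Section Evaluation.
Variables (K : fieldType) (F W : vectType K) (E : form_family F W).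
Implicit Types (w : F) (u v : W).
Local Notation ev := (ev E).

Lemma ev0f u v : ev 0 u v = 0.
Proof.
by apply: (addIr (ev 0 u v)); rewrite add0r -{1}(mul1r (ev 0 u v)) -ev_lin_form scaler0 add0r.
Qed.
Lemma ev0l w v : ev w 0 v = 0.
Proof.
by apply: (addIr (ev w 0 v)); rewrite add0r -{1}(mul1r (ev w 0 v)) -ev_linl scaler0 add0r.
Qed.
Lemma ev0r w u : ev w u 0 = 0.
Proof.
by apply: (addIr (ev w u 0)); rewrite add0r -{1}(mul1r (ev w u 0)) -ev_linr scaler0 add0r.
Qed.
Lemma evDl w u u' v : ev w (u + u') v = ev w u v + ev w u' v.
Proof. by rewrite -[u in LHS]scale1r ev_linl mul1r. Qed.
Lemma evDr w u v v' : ev w u (v + v') = ev w u v + ev w u v'.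
Proof. by rewrite -[v in LHS]scale1r ev_linr mul1r. Qed.
Lemma evDf w w' u v : ev (w + w') u v = ev w u v + ev w' u v.
Proof. by rewrite -[w in LHS]scale1r ev_lin_form mul1r. Qed.
Lemma evZl w a u v : ev w (a *: u) v = a * ev w u v.
Proof. by rewrite -[_ *: _]addr0 ev_linl ev0l addr0. Qed.
Lemma evZr w a u v : ev w u (a *: v) = a * ev w u v.
Proof. by rewrite -[_ *: _]addr0 ev_linr ev0r addr0. Qed.
Lemma evZf a w u v : ev (a *: w) u v = a * ev w u v.
Proof. by rewrite -[_ *: _]addr0 ev_lin_form ev0f addr0. Qed.
Lemma evNl w u v : ev w (- u) v = - ev w u v.
Proof. by rewrite -scaleN1r evZl mulN1r. Qed.
Lemma evNr w u v : ev w u (- v) = - ev w u v.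
Proof. by rewrite -scaleN1r evZr mulN1r. Qed.
Lemma evNf w u v : ev (- w) u v = - ev w u v.
Proof. by rewrite -scaleN1r evZf mulN1r. Qed.

Definition evE := (evDl, evDr, evZl, evZr, evNl, evNr, ev0l, ev0r,
                   evDf, evZf, evNf, ev0f).

End Evaluation.

(** * Pfaffians *)

Section Pfaffian.
Variable K : fieldType.

Definition pf4 (b : nat -> nat -> K) i j k l : K :=
  b i j * b k l - b i k * b j l + b i l * b j k.
Arguments pf4 b (i j k l)%_N.

(** Expansion along the first row; only entries above the diagonal occur. *)
Definition pfaff (b : nat -> nat -> K) : K :=
  b 0%N 1%N * pf4 b 2 3 4 5 - b 0%N 2%N * pf4 b 1 3 4 5 + b 0%N 3%N * pf4 b 1 2 4 5
  - b 0%N 4%N * pf4 b 1 2 3 5 + b 0%N 5%N * pf4 b 1 2 3 4.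

(** The signed 4 by 4 sub-Pfaffians form an adjugate of a skew matrix: combining the equations
    [e j = 0] with them gives [pfaff b * c i]. Each case below is one row of this identity. *)
Lemma pfaff_ker (b : nat -> nat -> K) (c : nat -> K) :
    (forall i, b i i = 0) -> (forall i j, b j i = - b i j) ->
    (forall i, (i < 6)%N -> \sum_(j < 6) c j * b i j = 0) ->
  pfaff b != 0 -> forall i, (i < 6)%N -> c i = 0.
Proof.
move=> b0 bN bc pf0.
pose e i := \sum_(j < 6) c j * b i j.
have e0 i : (i < 6)%N -> e i = 0 by exact: bc.
have eE i : e i = c 0%N * b i 0%N + c 1%N * b i 1%N + c 2%N * b i 2%N + c 3%N * b i 3%N
                  + c 4%N * b i 4%N + c 5%N * b i 5%N.
  by rewrite /e !big_ord_recl big_ord0 /=; ring.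
have cof x : pfaff b * x = 0 -> x = 0.
  by move/eqP; rewrite mulf_eq0 (negPf pf0) => /eqP.
(* Expands [e] and moves every entry above the diagonal, where [ring] can compare them. *)
have low := (eE, b0, bN 0%N 1%N, bN 0%N 2%N, bN 0%N 3%N, bN 0%N 4%N, bN 0%N 5%N,
    bN 1%N 2%N, bN 1%N 3%N, bN 1%N 4%N, bN 1%N 5%N, bN 2%N 3%N,
    bN 2%N 4%N, bN 2%N 5%N, bN 3%N 4%N, bN 3%N 5%N, bN 4%N 5%N).
rewrite /pfaff /pf4 in cof *.
case=> [|[|[|[|[|[|i]]]]]] //.
- move=> _; apply: cof; transitivity
    (- pf4 b 2 3 4 5 * e 1%N + pf4 b 1 3 4 5 * e 2%N - pf4 b 1 2 4 5 * e 3%N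
      + pf4 b 1 2 3 5 * e 4%N - pf4 b 1 2 3 4 * e 5%N).
    by rewrite /pf4 !low; ring.
  by rewrite !e0 // !mulr0 !(addr0, subr0, oppr0).
- move=> _; apply: cof; transitivity
    (pf4 b 2 3 4 5 * e 0%N - pf4 b 0 3 4 5 * e 2%N + pf4 b 0 2 4 5 * e 3%N
      - pf4 b 0 2 3 5 * e 4%N + pf4 b 0 2 3 4 * e 5%N).
    by rewrite /pf4 !low; ring.
  by rewrite !e0 // !mulr0 !(addr0, subr0, oppr0).
- move=> _; apply: cof; transitivity
    (- pf4 b 1 3 4 5 * e 0%N + pf4 b 0 3 4 5 * e 1%N - pf4 b 0 1 4 5 * e 3%N
      + pf4 b 0 1 3 5 * e 4%N - pf4 b 0 1 3 4 * e 5%N).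
    by rewrite /pf4 !low; ring.
  by rewrite !e0 // !mulr0 !(addr0, subr0, oppr0).
- move=> _; apply: cof; transitivity
    (pf4 b 1 2 4 5 * e 0%N - pf4 b 0 2 4 5 * e 1%N + pf4 b 0 1 4 5 * e 2%N
      - pf4 b 0 1 2 5 * e 4%N + pf4 b 0 1 2 4 * e 5%N).
    by rewrite /pf4 !low; ring.
  by rewrite !e0 // !mulr0 !(addr0, subr0, oppr0).
- move=> _; apply: cof; transitivity
    (- pf4 b 1 2 3 5 * e 0%N + pf4 b 0 2 3 5 * e 1%N - pf4 b 0 1 3 5 * e 2%N + pf4 b 0 1 2 5 * e 3%N
      - pf4 b 0 1 2 3 * e 5%N).
    by rewrite /pf4 !low; ring.
  by rewrite !e0 // !mulr0 !(addr0, subr0, oppr0).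
- move=> _; apply: cof; transitivity
    (pf4 b 1 2 3 4 * e 0%N - pf4 b 0 2 3 4 * e 1%N + pf4 b 0 1 3 4 * e 2%N - pf4 b 0 1 2 4 * e 3%N
      + pf4 b 0 1 2 3 * e 4%N).
    by rewrite /pf4 !low; ring.
  by rewrite !e0 // !mulr0 !(addr0, subr0, oppr0).
Qed.

Lemma pf4_ker (b : nat -> nat -> K) (c : nat -> K) :
    (forall i, b i i = 0) -> (forall i j, b j i = - b i j) ->
    (forall i, (i < 4)%N -> \sum_(j < 4) c j * b i j = 0) ->
  pf4 b 0 1 2 3 != 0 -> forall i, (i < 4)%N -> c i = 0.
Proof.
move=> b0 bN bc pf0.
pose e i := \sum_(j < 4) c j * b i j.
have e0 i : (i < 4)%N -> e i = 0 by exact: bc.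
have eE i : e i = c 0%N * b i 0%N + c 1%N * b i 1%N + c 2%N * b i 2%N + c 3%N * b i 3%N.
  by rewrite /e !big_ord_recl big_ord0 /=; ring.
have cof x : pf4 b 0 1 2 3 * x = 0 -> x = 0.
  by move/eqP; rewrite mulf_eq0 (negPf pf0) => /eqP.
have low := (eE, b0, bN 0%N 1%N, bN 0%N 2%N, bN 0%N 3%N, bN 1%N 2%N, bN 1%N 3%N, bN 2%N 3%N).
rewrite /pf4 in cof *.
case=> [|[|[|[|i]]]] // _; apply: cof.
- transitivity (- b 2%N 3%N * e 1%N + b 1%N 3%N * e 2%N - b 1%N 2%N * e 3%N).
    by rewrite !low; ring.
  by rewrite !e0 // !mulr0 !(addr0, subr0).
- transitivity (b 2%N 3%N * e 0%N - b 0%N 3%N * e 2%N + b 0%N 2%N * e 3%N).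
    by rewrite !low; ring.
  by rewrite !e0 // !mulr0 !(addr0, subr0).
- transitivity (- b 1%N 3%N * e 0%N + b 0%N 3%N * e 1%N - b 0%N 1%N * e 3%N).
    by rewrite !low; ring.
  by rewrite !e0 // !mulr0 !(addr0, subr0).
- transitivity (b 1%N 2%N * e 0%N - b 0%N 2%N * e 1%N + b 0%N 1%N * e 2%N).
    by rewrite !low; ring.
  by rewrite !e0 // !mulr0 !(addr0, subr0).
Qed.

End Pfaffian.
Arguments pf4 {K} b (i j k l)%_N.

Section Coordinates.
Variables (K : fieldType) (W : vectType K).
Implicit Types (u v : W).

Definition co i u := coord (vbasis {:W}) i u.

Lemma coD i u v : co i (u + v) = co i u + co i v.
Proof. exact: linearD. Qed.
Lemma coZ i a u : co i (a *: u) = a * co i u.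
Proof. exact: linearZ. Qed.
Lemma coN i u : co i (- u) = - co i u.
Proof. exact: linearN. Qed.
Lemma co0 i : co i 0 = 0.
Proof. exact: linear0. Qed.

Definition coE := (coD, coZ, coN, co0).

(* Reduces identities between vectors to scalar ones, where [ring] applies. *)
Lemma co_ext u v : (forall i, co i u = co i v) -> u = v.
Proof.
move=> e; rewrite (coord_vbasis (memvf u)) (coord_vbasis (memvf v)).
by apply: eq_bigr => i _; rewrite -/(co i u) e.
Qed.

Lemma basis_change (U : {vspace W}) (X Y : seq W) : basis_of U X ->
  (forall x, x \in X -> x \in <<Y>>%VS) -> size Y = size X -> basis_of U Y.
Proof.
move=> bX sXY sY; rewrite basisEdim sY (basis_size bX) leqnn andbT.
by rewrite -(span_basis bX); apply/span_subvP.
Qed.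

Lemma basis_subset (U : {vspace W}) (X Y : seq W) : basis_of U X ->
  {subset X <= Y} -> size Y = size X -> basis_of U Y.
Proof. by move=> bX sXY; apply: basis_change => // x /sXY; apply: memv_span. Qed.

End Coordinates.

(** * Skew forms and their Pfaffians in a basis *)

Section SkewForms.
Variables (K : fieldType) (F W : vectType K) (E : form_family F W).
Hypothesis nz2 : 2 != 0 :> K.
Implicit Types (w : F) (u v : W).
Local Notation ev := (ev E).

Definition skewsym w := forall u v, ev w v u = - ev w u v.

Lemma ev_diag w u : skewsym w -> ev w u u = 0.
Proof.
move=> sw; have /eqP := sw u u; rewrite -addr_eq0 -mulr2n -mulr_natl mulf_eq0.
by rewrite (negPf nz2) => /eqP.
Qed.

Lemma skewD w w' : skewsym w -> skewsym w' -> skewsym (w + w').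
Proof. by move=> s s' u v; rewrite !evE s s' opprD. Qed.
Lemma skewZ a w : skewsym w -> skewsym (a *: w).
Proof. by move=> s u v; rewrite !evE s mulrN. Qed.
Lemma skewN w : skewsym w -> skewsym (- w).
Proof. by move=> s u v; rewrite !evE s. Qed.

Definition pf w (X : seq W) := pfaff (fun i j => ev w X`_i X`_j).

Lemma pfE w v1 v2 v3 v4 v5 v6 : pf w [:: v1; v2; v3; v4; v5; v6] =
  ev w v1 v2 * (ev w v3 v4 * ev w v5 v6 - ev w v3 v5 * ev w v4 v6 + ev w v3 v6 * ev w v4 v5)
  - ev w v1 v3 * (ev w v2 v4 * ev w v5 v6 - ev w v2 v5 * ev w v4 v6 + ev w v2 v6 * ev w v4 v5)
  + ev w v1 v4 * (ev w v2 v3 * ev w v5 v6 - ev w v2 v5 * ev w v3 v6 + ev w v2 v6 * ev w v3 v5)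
  - ev w v1 v5 * (ev w v2 v3 * ev w v4 v6 - ev w v2 v4 * ev w v3 v6 + ev w v2 v6 * ev w v3 v4)
  + ev w v1 v6 * (ev w v2 v3 * ev w v4 v5 - ev w v2 v4 * ev w v3 v5 + ev w v2 v5 * ev w v3 v4).
Proof. by []. Qed.

Lemma ev_basis0 X w u : basis_of fullv X -> (forall x, x \in X -> ev w u x = 0) ->
  forall v, ev w u v = 0.
Proof.
move=> bX e v; have : v \in <<X>>%VS by rewrite (span_basis bX) memvf.
case/span_seqP => c ->; elim/big_rec: _ => [|i y _ IH]; first by rewrite evE.
by rewrite !evE IH e ?mem_nth // mulr0 addr0.
Qed.

Lemma ev_basis_ext X w w' : basis_of fullv X -> skewsym w -> skewsym w' ->
    (forall i j, (i < j < size X)%N -> ev w X`_i X`_j = ev w' X`_i X`_j) ->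
  w = w'.
Proof.
move=> bX s s' e; apply: ev_ext => u v; apply/eqP; rewrite -subr_eq0; apply/eqP.
rewrite -evNf -evDf; apply: (ev_basis0 bX) => y /(nthP 0)[j ltj <-].
have sd : skewsym (w - w') by apply: skewD => //; apply: skewN.
rewrite sd (ev_basis0 bX) ?oppr0 // => x /(nthP 0)[i lti <-].
wlog ltij : i j lti ltj / (i < j)%N => [IH|].
  case: (ltngtP i j) => [|ltji|->]; last exact: ev_diag.
    exact: IH.
  by rewrite sd IH // oppr0.
by rewrite sd !evE e ?ltij // subrr oppr0.
Qed.

Lemma pf_ker w X v : skewsym w -> basis_of fullv X -> size X = 6%N -> v != 0 ->
  (forall u, ev w u v = 0) -> pf w X = 0.
Proof.
move=> s bX sX v0 kv; apply/eqP; apply: contra_neqT v0 => pf0.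
have : v \in <<X>>%VS by rewrite (span_basis bX) memvf.
case/span_seqP => c; rewrite sX => def_v; rewrite def_v big1 // => i _.
rewrite (pfaff_ker (c := c) _ _ _ pf0) ?scale0r //= => [j|j ltj].
- exact: ev_diag.
- have evS (G : 'I_6 -> W) : ev w X`_j (\sum_k G k) = \sum_k ev w X`_j (G k).
    by apply: (big_morph (ev w X`_j)) => [x y|]; rewrite evE.
  transitivity (ev w X`_j v) => //; rewrite def_v evS.
  by apply: eq_bigr => k _; rewrite !evE.
Qed.

End SkewForms.

(** * Symplectic reduction of a form with vanishing Pfaffian *)

Section SymplecticBasis.
Variables (K : fieldType) (F W : vectType K) (E : form_family F W).
Hypothesis nz2 : 2 != 0 :> K.
Implicit Types (w : F) (u v : W).
Local Notation ev := (ev E).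
Local Notation skewsym := (skewsym E).
Local Notation pf := (pf E).

Lemma complete_basis (U : {vspace W}) (X : seq W) n :
  free X -> (<<X>> <= U)%VS -> (size X + n = \dim U)%N ->
  exists2 Y, size Y = n & basis_of U (X ++ Y).
Proof.
move=> fX sX dX; have [Y bY] := free_extend fX sX; exists Y => //.
by apply/eqP; rewrite -(eqn_add2l (size X)) dX -size_cat (basis_size bY).
Qed.

Lemma bilinear_eq1 (b : W -> W -> K) :
    (forall a u v, b (a *: u) v = a * b u v) ->
  (forall u v, b u v = 0) \/ exists u, exists v, b u v = 1.
Proof.
move=> bZ; have [|/existsNP[u /existsNP[v /eqP nz]]] := EM (forall u v, b u v = 0); first by left.
by right; exists ((b u v)^-1 *: u), v; rewrite bZ mulVf.
Qed.

(** Pairing a linear relation with each of the four vectors isolates one coefficient up to sign. *)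
Lemma free_pairs w u v u' v' : skewsym w ->
  ev w u v = 1 -> ev w u' v' = 1 ->
  ev w u u' = 0 -> ev w u v' = 0 -> ev w v u' = 0 -> ev w v v' = 0 ->
  free [:: u; v; u'; v'].
Proof.
move=> s e1 e2 e3 e4 e5 e6; apply/free_seqP => c.
rewrite /= !big_ord_recl big_ord0 /= => c0.
have ez x : ev w (c 0%N *: u + (c 1%N *: v + (c 2%N *: u' + (c 3%N *: v' + 0)))) x = 0.
  by rewrite c0 evE.
have := (ez u, ez v, ez u', ez v').
rewrite !evE !(ev_diag nz2) // (s u v) (s u u') (s u v') (s v u') (s v v') (s u' v').
rewrite e1 e2 e3 e4 e5 e6 !(mulr0, mulrN1, mulr1, oppr0, addr0, add0r) => -[[[h1 h0] h3] h2].
by case=> [|[|[|[|i]]]] //; rewrite ?h0 ?h2 // -[LHS]opprK ?h1 ?h3 oppr0.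
Qed.

(* Two steps of symplectic Gram-Schmidt; the orthogonal complement of the two
   hyperbolic planes is then the kernel since the Pfaffian vanishes. *)
Lemma rank4_normal_form w : \dim {:W} = 6%N -> skewsym w ->
    (forall X, basis_of fullv X -> pf w X = 0) -> w != 0 ->
  (exists p, exists q, forall u v,
      ev w u v = ev w p u * ev w q v - ev w q u * ev w p v) \/
  exists k1, exists k2, exists v3, exists v4, exists v5, exists v6,
   [/\ basis_of fullv [:: k1; k2; v3; v4; v5; v6],
       forall v, ev w k1 v = 0, forall v, ev w k2 v = 0 &
    [/\ ev w v3 v4 = 1, ev w v5 v6 = 1 & [/\
       ev w v3 v5 = 0, ev w v3 v6 = 0, ev w v4 v5 = 0 & ev w v4 v6 = 0]]].
Proof.
move=> dimW s pf0 w0.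
have [w_0|[u [v e1]]] := bilinear_eq1 (fun a u v => evZl E w a u v).
  by case/eqP: w0; apply: (ev_ext (f := E)) => u v; rewrite w_0 evE.
(* The part of [w] left after splitting off the hyperbolic plane of [u], [v]: if it vanishes, [w]
   has rank 2. *)
pose w' x y := ev w x y - (ev w u x * ev w v y - ev w v x * ev w u y).
have w'Z a x y : w' (a *: x) y = a * w' x y by rewrite /w' !evE; ring.
have [w'0|[u1 [v1]]] := bilinear_eq1 w'Z.
  by left; exists u, v => x y; apply/eqP; rewrite -subr_eq0; apply/eqP; apply: w'0.
rewrite /w' => e2; right.
(* Projection to the orthogonal of [u], [v]; it turns the values of [w'] into values of [w]. *)
pose orth x := x - ev w x v *: u + ev w x u *: v.
have orthE x : orth x = x - ev w x v *: u + ev w x u *: v by [].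
clearbody orth.
have orthu x : ev w u (orth x) = 0.
  by rewrite orthE !evE (ev_diag nz2) // e1 (s u x); ring.
have orthv x : ev w v (orth x) = 0.
  by rewrite orthE !evE (ev_diag nz2) // (s u v) e1 (s v x); ring.
set u' := orth u1; set v' := orth v1.
have e2' : ev w u' v' = 1.
  rewrite -e2 /v' [in LHS]orthE evDr evDr evNr !evZr (s u u') (s v u') orthu orthv.
  rewrite /u' orthE !evE (s u v1) (s v v1) (s u u1) (s v u1); ring.
have [ou ov] : ev w u u' = 0 /\ ev w u v' = 0 by rewrite !orthu.
have [ou' ov'] : ev w v u' = 0 /\ ev w v v' = 0 by rewrite !orthv.
clearbody u' v'.
have fr := free_pairs s e1 e2' ou ov ou' ov'.
have [||[|z1 [|z2 []]] // _ bz] := @complete_basis fullv _ 2 fr.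
- exact: subvf.
- by rewrite dimW.
pose orth2 x := orth x - ev w (orth x) v' *: u' + ev w (orth x) u' *: v'.
have orth2E x : orth2 x = orth x - ev w (orth x) v' *: u' + ev w (orth x) u' *: v' by [].
clearbody orth2.
have o1 x : ev w u (orth2 x) = 0 by rewrite orth2E !evE orthu ou ov; ring.
have o2 x : ev w v (orth2 x) = 0 by rewrite orth2E !evE orthv ou' ov'; ring.
have o3 x : ev w u' (orth2 x) = 0.
  by rewrite orth2E !evE (ev_diag nz2) // e2' (s u'); ring.
have o4 x : ev w v' (orth2 x) = 0.
  by rewrite orth2E !evE (ev_diag nz2) // (s u' v') e2' (s v' (orth x)); ring.
have bY : basis_of fullv [:: orth2 z1; orth2 z2; u; v; u'; v'].
  have zE z : z = orth2 z + (ev w z v *: u - ev w z u *: v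
                     + (ev w (orth z) v' *: u' - ev w (orth z) u' *: v')).
    by apply: co_ext => i; rewrite orth2E {1}orthE !coE; ring.
  apply: (basis_change bz) => // x; rewrite !inE.
  have zY z : orth2 z \in [:: orth2 z1; orth2 z2; u; v; u'; v'] ->
      z \in <<[:: orth2 z1; orth2 z2; u; v; u'; v']>>%VS.
    move=> zY; rewrite (zE z).
    by rewrite memvD ?(memv_span zY) // memvD ?memvB ?memvZ ?memv_span ?inE ?eqxx ?orbT.
  case/or4P=> [/eqP->|/eqP->|/eqP->|/or3P[/eqP->|/eqP->|/eqP->]];
    by [rewrite memv_span ?inE ?eqxx ?orbT | rewrite zY ?inE ?eqxx ?orbT].
(* In this basis the matrix is block diagonal with two blocks of Pfaffian 1, so the Pfaffian is this
   remaining entry. *)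
have e0 : ev w (orth2 z1) (orth2 z2) = 0.
  have := pf0 _ bY; rewrite /pf /pfaff /pf4 /= e1 e2' ou ov ou' ov'.
  rewrite !(s u) !(s v) !(s u') !(s v') !o1 !o2 !o3 !o4 => e0; rewrite -[RHS]e0; ring.
exists (orth2 z1), (orth2 z2), u, v, u', v'; split=> //.
- apply: (ev_basis0 bY) => x; rewrite !inE.
  case/or4P=> [/eqP->|/eqP->|/eqP->|/or3P[/eqP->|/eqP->|/eqP->]];
    by rewrite ?(ev_diag nz2) // (s _ (orth2 z1)) ?o1 ?o2 ?o3 ?o4 ?oppr0.
- apply: (ev_basis0 bY) => x; rewrite !inE.
  case/or4P=> [/eqP->|/eqP->|/eqP->|/or3P[/eqP->|/eqP->|/eqP->]];
    by rewrite ?(ev_diag nz2) // (s _ (orth2 z2)) ?o1 ?o2 ?o3 ?o4 ?e0 ?oppr0.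
Qed.
End SymplecticBasis.

(** * Small matrices *)

Section Matrices.
Variable K : fieldType.

Lemma row_ker m n (M : 'M[K]_(m, n)) : (\rank M < m)%N ->
  exists2 x : 'rV_m, x != 0 & x *m M = 0.
Proof.
move=> rM; exists (nz_row (kermx M)); last first.
  by apply/eqP; rewrite -[_ == 0]sub_kermx nz_row_sub.
by rewrite nz_row_eq0 -mxrank_eq0 mxrank_ker subn_eq0 -ltnNge.
Qed.

(** The hypothesis is the determinant with rows [p], [q], [s], written out so that [ring] can
    establish it. *)
Lemma det3 (p q s : nat -> K) :
  p 0%N * (q 1%N * s 2%N - q 2%N * s 1%N)
    - p 1%N * (q 0%N * s 2%N - q 2%N * s 0%N)
    + p 2%N * (q 0%N * s 1%N - q 1%N * s 0%N) = 0 ->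
  exists2 x : nat -> K, ~~ [&& x 0%N == 0, x 1%N == 0 & x 2%N == 0] &
    forall i, (i < 3)%N -> x 0%N * p i + x 1%N * q i + x 2%N * s i = 0.
Proof.
pose rw k : nat -> K := if k is k'.+1 then if k' is 0%N then q else s else p.
pose M : 'M[K]_3 := \matrix_(i, j) rw i j.
move=> d0; have : \det M = 0.
  rewrite -[RHS]d0 (expand_det_row M ord0) !big_ord_recl big_ord0.
  rewrite /cofactor !(expand_det_row _ ord0) !big_ord_recl !big_ord0 /cofactor !det_mx11.
  rewrite !mxE /=; ring.
move/eqP/det0P => [v v0 vM]; pose x i := v ord0 (inord i).
have xE (i : 'I_3) : v ord0 i = x i by rewrite /x inord_val.
exists x => [|i lti].
  apply: contra v0 => /and3P[/eqP x0 /eqP x1 /eqP x2].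
  apply/eqP/rowP => -[[|[|[|i]]] lti] //; by rewrite mxE xE.
have /rowP/(_ (Ordinal lti)) := vM; rewrite !mxE !big_ord_recl big_ord0 !mxE !xE /=.
by rewrite addr0 addrA.
Qed.

End Matrices.

Definition sqrt_closed (K : fieldType) :=
  forall p q : K, exists x, x ^+ 2 = p * x + q.

(** The factorization of the binary form aX^2 + bXY + cY^2 as (s1 X + s2 Y)(t1 X + t2 Y). *)
Lemma quadratic_split (K : fieldType) (a b c : K) :
  sqrt_closed K ->
  ~~ [&& a == 0, b == 0 & c == 0] ->
  exists s1, exists s2, exists t1, exists t2,
  [/\ (s1 != 0) || (s2 != 0), (t1 != 0) || (t2 != 0),
      a = s1 * t1 , b = s1 * t2 + s2 * t1 & c = s2 * t2].
Proof.
move=> sqK; have [-> nz|a0 _] := eqVneq a 0.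
  exists 0, 1, b, c; rewrite oner_eq0 orbT; split=> //; [|by ring..].
  by move: nz; rewrite /= negb_and.
(* [x] is a root of aX^2 + bX + c; the other root is -(b/a) - x. *)
have [x xr] := sqK (- (b / a)) (- (c / a)).
exists a, (- (a * x)), 1, (b / a + x); rewrite a0 oner_eq0; split => //.
- by rewrite mulr1.
- by field.
- have -> : - (a * x) * (b / a + x) = - (a * x ^+ 2) - b * x by field.
  by rewrite xr; field.
Qed.

(** * A pencil in [A] with a common kernel vector *)

Section CommonKernel.
Variables (K : fieldType) (F W : vectType K) (E : form_family F W).
Hypothesis nz2 : 2 != 0 :> K.
Variable A : {vspace F}.
Local Notation ev := (ev E).
Local Notation skewsym := (skewsym E).
Local Notation pf := (pf E).
Hypothesis dimA : \dim A = 4%N.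
Hypothesis skA : forall w, w \in A -> skewsym w.
Hypothesis pfA : forall w X, w \in A -> basis_of fullv X -> pf w X = 0.

Lemma basis4_mem a1 a2 a3 a4 w : basis_of A [:: a1; a2; a3; a4] -> w \in A ->
  exists c1, exists c2, exists c3, exists c4,
    w = c1 *: a1 + c2 *: a2 + c3 *: a3 + c4 *: a4.
Proof.
move=> bA; rewrite -(span_basis bA) => /span_seqP[c ->].
exists (c 0%N), (c 1%N), (c 2%N), (c 3%N).
by rewrite !big_ord_recl big_ord0 /= addr0 !addrA.
Qed.

Lemma half0 (x : K) : 2 * x = 0 -> x = 0.
Proof. by move/eqP; rewrite mulf_eq0 (negPf nz2) => /eqP. Qed.

(** The certificate for finite differences: [u] is a combination of three vanishing values, spare
    slots having coefficient 0. *)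
Lemma comb3 (s t r x y z u : K) : x = 0 -> y = 0 -> z = 0 ->
  u = s * x + t * y + r * z -> u = 0.
Proof. by move=> -> -> -> ->; rewrite !mulr0 !addr0. Qed.

Section NormalForm.
Variables (w : F) (k1 k2 v3 v4 v5 v6 : W).
Hypothesis wA : w \in A.
Hypothesis bW : basis_of fullv [:: k1; k2; v3; v4; v5; v6].
Hypothesis ker1 : forall v, ev w k1 v = 0.
Hypothesis ker2 : forall v, ev w k2 v = 0.
Hypothesis w34 : ev w v3 v4 = 1.
Hypothesis w56 : ev w v5 v6 = 1.
Hypothesis w35 : ev w v3 v5 = 0.
Hypothesis w36 : ev w v3 v6 = 0.
Hypothesis w45 : ev w v4 v5 = 0.
Hypothesis w46 : ev w v4 v6 = 0.

(** The Pfaffian of [b + t w] has t^2-coefficient b(k1, k2), since [w] has Pfaffian 1 on v3, ...,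
    v6; this is its second difference. *)
Lemma kernel_isotropic b : b \in A -> ev b k1 k2 = 0.
Proof.
move=> bA; apply: half0.
have := pfA (memvD bA wA) bW; have := pfA (memvB bA wA) bW; have := pfA bA bW.
rewrite !pfE !evE !ker1 !ker2 w34 w35 w36 w45 w46 w56 => p0 p1 p2.
by apply: (comb3 (s := 1) (t := 1) (r := - 2) p1 p2 p0); ring.
Qed.

(** Up to sign, the form inverse to [w] on functionals on the span of v3, ..., v6, each given by its
    four values there. *)
Definition symp (x y : nat -> K) : K :=
  x 0%N * y 1%N - x 1%N * y 0%N + x 2%N * y 3%N - x 3%N * y 2%N.

Let V : seq W := [:: v3; v4; v5; v6].
Definition krow b k j : K := ev b k V`_j.

(** With b(k1, k2) = 0 this is, up to sign, the coefficient of t in the Pfaffian of [b + t w]. *)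
Lemma krow_orth b : b \in A -> symp (krow b k1) (krow b k2) = 0.
Proof.
move=> bA; have := pfA (memvD bA wA) bW; have := pfA bA bW.
rewrite /symp /krow /= !pfE !evE (kernel_isotropic bA) !ker1 !ker2.
rewrite w34 w35 w36 w45 w46 w56 => p0 p1.
by apply: (comb3 (s := 1) (t := - 1) (r := 0) p0 p1 p1); ring.
Qed.

Lemma krow_skew b c : b \in A -> c \in A ->
  symp (krow b k1) (krow c k2) = - symp (krow c k1) (krow b k2).
Proof.
move=> bA cA; apply/eqP; rewrite -addr_eq0; apply/eqP.
have := krow_orth (memvD bA cA).
rewrite /symp /krow !evE => p0.
by apply: (comb3 (s := 1) (t := - 1) (r := - 1) p0 (krow_orth bA) (krow_orth cA));
  rewrite /symp /krow; ring.
Qed.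

(** For three forms completing [w], the six rows at k1 and k2 have a Gram matrix made of the skew 3
    by 3 blocks S00, S01, S11, with S10 = S01. Its Pfaffian is, up to sign, the determinant of these
    blocks seen as vectors of K^3. A relation between them, read as a binary quadratic form and
    factored, gives two vectors of the kernel of [w] whose row spaces are orthogonal; one of these
    spaces has dimension below 3. *)
Lemma exists_common_kernel_normal : sqrt_closed K ->
  exists s1, exists s2, exists b, [/\ (s1 != 0) || (s2 != 0),
    b \in A, b \notin <[w]>%VS & forall v, ev b (s1 *: k1 + s2 *: k2) v = 0].
Proof.
move=> sqK; have w0 : w != 0.
  apply/eqP => w0; move: w34; rewrite w0 evE => /eqP.
  by rewrite eq_sym oner_eq0.
have fw : free [:: w] by rewrite seq1_free.
have [||B sB bA] := @complete_basis _ _ A [:: w] 3 fw.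
- by rewrite span_seq1 -memvE.
- by rewrite dimA.
have BA i : (i < 3)%N -> B`_i \in A.
  by move=> lti; apply: (basis_mem bA); rewrite inE mem_nth ?sB // orbT.
pose k i := if i is 0%N then k1 else k2.
pose Z i a := krow B`_a (k i).
pose S i j a b := symp (Z i a) (Z j b).
have SN i j a b : S j i b a = - S i j a b by rewrite /S /symp; ring.
have S01 a b : (a < 3)%N -> (b < 3)%N -> S 0%N 1%N b a = - S 0%N 1%N a b.
  by move=> lta ltb; rewrite /S /Z krow_skew ?BA.
have S0 i a : S i i a a = 0 by rewrite /S /symp; ring.
have S010 a : (a < 3)%N -> S 0%N 1%N a a = 0 by move=> lta; rewrite /S krow_orth ?BA.
(* It suffices to find a relation between the three rows at s1 k1 + s2 k2: its coefficients define
   the form. *)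
have finish s1 s2 (x : nat -> K) : (s1 != 0) || (s2 != 0) ->
    ~~ [&& x 0%N == 0, x 1%N == 0 & x 2%N == 0] ->
    (forall j, (j < 4)%N -> \sum_(a < 3) x a * (s1 * Z 0%N a j + s2 * Z 1%N a j) = 0) ->
  exists s1, exists s2, exists b, [/\ (s1 != 0) || (s2 != 0),
    b \in A, b \notin <[w]>%VS & forall v, ev b (s1 *: k1 + s2 *: k2) v = 0].
  move=> nzs nzx Zx; pose b := \sum_(a < 3) x a *: B`_a.
  have bE : b = x 0%N *: B`_0 + x 1%N *: B`_1 + x 2%N *: B`_2.
    by rewrite /b !big_ord_recl big_ord0 /= addr0 addrA.
  have bInA : b \in A by rewrite bE !memvD ?memvZ ?BA.
  exists s1, s2, b; split => //.
    apply: contra nzx => /vlineP[c bc].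
    have /free_seqP/(_ (fun i => if i is j.+1 then x j else - c)) := basis_free bA.
    rewrite /= sB big_ord_recl /= -/b bc scaleNr addNr => /(_ erefl) x0.
    by rewrite (x0 1%N) ?(x0 2%N) ?(x0 3%N) ?eqxx.
  apply: (ev_basis0 bW).
  have bV j : (j < 4)%N -> ev b (s1 *: k1 + s2 *: k2) V`_j = 0.
    move=> ltj; rewrite -[RHS](Zx j ltj) bE !big_ord_recl big_ord0 /Z /krow /= !evE; ring.
  have b12 := kernel_isotropic bInA.
  have b21 : ev b k2 k1 = 0 by rewrite (skA bInA) b12 oppr0.
  move=> v; rewrite !inE.
  case/or4P=> [/eqP->|/eqP->|/eqP->|/or3P[/eqP->|/eqP->|/eqP->]].
  - by rewrite evDl !evZl b21 (ev_diag nz2 _ (skA bInA)) !mulr0 addr0.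
  - by rewrite evDl !evZl b12 (ev_diag nz2 _ (skA bInA)) !mulr0 addr0.
  - exact: (bV 0%N).
  - exact: (bV 1%N).
  - exact: (bV 2%N).
  - exact: (bV 3%N).
pose T l := if l is l'.+3 then Z 1%N l' else Z 0%N l.
pose g l m := symp (T l) (T m).
(* Six vectors of K^4 are dependent, and a relation between them is a kernel vector of their Gram
   matrix. *)
have g0 : pfaff g = 0.
  apply/eqP/negPn/negP => nz.
  pose M : 'M[K]_(6, 4) := \matrix_(l, j) T l j.
  have [|x x0 xM] := @row_ker _ _ _ M; first exact: leq_ltn_trans (rank_leq_col _) _.
  case/eqP: x0; apply/rowP => i; rewrite mxE.
  pose c l := x ord0 (inord l).
  have cE (l : 'I_6) : x ord0 l = c l by rewrite /c inord_val.
  rewrite cE; apply: (pfaff_ker _ _ _ nz); rewrite // /g.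
  - by move=> l; rewrite /symp; ring.
  - by move=> l m; rewrite /symp; ring.
  have cT j : (j < 4)%N -> \sum_(l < 6) c l * T l j = 0.
    move=> ltj; have /rowP/(_ (Ordinal ltj)) := xM; rewrite !mxE => e; rewrite -[RHS]e.
    by apply: eq_bigr => l _; rewrite !mxE cE.
  move=> l ltl; transitivity (T l 0%N * (\sum_(m < 6) c m * T m 1%N)
      - T l 1%N * (\sum_(m < 6) c m * T m 0%N) + T l 2%N * (\sum_(m < 6) c m * T m 3%N)
      - T l 3%N * (\sum_(m < 6) c m * T m 2%N)).
    rewrite !mulr_sumr -!sumrB -big_split /= -sumrB.
    by apply: eq_bigr => m _; rewrite /symp; ring.
  by rewrite !cT // !mulr0 !subr0 addr0.
(* The three rows encode the skew blocks S00, S01 and S11. *)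
have [|x nzx xS] := @det3 K (nth 0 [:: g 1%N 2%N; - g 0%N 2%N; g 0%N 1%N])
   (nth 0 [:: g 1%N 5%N; - g 0%N 5%N; g 0%N 4%N])
   (nth 0 [:: g 4%N 5%N; - g 3%N 5%N; g 3%N 4%N]).
  apply: oppr_inj; rewrite oppr0 -[RHS]g0 /pfaff /pf4 /=.
  have -> : g 0%N 3%N = 0 by exact: S010.
  have -> : g 1%N 4%N = 0 by exact: S010.
  have -> : g 2%N 5%N = 0 by exact: S010.
  have -> : g 1%N 3%N = - g 0%N 4%N by exact: S01.
  have -> : g 2%N 3%N = - g 0%N 5%N by exact: S01.
  have -> : g 2%N 4%N = - g 1%N 5%N by exact: S01.
  by ring.
have xS' a b : (a < 3)%N -> (b < 3)%N ->
    x 0%N * S 0%N 0%N a b + x 1%N * S 0%N 1%N a b + x 2%N * S 1%N 1%N a b = 0.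
  wlog ltab : a b / (a < b)%N => [IH|] lta ltb.
    case: (ltngtP a b) => [?|ltba|->]; first exact: IH.
      rewrite (SN 0%N 0%N b a) (SN 1%N 1%N b a) (S01 b a) //.
      by rewrite !mulrN -!opprD (IH b a) ?oppr0.
    by rewrite !S0 S010 // !mulr0 !addr0.
  have := (xS 0%N isT, xS 1%N isT, xS 2%N isT) => /= -[[h0 h1] h2].
  case: a ltab lta => [|[|[|a]]] //; case: b ltb => [|[|[|b]]] // _ _ _.
  by apply: oppr_inj; rewrite oppr0 -h1 /g /S /T /=; ring.
(* Since S10 = S01, the relation with the coefficients of this product says that the rows for [s]
   are orthogonal to the rows for [t]. *)
have [s1 [s2 [t1 [t2 [nzs nzt e0 e1 e2]]]]] := quadratic_split sqK nzx.
pose row3 (s1 s2 : K) a j := s1 * Z 0%N a j + s2 * Z 1%N a j.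
pose X : 'M[K]_(3, 4) := \matrix_(a, j) row3 s1 s2 a j.
pose J (y : nat -> K) := nth 0 [:: y 1%N; - y 0%N; y 3%N; - y 2%N].
pose Y : 'M[K]_(4, 3) := \matrix_(j, b) J (row3 t1 t2 b) j.
have XY : X *m Y = 0.
  apply/matrixP => a b; rewrite !mxE !big_ord_recl big_ord0 !mxE /=.
  rewrite -[RHS](xS' a b) // e0 e1 e2.
  have S10 : S 1%N 0%N a b = S 0%N 1%N a b by rewrite SN S01 ?opprK.
  rewrite [in RHS]mulrDl -{2}S10 /S /symp /J /row3 /=; ring.
(* The two ranks add up to at most 4, so they cannot both be 3. *)
have rXY := mulmx0_rank_max XY.
have [rX|rX] := ltnP (\rank X) 3.
  have [y y0 yX] := row_ker rX.
  apply: (finish s1 s2 (fun a => y ord0 (inord a))) => //.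
    apply: contra y0 => /and3P[/eqP y0 /eqP y1 /eqP y2]; apply/eqP/rowP => i.
    by rewrite mxE -(inord_val i); case: i => -[|[|[|]]].
  move=> j ltj; have /rowP/(_ (Ordinal ltj)) := yX; rewrite !mxE => e; rewrite -[RHS]e.
  by apply: eq_bigr => a _; rewrite !mxE inord_val.
have rY : (\rank Y^T < 3)%N.
  rewrite mxrank_tr -(ltn_add2l (\rank X)); apply: leq_ltn_trans rXY _.
  exact: leq_trans (isT : (4 < 3 + 3)%N) (leq_add rX (leqnn 3)).
have [y y0 yY] := row_ker rY.
apply: (finish t1 t2 (fun a => y ord0 (inord a))) => //.
  apply: contra y0 => /and3P[/eqP y0 /eqP y1 /eqP y2]; apply/eqP/rowP => i.
  by rewrite mxE -(inord_val i); case: i => -[|[|[|]]].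
have yY' j : (j < 4)%N -> \sum_(a < 3) y ord0 (inord a) * J (row3 t1 t2 a) j = 0.
  move=> ltj; have /rowP/(_ (Ordinal ltj)) := yY; rewrite !mxE => e; rewrite -[RHS]e.
  by apply: eq_bigr => a _; rewrite !mxE inord_val.
case=> [|[|[|[|]]]] // _.
- by apply: oppr_inj; rewrite oppr0 -[RHS](yY' 1%N) // -sumrN; apply: eq_bigr => a _;
  rewrite -mulrN.
- by rewrite -[RHS](yY' 0%N).
- by apply: oppr_inj; rewrite oppr0 -[RHS](yY' 3%N) // -sumrN; apply: eq_bigr => a _;
  rewrite -mulrN.
- by rewrite -[RHS](yY' 2%N).
Qed.

End NormalForm.
End CommonKernel.

(** * Existence of a form of rank 2 *)

Lemma linear_basis0 (K : fieldType) (W : vectType K) (X : seq W) (phi : W -> K) :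
    (forall a u v, phi (a *: u + v) = a * phi u + phi v) ->
  basis_of fullv X -> (forall x, x \in X -> phi x = 0) -> forall v, phi v = 0.
Proof.
move=> lin bX phiX v; have phi0 : phi 0 = 0.
  by apply: (addIr (phi 0)); rewrite add0r -{1}(mul1r (phi 0)) -lin scaler0 add0r.
have : v \in <<X>>%VS by rewrite (span_basis bX) memvf.
case/span_seqP => c ->; elim/big_rec: _ => [//|i y _ IH].
by rewrite lin IH phiX ?mem_nth // mulr0 addr0.
Qed.

Section RankTwo.
Variables (K : fieldType) (F W : vectType K) (E : form_family F W).
Hypothesis nz2 : 2 != 0 :> K.
Variable A : {vspace F}.
Local Notation ev := (ev E).
Local Notation skewsym := (skewsym E).
Local Notation pf := (pf E).
Hypothesis dimW : \dim {:W} = 6%N.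
Hypothesis dimA : \dim A = 4%N.
Hypothesis skA : forall w, w \in A -> skewsym w.
Hypothesis pfA : forall w X, w \in A -> basis_of fullv X -> pf w X = 0.
Hypothesis sqK : sqrt_closed K.
Hypothesis no_iso3 : forall v1 v2 v3 v4 v5 v6,
  basis_of fullv [:: v1; v2; v3; v4; v5; v6] ->
  ~ (forall w, w \in A -> [/\ ev w v1 v2 = 0, ev w v1 v3 = 0 & ev w v2 v3 = 0]).

(** Decomposability, with factors among the functionals w(p, -). The zero form satisfies it too, so
    [w != 0] is always stated separately. *)
Definition rank2 w := exists p, exists q,
  forall u v, ev w u v = ev w p u * ev w q v - ev w q u * ev w p v.

(** For w = f /\ h, the form w(u, -) /\ w(v, -) equals w(u, v) w; take w(u, v) = 1. *)
Lemma rank2_wedge w (f h : W -> K) :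
  (forall u v, ev w u v = f u * h v - h u * f v) -> rank2 w.
Proof.
move=> wE; have [w0|[u [v e1]]] := bilinear_eq1 (fun a u v => evZl E w a u v).
  by exists 0, 0 => u v; rewrite !w0; ring.
exists u, v => x y; rewrite -[LHS]mul1r -e1 !wE; ring.
Qed.

(** A bivector of a 3-space is decomposable, so one on which all of A vanishes is an isotropic
    plane, and [k] extends it to an isotropic 3-space. For r1 != 0, the vectors x = r1 l2 - r2 l1
    and y = r1 l3 - r3 l1 satisfy x /\ y = r1 (r1 l2 /\ l3 + r2 l3 /\ l1 + r3 l1 /\ l2). *)
Lemma isotropic_plane k m1 m2 m3 s t n1 n2 n3 :
    basis_of fullv [:: k; m1; m2; m3; s; t] ->
    ~~ [&& n1 == 0, n2 == 0 & n3 == 0] ->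
  ~ (forall w, w \in A -> [/\ ev w k m1 = 0, ev w k m2 = 0, ev w k m3 = 0
      & n1 * ev w m2 m3 + n2 * ev w m3 m1 + n3 * ev w m1 m2 = 0]).
Proof.
have main l1 l2 l3 r1 r2 r3 : basis_of fullv [:: k; l1; l2; l3; s; t] -> r1 != 0 ->
  ~ (forall w, w \in A -> [/\ ev w k l1 = 0, ev w k l2 = 0, ev w k l3 = 0
      & r1 * ev w l2 l3 + r2 * ev w l3 l1 + r3 * ev w l1 l2 = 0]).
  move=> bX r0 iso; pose x := r1 *: l2 - r2 *: l1; pose y := r1 *: l3 - r3 *: l1.
  have bY : basis_of fullv [:: k; x; y; l1; s; t].
    have mY z : z \in [:: k; x; y; l1; s; t] -> z \in <<[:: k; x; y; l1; s; t]>>%VS.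
      exact: memv_span.
    apply: (basis_change bX) => // z; rewrite !inE.
    have l2E : l2 = r1^-1 *: (x + r2 *: l1).
      by apply: co_ext => i; rewrite !coE; field.
    have l3E : l3 = r1^-1 *: (y + r3 *: l1).
      by apply: co_ext => i; rewrite !coE; field.
    have [Mx My M1] : [/\ x \in <<[:: k; x; y; l1; s; t]>>%VS,
        y \in <<[:: k; x; y; l1; s; t]>>%VS & l1 \in <<[:: k; x; y; l1; s; t]>>%VS].
      by split; apply: mY; rewrite !inE eqxx ?orbT.
    case/or4P=> [/eqP->|/eqP->|/eqP->|/or3P[/eqP->|/eqP->|/eqP->]].
    - by rewrite mY ?inE ?eqxx ?orbT.
    - by rewrite mY ?inE ?eqxx ?orbT.
    - by rewrite l2E; apply/memvZ/memvD/memvZ.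
    - by rewrite l3E; apply/memvZ/memvD/memvZ.
    - by rewrite mY ?inE ?eqxx ?orbT.
    - by rewrite mY ?inE ?eqxx ?orbT.
  apply: (no_iso3 bY) => w wA; have [h1 h2 h3 h4] := iso w wA.
  rewrite /x /y !evE h1 h2 h3 (ev_diag nz2 _ (skA wA)); split; try by ring.
  rewrite -[RHS](mulr0 r1) -[in RHS]h4 (skA wA l3 l1) (skA wA l1 l2); ring.
move=> bX nz iso; move: nz; rewrite !negb_and => /or3P[] nz.
- exact: (main _ _ _ _ _ _ bX nz iso).
- have bX' : basis_of fullv [:: k; m2; m3; m1; s; t].
    apply: basis_subset bX _ _ => // z.
    by rewrite !inE => /or4P[->|->|->|/or3P[->|->|->]]; rewrite ?orbT.
  apply: (main _ _ _ _ n3 n1 bX' nz) => w /iso[-> -> -> e]; split=> //.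
  by rewrite -[RHS]e; ring.
- have bX' : basis_of fullv [:: k; m3; m1; m2; s; t].
    apply: basis_subset bX _ _ => // z.
    by rewrite !inE => /or4P[->|->|->|/or3P[->|->|->]]; rewrite ?orbT.
  apply: (main _ _ _ _ n1 n2 bX' nz) => w /iso[-> -> -> e]; split=> //.
  by rewrite -[RHS]e; ring.
Qed.

(** * Skew pencils on W/k, according to their minimal index 0, 1 or 2 *)

Section Pencil.
Variables (a b : F) (k u0 v3 v4 v5 v6 : W).
Hypotheses (aA : a \in A) (bA : b \in A) (ba : b \notin <[a]>%VS).
Hypothesis bW : basis_of fullv [:: k; u0; v3; v4; v5; v6].
Hypothesis ak : forall v, ev a k v = 0.
Hypothesis bk : forall v, ev b k v = 0.
Hypothesis au0 : forall v, ev a u0 v = 0.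
Hypothesis a34 : ev a v3 v4 = 1.
Hypothesis a56 : ev a v5 v6 = 1.
Hypothesis a35 : ev a v3 v5 = 0.
Hypothesis a36 : ev a v3 v6 = 0.
Hypothesis a45 : ev a v4 v5 = 0.
Hypothesis a46 : ev a v4 v6 = 0.

Let exists_rank2 := exists w, [/\ w \in A, w != 0 & rank2 w].

Let skewa := skA aA.
Let skewb := skA bA.

Lemma pencil_neq0 s t : (s != 0) || (t != 0) -> s *: a + t *: b != 0.
Proof.
have a0 : a != 0.
  by apply/eqP => a0; move: a34; rewrite a0 evE => /eqP; rewrite eq_sym oner_eq0.
have [-> /=|t0 _] := eqVneq t 0.
  by rewrite orbF scale0r addr0 scaler_eq0 (negPf a0) orbF.
apply: contra ba; rewrite addrC addr_eq0 => /eqP e; apply/vlineP; exists (- (s / t)).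
by rewrite -[LHS](scalerK t0) e scalerN scalerA mulrC scaleNr.
Qed.

Lemma in_basis x : exists c : nat -> K,
  x = c 0%N *: k + c 1%N *: u0 + c 2%N *: v3 + c 3%N *: v4 + c 4%N *: v5 + c 5%N *: v6.
Proof.
have : x \in <<[:: k; u0; v3; v4; v5; v6]>>%VS by rewrite (span_basis bW) memvf.
case/span_seqP => c ->; exists c.
by rewrite !big_ord_recl big_ord0 /= addr0 !addrA.
Qed.

(* A root [s] of the Pfaffian of [s a + b] on the span of the [v_i]. *)
Lemma pencil_same_kernel : (forall v, ev b u0 v = 0) -> exists_rank2.
Proof.
move=> bu0.
have [s sE] := sqK (- (ev b v3 v4 + ev b v5 v6))
  (- (ev b v3 v4 * ev b v5 v6 - ev b v3 v5 * ev b v4 v6 + ev b v3 v6 * ev b v4 v5)).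
pose c := s *: a + b; have cA : c \in A by rewrite memvD ?memvZ.
have ck v : ev c k v = 0 by rewrite !evE ak bk mulr0 addr0.
have cu0 v : ev c u0 v = 0 by rewrite !evE au0 bu0 mulr0 addr0.
have pf40 : ev c v3 v4 * ev c v5 v6 - ev c v3 v5 * ev c v4 v6 + ev c v3 v6 * ev c v4 v5 = 0.
  rewrite !evE a34 a56 a35 a36 a45 a46; move/eqP: sE; rewrite -subr_eq0 => /eqP sE.
  by rewrite -[RHS]sE; ring.
have c0 : c != 0.
  have := @pencil_neq0 s 1; rewrite oner_eq0 orbT scale1r; exact.
have sc := skA cA; clearbody c.
exists c; split => //.
have [cz|[p [q e1]]] := bilinear_eq1 (fun a u v => evZl E c a u v).
  by exists 0, 0 => u v; rewrite !cz; ring.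
exists p, q => x y; rewrite -[LHS]mul1r -e1; apply/eqP; rewrite -subr_eq0; apply/eqP.
pose L (x : nat -> K) := x 0%N *: k + x 1%N *: u0 + x 2%N *: v3 + x 3%N *: v4
                         + x 4%N *: v5 + x 5%N *: v6.
have evL xu xv : ev c (L xu) (L xv) =
      (xu 2%N * xv 3%N - xu 3%N * xv 2%N) * ev c v3 v4
    + (xu 2%N * xv 4%N - xu 4%N * xv 2%N) * ev c v3 v5
    + (xu 2%N * xv 5%N - xu 5%N * xv 2%N) * ev c v3 v6
    + (xu 3%N * xv 4%N - xu 4%N * xv 3%N) * ev c v4 v5
    + (xu 3%N * xv 5%N - xu 5%N * xv 3%N) * ev c v4 v6
    + (xu 4%N * xv 5%N - xu 5%N * xv 4%N) * ev c v5 v6.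
  rewrite /L !evE !ck !cu0 !(sc k) !(sc u0) !ck !cu0 !(ev_diag nz2 _ sc).
  rewrite (sc v3 v4) (sc v3 v5) (sc v3 v6) (sc v4 v5) (sc v4 v6) (sc v5 v6); ring.
have [xp ->] := in_basis p; have [xq ->] := in_basis q.
have [xx ->] := in_basis x; have [xy ->] := in_basis y.
rewrite -!/(L _) !evL; clearbody L.
pose mn i j := xp i * xq j - xp j * xq i; pose mn' i j := xx i * xy j - xx j * xy i.
(* The difference is the Pfaffian of [c] on p, q, x, y, that is, its Pfaffian on the v_i times a 4
   by 4 determinant of coordinates, here expanded in 2 by 2 minors. *)
rewrite -[RHS](mulr0 (mn 2%N 3%N * mn' 4%N 5%N - mn 2%N 4%N * mn' 3%N 5%N
  + mn 2%N 5%N * mn' 3%N 4%N + mn 3%N 4%N * mn' 2%N 5%N - mn 3%N 5%N * mn' 2%N 4%N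
  + mn 4%N 5%N * mn' 2%N 3%N)) -[in RHS]pf40 /mn /mn'; ring.
Qed.

(** [a] is nondegenerate modulo its kernel, spanned by [k] and [u0], so it represents every
    functional that vanishes there. *)
Lemma solve_a (phi : W -> K) : (forall c u v, phi (c *: u + v) = c * phi u + phi v) ->
  phi k = 0 -> phi u0 = 0 -> exists u, forall v, ev a u v = phi v.
Proof.
move=> lin pk pu0.
exists (phi v4 *: v3 - phi v3 *: v4 + phi v6 *: v5 - phi v5 *: v6) => v.
apply/eqP; rewrite -subr_eq0; apply/eqP; move: v.
apply: (linear_basis0 _ bW) => [c u v|v].
  by rewrite lin ev_linr; ring.
have s43 := skewa v3 v4; have s65 := skewa v5 v6.
have s53 := skewa v3 v5; have s63 := skewa v3 v6.
have s54 := skewa v4 v5; have s64 := skewa v4 v6.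
rewrite !inE !evE.
case/or4P=> [/eqP->|/eqP->|/eqP->|/or3P[/eqP->|/eqP->|/eqP->]];
  rewrite ?(skewa k) ?(skewa u0) ?ak ?au0 ?pk ?pu0 ?(ev_diag nz2 _ skewa);
  rewrite ?s43 ?s65 ?s53 ?s63 ?s54 ?s64 ?a34 ?a56 ?a35 ?a36 ?a45 ?a46; ring.
Qed.

Lemma ker_a x : (forall v, ev a x v = 0) -> exists c0, exists c1, x = c0 *: k + c1 *: u0.
Proof.
have [c xE] := in_basis x => ax.
have := (ax v3, ax v4, ax v5, ax v6); rewrite xE !evE !(ev_diag nz2 _ skewa).
rewrite (skewa v3 v4) (skewa v3 v5) (skewa v3 v6) (skewa v4 v5) (skewa v4 v6) (skewa v5 v6).
rewrite !ak !au0 a34 a56 a35 a36 a45 a46 !(mulr0, mulr1, oppr0, mulrN1, addr0, add0r).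
move=> [[[/eqP + c2] /eqP] + c4]; rewrite !oppr_eq0 => /eqP c3 /eqP c5.
by exists (c 0%N), (c 1%N); rewrite c2 c3 c4 c5 !scale0r !addr0.
Qed.

Lemma free_ku0 : free [:: k; u0].
Proof. by apply: (catl_free (Y := [:: v3; v4; v5; v6])); apply: basis_free bW. Qed.

(* The pencil has a Kronecker block of minimal index 1: both [a] and [b] vanish on
   [<k, u0, u>], and a suitable member of the pencil vanishes on the hyperplane
   [a(u, -) = 0]. *)
Lemma pencil_index1 u : (exists v, ev b u0 v != 0) ->
  (forall v, ev a u v = - ev b u0 v) -> (forall v, ev b u v = 0) -> exists_rank2.
Proof.
move=> [t0 bt0] au bu; pose f v := ev a u v.
have fD c x y : f (c *: x + y) = c * f x + f y by rewrite /f ev_linr.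
have fk : f k = 0 by rewrite /f skewa ak oppr0.
have fu0 : f u0 = 0 by rewrite /f skewa au0 oppr0.
have fu : f u = 0 by rewrite /f (ev_diag nz2 _ skewa).
have ft0 : f t0 != 0 by rewrite /f au oppr_eq0.
pose t := (f t0)^-1 *: t0.
have ft : f t = 1 by rewrite /t -[_ *: _]addr0 fD /f ev0r addr0 mulVf.
have fr : free [:: t; u; k; u0].
  rewrite free_cons; apply/andP; split.
    apply: contraTN ft0 => /span_seqP[c tE].
    have : f t = 0 by rewrite tE !big_ord_recl big_ord0 /= !fD fu fk fu0 /f ev0r; ring.
    by move/eqP; rewrite ft oner_eq0.
  rewrite free_cons free_ku0 andbT; apply: contraTN ft0 => /span_seqP[c uE].
  by rewrite negbK /f uE !big_ord_recl big_ord0 /= !evE ak au0; apply/eqP; ring.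
have [||[|q1 [|q2 []]] // _ bX] := @complete_basis _ _ fullv _ 2 fr.
- exact: subvf.
- by rewrite dimW.
pose r1 := q1 - f q1 *: t; pose r2 := q2 - f q2 *: t.
have fr0 q : f (q - f q *: t) = 0 by rewrite addrC -scaleNr fD ft; ring.
have bY : basis_of fullv [:: t; u; k; u0; r1; r2].
  have M z : z \in [:: t; u; k; u0; r1; r2] -> z \in <<[:: t; u; k; u0; r1; r2]>>%VS.
    exact: memv_span.
  have Mt : t \in <<[:: t; u; k; u0; r1; r2]>>%VS by rewrite M ?inE ?eqxx.
  have q1E : q1 = r1 + f q1 *: t by rewrite subrK.
  have q2E : q2 = r2 + f q2 *: t by rewrite subrK.
  apply: (basis_change bX) => // z; rewrite !inE.
  case/or4P=> [/eqP->|/eqP->|/eqP->|/or3P[/eqP->|/eqP->|/eqP->]].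
  - by rewrite M ?inE ?eqxx ?orbT.
  - by rewrite M ?inE ?eqxx ?orbT.
  - by rewrite M ?inE ?eqxx ?orbT.
  - by rewrite M ?inE ?eqxx ?orbT.
  - by rewrite q1E; apply: memvD; [apply: M; rewrite !inE eqxx ?orbT | apply: memvZ].
  - by rewrite q2E; apply: memvD; [apply: M; rewrite !inE eqxx ?orbT | apply: memvZ].
(* On the kernel of [f], spanned by u, k, u0, r1, r2, the pencil has r1, r2 as its only possibly
   nonzero pair; this member kills it and is therefore divisible by [f]. *)
have [s1 [s2 [nzs cr]]] : exists s1, exists s2, (s1 != 0) || (s2 != 0) /\
    s1 * ev a r1 r2 + s2 * ev b r1 r2 = 0.
  have [h|h] := boolP ((ev b r1 r2 != 0) || (- ev a r1 r2 != 0)).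
    by exists (ev b r1 r2), (- ev a r1 r2); split => //; ring.
  exists 1, 0; rewrite oner_eq0; split => //.
  move: h; rewrite negb_or !negbK oppr_eq0 => /andP[/eqP -> /eqP ->]; ring.
pose c := s1 *: a + s2 *: b.
have cA : c \in A by rewrite memvD ?memvZ.
exists c; split; [by [] | exact: pencil_neq0 |].
have sc := skA cA.
have ck y : ev c k y = 0 by rewrite /c !evE ak bk; ring.
have cu0 y : ev c u0 y = - s2 * f y by rewrite /c !evE au0 /f au; ring.
have cu y : ev c u y = s1 * f y by rewrite /c !evE bu /f; ring.
have cr12 : ev c r1 r2 = 0 by rewrite evDf !evZf.
apply: (@rank2_wedge _ f (ev c t)) => x y.
have fr1 : f r1 = 0 by exact: fr0.
have fr2 : f r2 = 0 by exact: fr0.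
clearbody c r1 r2 f.
apply/eqP; rewrite -subr_eq0; apply/eqP; move: x.
apply: (linear_basis0 _ bY) => [d x x'|x]; first by rewrite ev_linl ev_linr fD; ring.
have known z : z \in [:: t; u; k; u0] -> ev c z y - (f z * ev c t y - ev c t z * f y) = 0.
  rewrite !inE => /or4P[] /eqP ->.
  - by rewrite ft (ev_diag nz2 _ sc); ring.
  - by rewrite fu (sc u t) !cu ft; ring.
  - by rewrite fk (sc k t) !ck; ring.
  - by rewrite fu0 (sc u0 t) !cu0 ft; ring.
suff rest r : f r = 0 -> ev c r r1 = 0 -> ev c r r2 = 0 ->
    ev c r y - (f r * ev c t y - ev c t r * f y) = 0.
  rewrite -[[:: t; u; k; u0; r1; r2]]/([:: t; u; k; u0] ++ [:: r1; r2]) mem_cat.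
  case/orP => [|]; first exact: known.
  rewrite !inE => /orP[] /eqP ->; apply: rest => //; rewrite ?(ev_diag nz2 _ sc) //.
  by rewrite sc cr12 oppr0.
move=> fr_ e1 e2; move: y {known}.
apply: (linear_basis0 _ bY) => [d y y'|y]; first by rewrite !ev_linr fD; ring.
rewrite !inE fr_ mul0r sub0r opprK.
case/or4P=> [/eqP->|/eqP->|/eqP->|/or3P[/eqP->|/eqP->|/eqP->]].
- by rewrite ft (sc r t); ring.
- by rewrite fu (sc u r) cu fr_; ring.
- by rewrite fk (sc k r) ck; ring.
- by rewrite fu0 (sc u0 r) cu0 fr_; ring.
- by rewrite fr1 e1; ring.
- by rewrite fr2 e2; ring.
Qed.

(** The chain a(u1, -) = - b(u0, -), a(u2, -) = - b(u1, -) collects the coefficients of a kernel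
    vector u0 + t u1 + t^2 u2 of a + t b. If it stops early, the index is 0 or 1 and a form of rank
    2 appears; otherwise the Pfaffian forces A(k, u_i) = 0, against [isotropic_plane]. *)
Lemma pencil_rank2 : exists_rank2.
Proof.
have [|/existsNP[t0 /eqP bt0]] := EM (forall v, ev b u0 v = 0).
  exact: pencil_same_kernel.
have [c u v|||u1 au1] := @solve_a (fun v => - ev b u0 v).
- by rewrite ev_linr; ring.
- by rewrite -skewb bk.
- by rewrite (ev_diag nz2 _ skewb) oppr0.
have b01 : ev b u0 u1 = 0.
  by apply: oppr_inj; rewrite -au1 (ev_diag nz2 _ skewa) oppr0.
have [c u v|||u2 au2] := @solve_a (fun v => - ev b u1 v).
- by rewrite ev_linr; ring.
- by rewrite -skewb bk.
- by rewrite -skewb b01.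
have fr1 : free [:: u1; k; u0].
  rewrite free_cons free_ku0 andbT; apply: contra bt0 => /span_seqP[c uE].
  rewrite -oppr_eq0 -au1 uE !big_ord_recl big_ord0 /= !evE ak au0; apply/eqP; ring.
(* A dependent [u2] makes b(u1, -) a multiple of b(u0, -), and correcting [u1] by [u0] gives index
   1. *)
have [/span_seqP[c]|nu2] := boolP (u2 \in <<[:: u1; k; u0]>>%VS).
  rewrite !big_ord_recl big_ord0 /= addr0 => u2E.
  have bu1 v : ev b u1 v = c 0%N * ev b u0 v.
    apply: oppr_inj; rewrite -au2 u2E !evE ak au0 au1; ring.
  apply: (@pencil_index1 (u1 - c 0%N *: u0)) => [|v|v]; first by exists t0.
    by rewrite !evE au0 au1; ring.
  by rewrite !evE bu1; ring.
have fr2 : free [:: u2; u1; k; u0] by rewrite free_cons nu2.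
have [||[|q1 [|q2 []]] // _ bX] := @complete_basis _ _ fullv _ 2 fr2.
- exact: subvf.
- by rewrite dimW.
have bY : basis_of fullv [:: k; u0; u1; u2; q1; q2].
  apply: basis_subset bX _ _ => // z.
  by rewrite !inE => /or4P[->|->|->|/or3P[->|->|->]]; rewrite ?orbT.
have b02 : ev b u0 u2 = 0.
  by apply: oppr_inj; rewrite -au1 skewa au2 (ev_diag nz2 _ skewb) !oppr0.
have b12 : ev b u1 u2 = 0.
  by apply: oppr_inj; rewrite -au2 (ev_diag nz2 _ skewa) oppr0.
(* If [D] vanished, a combination of [u1] and [u2] would lie in the kernel of [a]. *)
pose D := ev b u0 q1 * ev b u1 q2 - ev b u0 q2 * ev b u1 q1.
have D0 : D != 0.
  apply/eqP => D0.
  have [x [y [nz [h1 h2]]]] : exists x, exists y, (x != 0) || (y != 0) /\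
      (x * ev b u0 q1 + y * ev b u1 q1 = 0 /\ x * ev b u0 q2 + y * ev b u1 q2 = 0).
    have [h|h] := boolP ((ev b u1 q1 != 0) || (- ev b u0 q1 != 0)).
      exists (ev b u1 q1), (- ev b u0 q1); do !split => //; first by ring.
      by apply: oppr_inj; rewrite oppr0 -D0 /D; ring.
    have [h'|h'] := boolP ((ev b u1 q2 != 0) || (- ev b u0 q2 != 0)).
      exists (ev b u1 q2), (- ev b u0 q2); do !split => //; last by ring.
      by rewrite -D0 /D; ring.
    exists 1, 0; rewrite oner_eq0.
    move: h h'; rewrite !negb_or !negbK !oppr_eq0.
    move=> /andP[/eqP -> /eqP ->] /andP[/eqP -> /eqP ->]; do !split => //; ring.
  have [v|c0 [c1 zE]] := @ker_a (x *: u1 + y *: u2).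
    move: v; apply: (linear_basis0 _ bY) => [c v v'|v]; first by rewrite ev_linr.
    rewrite !inE evDl !evZl au1 au2.
    case/or4P=> [/eqP->|/eqP->|/eqP->|/or3P[/eqP->|/eqP->|/eqP->]].
    - by rewrite !(skewb k) !bk; ring.
    - by rewrite (skewb u0 u1) b01 (ev_diag nz2 _ skewb); ring.
    - by rewrite b01 (ev_diag nz2 _ skewb); ring.
    - by rewrite b02 b12; ring.
    - by apply: oppr_inj; rewrite oppr0 -h1; ring.
    - by apply: oppr_inj; rewrite oppr0 -h2; ring.
  have /free_seqP/(_ (nth 0 [:: y; x; - c0; - c1])) := fr2.
  rewrite !big_ord_recl big_ord0 /= addrA (addrC (y *: _)) zE => h.
  have {}h : forall i, (i < 4)%N -> [:: y; x; - c0; - c1]`_i = 0.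
    by apply: h; apply: co_ext => i; rewrite !coE; ring.
  by move: nz; rewrite (h 0%N isT : y = 0) (h 1%N isT : x = 0) eqxx.
have perp z : z \in A -> [/\ ev z k u0 = 0, ev z k u1 = 0 & ev z k u2 = 0].
  move=> zA.
  (* The Pfaffian of s a + t b + z, expanded along the row of [k]. *)
  have P s t : ev z k u0 * (ev z u1 u2 * (s * ev a q1 q2 + t * ev b q1 q2 + ev z q1 q2)
       - (- s * ev b u0 q1 + t * ev b u1 q1 + ev z u1 q1)
         * (- s * ev b u1 q2 + t * ev b u2 q2 + ev z u2 q2)
       + (- s * ev b u0 q2 + t * ev b u1 q2 + ev z u1 q2)
         * (- s * ev b u1 q1 + t * ev b u2 q1 + ev z u2 q1))
     - ev z k u1 * (ev z u0 u2 * (s * ev a q1 q2 + t * ev b q1 q2 + ev z q1 q2)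
       - (t * ev b u0 q1 + ev z u0 q1) * (- s * ev b u1 q2 + t * ev b u2 q2 + ev z u2 q2)
       + (t * ev b u0 q2 + ev z u0 q2) * (- s * ev b u1 q1 + t * ev b u2 q1 + ev z u2 q1))
     + ev z k u2 * (ev z u0 u1 * (s * ev a q1 q2 + t * ev b q1 q2 + ev z q1 q2)
       - (t * ev b u0 q1 + ev z u0 q1) * (- s * ev b u0 q2 + t * ev b u1 q2 + ev z u1 q2)
       + (t * ev b u0 q2 + ev z u0 q2) * (- s * ev b u0 q1 + t * ev b u1 q1 + ev z u1 q1))
     - ev z k q1 * (ev z u0 u1 * (- s * ev b u1 q2 + t * ev b u2 q2 + ev z u2 q2)
       - ev z u0 u2 * (- s * ev b u0 q2 + t * ev b u1 q2 + ev z u1 q2)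
       + (t * ev b u0 q2 + ev z u0 q2) * ev z u1 u2)
     + ev z k q2 * (ev z u0 u1 * (- s * ev b u1 q1 + t * ev b u2 q1 + ev z u2 q1)
       - ev z u0 u2 * (- s * ev b u0 q1 + t * ev b u1 q1 + ev z u1 q1)
       + (t * ev b u0 q1 + ev z u0 q1) * ev z u1 u2) = 0.
    have pz : pf (s *: a + t *: b + z) [:: k; u0; u1; u2; q1; q2] = 0.
      by apply: pfA bY; rewrite memvD // memvD // memvZ.
    by rewrite -[RHS]pz pfE !evDf !evZf !ak !au0 !bk !au1 !au2 b01 b02 b12; ring.
  (* The coefficients of s^2, st and t^2 are, up to sign, D times z(k, u0), z(k, u1) and z(k, u2),
     each once the previous values are known to vanish. *)
  have e1 : ev z k u0 = 0.
    apply: (mulIf D0); rewrite mul0r; apply: (half0 nz2).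
    apply: (comb3 (s := -1) (t := -1) (r := 2) (P 1 0) (P (- 1) 0) (P 0 0)).
    by rewrite /D; ring.
  rewrite e1 in P.
  have e2 : ev z k u1 = 0.
    apply: (mulIf D0); rewrite mul0r.
    have P1 := comb3 (s := 1) (t := - 1) (r := 0) (P 1 1) (P 1 0) (P 0 0) erefl.
    apply: (comb3 (s := - 1) (t := 1) (r := - 1) P1 (P 0 1) (P 0 0)).
    by rewrite /D; ring.
  rewrite e2 in P; split => //.
  apply: (mulIf D0); rewrite mul0r; apply: (half0 nz2).
  apply: (comb3 (s := -1) (t := -1) (r := 2) (P 0 1) (P 0 (- 1)) (P 0 0)).
  by rewrite /D; ring.
have bfree : free [:: b; a].
  rewrite free_cons span_seq1 ba seq1_free; apply/eqP => a0; move: a34.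
  by rewrite a0 evE => /eqP; rewrite eq_sym oner_eq0.
have [||[|z1 [|z2 []]] // _ bAA] := @complete_basis _ _ A _ 2 bfree.
- by apply/span_subvP => z; rewrite !inE => /orP[] /eqP ->.
- by rewrite dimA.
(* [a] and [b] vanish on u0, u1, u2, so only [z1] and [z2] impose conditions on a bivector there:
   two equations in three unknowns. The zero column makes the determinant vanish. *)
have [|n nz nE] := @det3 K (nth 0 [:: ev z1 u1 u2; ev z2 u1 u2; 0])
   (nth 0 [:: ev z1 u2 u0; ev z2 u2 u0; 0]) (nth 0 [:: ev z1 u0 u1; ev z2 u0 u1; 0]).
  by rewrite /=; ring.
exfalso; apply: (isotropic_plane bY nz) => z zA; have [-> -> ->] := perp z zA.
split => //; have [c1 [c2 [c3 [c4 ->]]]] := basis4_mem bAA zA.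
have := (nE 0%N isT, nE 1%N isT) => /= -[n1 n2].
rewrite !evE au0 au1 b01 b02 b12 (skewb u0 u2) b02 (skewa u0 u2) au0.
by apply: (comb3 (s := c3) (t := c4) (r := 0) n1 n2 n2); ring.
Qed.

End Pencil.

Lemma exists_rank2_form : exists w, [/\ w \in A, w != 0 & rank2 w].
Proof.
have [w wA w0] : exists2 w, w \in A & w != 0.
  exists (vpick A); rewrite ?memv_pick // vpick0.
  by apply: contra_eq_neq dimA => ->; rewrite dimv0.
have pfw X : basis_of fullv X -> pf w X = 0 by exact: pfA.
have [|[k1 [k2 [v3 [v4 [v5 [v6 [bW ker1 ker2 nf]]]]]]]] :=
  rank4_normal_form nz2 dimW (skA wA) pfw w0; first by exists w.
have [w34 w56 [w35 w36 w45 w46]] := nf.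
have [s1 [s2 [b [nz bA bw bk]]]] := exists_common_kernel_normal nz2 dimA skA pfA
  wA bW ker1 ker2 w34 w56 w35 w36 w45 w46 sqK.
pose k := s1 *: k1 + s2 *: k2.
have kerk v : ev w k v = 0 by rewrite /k !evE ker1 ker2; ring.
have [s10|s10] := eqVneq s1 0.
  have s20 : s2 != 0 by move: nz; rewrite s10 eqxx.
  have bX : basis_of fullv [:: k; k1; v3; v4; v5; v6].
    have k2E : k2 = s2^-1 *: k by rewrite /k s10 scale0r add0r scalerK.
    apply: (basis_change bW) => // z; rewrite !inE.
    case/or4P=> [/eqP->|/eqP->|/eqP->|/or3P[/eqP->|/eqP->|/eqP->]];
      by [rewrite memv_span // !inE eqxx ?orbT | rewrite k2E memvZ // memv_span // inE eqxx].
  exact: (@pencil_rank2 w b k k1 v3 v4 v5 v6).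
have bX : basis_of fullv [:: k; k2; v3; v4; v5; v6].
  have k1E : k1 = s1^-1 *: (k - s2 *: k2) by rewrite /k addrK scalerK.
  apply: (basis_change bW) => // z; rewrite !inE.
  case/or4P=> [/eqP->|/eqP->|/eqP->|/or3P[/eqP->|/eqP->|/eqP->]];
    try by rewrite memv_span // !inE eqxx ?orbT.
  by rewrite k1E memvZ // memvB ?memvZ // memv_span // !inE eqxx ?orbT.
exact: (@pencil_rank2 w b k k2 v3 v4 v5 v6).
Qed.

End RankTwo.

(** * The forms restricted to the kernel of a form of rank 2 *)

Section ExplicitBases.
Variables (K : fieldType) (W : vectType K).

Lemma mem_span6 (x y1 y2 y3 y4 y5 y6 : W) (c1 c2 c3 c4 c5 c6 : K) :
  x = c1 *: y1 + c2 *: y2 + c3 *: y3 + c4 *: y4 + c5 *: y5 + c6 *: y6 ->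
  x \in <<[:: y1; y2; y3; y4; y5; y6]>>%VS.
Proof.
move->; do 5?[apply: memvD; last by apply/memvZ/memv_span; rewrite !inE eqxx ?orbT].
by apply/memvZ/memv_span; rewrite !inE eqxx.
Qed.

Lemma basis6_change (U : {vspace W}) x1 x2 x3 x4 x5 x6 (Y : seq W) :
  basis_of U [:: x1; x2; x3; x4; x5; x6] -> size Y = 6%N ->
  x1 \in <<Y>>%VS -> x2 \in <<Y>>%VS -> x3 \in <<Y>>%VS ->
  x4 \in <<Y>>%VS -> x5 \in <<Y>>%VS -> x6 \in <<Y>>%VS -> basis_of U Y.
Proof.
move=> bX sY h1 h2 h3 h4 h5 h6; apply: (basis_change bX) => // z; rewrite !inE.
by case/or4P=> [/eqP->|/eqP->|/eqP->|/or3P[/eqP->|/eqP->|/eqP->]].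
Qed.

End ExplicitBases.

Section KernelOfRankTwo.
Variables (K : fieldType) (F W : vectType K) (E : form_family F W).
Hypothesis nz2 : 2 != 0 :> K.
Variable A : {vspace F}.
Local Notation ev := (ev E).
Local Notation skewsym := (skewsym E).
Local Notation pf := (pf E).
Hypothesis dimW : \dim {:W} = 6%N.
Hypothesis dimA : \dim A = 4%N.
Hypothesis skA : forall w, w \in A -> skewsym w.
Hypothesis pfA : forall w X, w \in A -> basis_of fullv X -> pf w X = 0.
Hypothesis no_iso3 : forall v1 v2 v3 v4 v5 v6,
  basis_of fullv [:: v1; v2; v3; v4; v5; v6] ->
  ~ (forall w, w \in A -> [/\ ev w v1 v2 = 0, ev w v1 v3 = 0 & ev w v2 v3 = 0]).
Hypothesis no_flag15 : forall v1 v2 v3 v4 v5 v6,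
  basis_of fullv [:: v1; v2; v3; v4; v5; v6] ->
  ~ (forall w, w \in A ->
       [/\ ev w v1 v2 = 0, ev w v1 v3 = 0, ev w v1 v4 = 0 & ev w v1 v5 = 0]).

(** A space is not the union of two proper subspaces. *)
Lemma linear_prod0 (phi psi : F -> K) :
    (forall w w', phi (w + w') = phi w + phi w') ->
    (forall w w', psi (w + w') = psi w + psi w') ->
    (forall w, w \in A -> phi w * psi w = 0) ->
  (forall w, w \in A -> phi w = 0) \/ (forall w, w \in A -> psi w = 0).
Proof.
move=> phiD psiD pp.
have [|/existsNP[w1 /not_implyP[w1A /eqP n1]]] := EM (forall w, w \in A -> phi w = 0).
  by left.
right=> w2 w2A; apply/eqP; apply: contraT => n2.
have p1 : psi w1 = 0 by apply: (mulfI n1); rewrite mulr0 pp.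
have p2 : phi w2 = 0 by apply: (mulIf n2); rewrite mul0r pp.
have /eqP := pp _ (memvD w1A w2A).
by rewrite phiD psiD p1 p2 addr0 add0r mulf_eq0 (negPf n1) (negPf n2).
Qed.

Variable r : F.
Hypotheses (rA : r \in A) (r0 : r != 0) (r2 : rank2 E r).

Definition adapted x y n1 n2 n3 n4 :=
  [/\ basis_of fullv [:: x; y; n1; n2; n3; n4], ev r x y = 1
    & [/\ forall v, ev r n1 v = 0, forall v, ev r n2 v = 0,
          forall v, ev r n3 v = 0 & forall v, ev r n4 v = 0]].

Let skr := skA rA.

Lemma exists_adapted : exists x, exists y, exists n1, exists n2, exists n3, exists n4,
  adapted x y n1 n2 n3 n4.
Proof.
have [rz|[x [y e1]]] := bilinear_eq1 (fun a u v => evZl E r a u v).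
  by case/eqP: r0; apply: (ev_ext (f := E)) => u v; rewrite rz evE.
have fr : free [:: x; y].
  apply/free_seqP => c; rewrite !big_ord_recl big_ord0 /= addr0 => c0.
  have cz v : ev r (c 0%N *: x + c 1%N *: y) v = 0 by rewrite c0 evE.
  have := (cz x, cz y); rewrite !evE !(ev_diag nz2 _ skr) (skr x y) e1.
  rewrite !(mulr0, mulr1, mulrN1, add0r, addr0) => -[/eqP + c00].
  by rewrite oppr_eq0 => /eqP c01; case=> [|[|]].
have [||[|z1 [|z2 [|z3 [|z4 []]]]] // _ bX] := @complete_basis _ _ fullv _ 4 fr.
- exact: subvf.
- by rewrite dimW.
(* Projection to the orthogonal of x, y, which is the kernel of [r] because [r] has rank 2. *)
pose n z := z - ev r z y *: x + ev r z x *: y.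
have nE z : n z = z - ev r z y *: x + ev r z x *: y by [].
have zE z : z = n z + ev r z y *: x - ev r z x *: y.
  by rewrite nE; apply: co_ext => i; rewrite !coE; ring.
clearbody n.
have nker z v : ev r (n z) v = 0.
  have nx : ev r (n z) x = 0.
    by rewrite nE !evE (ev_diag nz2 _ skr) (skr x y) e1; ring.
  have ny : ev r (n z) y = 0 by rewrite nE !evE (ev_diag nz2 _ skr) e1; ring.
  have [p [q rE]] := r2.
  rewrite rE -[LHS]mul1r -e1; move: nx ny; rewrite (rE x y) (rE (n z) x) (rE (n z) y).
  move=> nx ny.
  apply: (comb3 (s := ev r q y * ev r p v - ev r p y * ev r q v)
     (t := ev r p x * ev r q v - ev r q x * ev r p v) (r := 0) nx ny nx).
  ring.
exists x, y, (n z1), (n z2), (n z3), (n z4); split => //.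
by apply: (basis6_change bX) => //;
  [apply: (mem_span6 (c1 := 1) (c2 := 0) (c3 := 0) (c4 := 0) (c5 := 0) (c6 := 0))
  |apply: (mem_span6 (c1 := 0) (c2 := 1) (c3 := 0) (c4 := 0) (c5 := 0) (c6 := 0))
  |apply: (mem_span6 (c1 := ev r z1 y) (c2 := - ev r z1 x) (c3 := 1) (c4 := 0) (c5 := 0) (c6 := 0))
  |apply: (mem_span6 (c1 := ev r z2 y) (c2 := - ev r z2 x) (c3 := 0) (c4 := 1) (c5 := 0) (c6 := 0))
  |apply: (mem_span6 (c1 := ev r z3 y) (c2 := - ev r z3 x) (c3 := 0) (c4 := 0) (c5 := 1) (c6 := 0))
  |apply: (mem_span6 (c1 := ev r z4 y) (c2 := - ev r z4 x) (c3 := 0)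
      (c4 := 0) (c5 := 0) (c6 := 1))];
  rewrite 1?{1}(zE z1) 1?{1}(zE z2) 1?{1}(zE z3) 1?{1}(zE z4);
  apply: co_ext => i; rewrite !coE; ring.
Qed.

(** Adding [r] to [w] changes the 6 by 6 Pfaffian by r(x, y) = 1 times the Pfaffian of [w] on the
    kernel of [r]. *)
Lemma adapted_pf4 x y n1 n2 n3 n4 w : adapted x y n1 n2 n3 n4 -> w \in A ->
  ev w n1 n2 * ev w n3 n4 - ev w n1 n3 * ev w n2 n4 + ev w n1 n4 * ev w n2 n3 = 0.
Proof.
move=> [bX rxy [r1 r2' r3 r4]] wA.
have := (pfA (memvD wA rA) bX, pfA wA bX).
rewrite !pfE !evDf rxy (skr n1 x) (skr n1 y) (skr n2 x) (skr n2 y)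
  (skr n3 x) (skr n3 y) (skr n4 x) (skr n4 y).
rewrite !r1 !r2' !r3 ?r4 => -[p1 p0].
by apply: (comb3 (s := 1) (t := - 1) (r := 0) p1 p0 p0); ring.
Qed.

Definition common_isotropic x y n1 n2 n3 n4 :=
  adapted x y n1 n2 n3 n4 /\ forall w, w \in A -> ev w n3 n4 = 0.

(** If w(n1, n2) != 0, shear n3, n4 into the [w]-orthogonal of n1, n2: there [w] has only its (n1,
    n2) entry, and polarizing [adapted_pf4] at [w] kills z(n3, n4) for all z. Such a [w] exists
    after a permutation, since n1, n2, n3 do not span an isotropic space. *)
Lemma exists_common_isotropic : exists x, exists y, exists n1, exists n2, exists n3, exists n4,
  common_isotropic x y n1 n2 n3 n4.
Proof.
have shear x y n1 n2 n3 n4 w : adapted x y n1 n2 n3 n4 -> w \in A -> ev w n1 n2 != 0 ->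
    exists x, exists y, exists n1, exists n2, exists n3, exists n4,
      common_isotropic x y n1 n2 n3 n4.
  move=> ad wA w12; have [bX rxy [r1 r2' r3 r4]] := ad; have sw := skA wA.
  pose c := (ev w n1 n2)^-1.
  pose p z := z + (c * ev w z n1) *: n2 - (c * ev w z n2) *: n1.
  have pE z : p z = z + (c * ev w z n1) *: n2 - (c * ev w z n2) *: n1 by [].
  have c1 : c * ev w n1 n2 = 1 by rewrite mulVf.
  clearbody p c.
  have p1 z : ev w n1 (p z) = 0.
    rewrite pE !evE (ev_diag nz2 _ sw) (sw z n1).
    by transitivity ((c * ev w n1 n2 - 1) * ev w z n1); [ring | rewrite c1 subrr mul0r].
  have p2 z : ev w n2 (p z) = 0.
    rewrite pE !evE (ev_diag nz2 _ sw) (sw n1 n2) (sw z n2).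
    by transitivity ((c * ev w n1 n2 - 1) * ev w z n2); [ring | rewrite c1 subrr mul0r].
  have ad' : adapted x y n1 n2 (p n3) (p n4).
    split=> //; last by split=> // v; rewrite pE !evE ?r1 ?r2' ?r3 ?r4; ring.
    apply: (basis6_change bX) => //; try by rewrite memv_span // !inE eqxx ?orbT.
      apply: (mem_span6 (c1 := 0) (c2 := 0) (c3 := c * ev w n3 n2) (c4 := - (c * ev w n3 n1))
        (c5 := 1) (c6 := 0)); by rewrite (pE n3); apply: co_ext => i; rewrite !coE; ring.
    apply: (mem_span6 (c1 := 0) (c2 := 0) (c3 := c * ev w n4 n2) (c4 := - (c * ev w n4 n1))
        (c5 := 0) (c6 := 1)); by rewrite (pE n4); apply: co_ext => i; rewrite !coE; ring.
  exists x, y, n1, n2, (p n3), (p n4); split=> // z zA.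
  have q1 := adapted_pf4 ad' wA; have q2 := adapted_pf4 ad' zA.
  have q3 := adapted_pf4 ad' (memvD wA zA); move: q1 q2 q3; rewrite !evDf !p1 !p2.
  move=> q1 q2 q3; apply: (mulfI w12); rewrite mulr0.
  have w34 : ev w (p n3) (p n4) = 0.
    by apply: (mulfI w12); rewrite mulr0 -[RHS]q1; ring.
  rewrite w34 in q3; apply: (comb3 (s := 1) (t := - 1) (r := 0) q3 q2 q2); ring.
have [x [y [n1 [n2 [n3 [n4 ad]]]]]] := exists_adapted.
have [bX rxy [r1 r2' r3 r4]] := ad.
have bY : basis_of fullv [:: n1; n2; n3; x; y; n4].
  apply: basis_subset bX _ _ => // z.
  by rewrite !inE => /or4P[->|->|->|/or3P[->|->|->]]; rewrite ?orbT.
have [w /not_implyP[wA nw]] : exists w, ~ (w \in A ->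
    [/\ ev w n1 n2 = 0, ev w n1 n3 = 0 & ev w n2 n3 = 0]).
  by apply/existsNP; apply: no_iso3 bY.
have [w12|] := eqVneq (ev w n1 n2) 0; last exact: shear ad wA.
have [w13|] := eqVneq (ev w n1 n3) 0; last first.
  have ad' : adapted x y n1 n3 n2 n4.
    split=> //; apply: basis_subset bX _ _ => // z.
    by rewrite !inE => /or4P[->|->|->|/or3P[->|->|->]]; rewrite ?orbT.
  exact: shear ad' wA.
have [w23|] := eqVneq (ev w n2 n3) 0; last first.
  have ad' : adapted x y n2 n3 n1 n4.
    split=> //; apply: basis_subset bX _ _ => // z.
    by rewrite !inE => /or4P[->|->|->|/or3P[->|->|->]]; rewrite ?orbT.
  exact: shear ad' wA.
by case: nw.
Qed.

(* The matrices [ev w n_i n_j], i = 1, 2, j = 3, 4, form a linear space of singular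
   2 x 2 matrices, so they have a common kernel on one side. *)
Lemma exists_common_killer : exists x, exists y, exists n, exists m1, exists m2, exists m3,
  adapted x y n m1 m2 m3 /\
  forall w, w \in A -> [/\ ev w n m1 = 0, ev w n m2 = 0 & ev w n m3 = 0].
Proof.
have main x y n1 n2 n3 n4 w : common_isotropic x y n1 n2 n3 n4 -> w \in A ->
    ev w n1 n3 != 0 ->
    exists x, exists y, exists n, exists m1, exists m2, exists m3,
    adapted x y n m1 m2 m3 /\
    forall w, w \in A -> [/\ ev w n m1 = 0, ev w n m2 = 0 & ev w n m3 = 0].
  move=> [ad iso] wA w13; have [bX rxy [r1 r2' r3 r4]] := ad; have sw := skA wA.
  (* Pivot on w(n1, n3): the 2 by 2 matrix of [w] is reduced to this single entry. *)
  pose p2 := n2 - (ev w n2 n3 / ev w n1 n3) *: n1.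
  pose p4 := n4 - (ev w n1 n4 / ev w n1 n3) *: n3.
  have p2E : p2 = n2 - (ev w n2 n3 / ev w n1 n3) *: n1 by [].
  have p4E : p4 = n4 - (ev w n1 n4 / ev w n1 n3) *: n3 by [].
  clearbody p2 p4.
  have ad' : adapted x y n1 p2 n3 p4.
    split=> //; last by split=> // v; rewrite ?p2E ?p4E !evE ?r1 ?r2' ?r3 ?r4; ring.
    apply: (basis6_change bX) => //; try by rewrite memv_span // !inE eqxx ?orbT.
      apply: (mem_span6 (c1 := 0) (c2 := 0) (c3 := ev w n2 n3 / ev w n1 n3) (c4 := 1)
        (c5 := 0) (c6 := 0)); by rewrite p2E; apply: co_ext => i; rewrite !coE; ring.
    apply: (mem_span6 (c1 := 0) (c2 := 0) (c3 := 0) (c4 := 0)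
        (c5 := ev w n1 n4 / ev w n1 n3) (c6 := 1)).
    by rewrite p4E; apply: co_ext => i; rewrite !coE; ring.
  have iso' z : z \in A -> ev z n3 p4 = 0.
    by move=> zA; rewrite p4E !evE iso // (ev_diag nz2 _ (skA zA)); ring.
  have w23 : ev w p2 n3 = 0 by rewrite p2E !evE; field.
  have w14 : ev w n1 p4 = 0 by rewrite p4E !evE; field.
  have det z : z \in A -> ev z n1 n3 * ev z p2 p4 = ev z n1 p4 * ev z p2 n3.
    move=> zA; have := adapted_pf4 ad' zA; rewrite (iso' _ zA) => q.
    apply/eqP; rewrite -subr_eq0; apply/eqP.
    by apply: (comb3 (s := - 1) (t := 0) (r := 0) q q q); ring.
  have w24 : ev w p2 p4 = 0 by apply: (mulfI w13); rewrite det // w23 w14 !mulr0.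
  (* Polarizing the determinant at [w] leaves w(n1, n3) z(p2, p4); the two off-diagonal functionals
     then have zero product. *)
  have z24 z : z \in A -> ev z p2 p4 = 0.
    move=> zA; apply: (mulfI w13); rewrite mulr0.
    have := (det _ (memvD wA zA), det _ zA); rewrite !evDf w23 w14 w24 !add0r => -[q1 q0].
    by rewrite -(subrr (ev z n1 p4 * ev z p2 n3)) -{1}q1 -q0; ring.
  have [h|h] : (forall z, z \in A -> ev z n1 p4 = 0) \/ (forall z, z \in A -> ev z p2 n3 = 0).
    by apply: linear_prod0 => [z z'|z z'|z zA]; rewrite ?evDf // -det // z24 // mulr0.
    exists x, y, p4, n1, p2, n3; split.
      have [bX' _ [? ? ? ?]] := ad'; split=> //; apply: basis_subset bX' _ _ => // z.
      by rewrite !inE => /or4P[->|->|->|/or3P[->|->|->]]; rewrite ?orbT.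
    move=> z zA; have sz := skA zA.
    by rewrite (sz n1 p4) (sz p2 p4) (sz n3 p4) h // z24 // iso' // oppr0.
  have [bX' _ _] := ad'; have bY : basis_of fullv [:: p2; n3; p4; x; y; n1].
    apply: basis_subset bX' _ _ => // z.
    by rewrite !inE => /or4P[->|->|->|/or3P[->|->|->]]; rewrite ?orbT.
  by exfalso; apply: (no_iso3 bY) => z zA; rewrite h // z24 // iso'.
have [x [y [n1 [n2 [n3 [n4 ci]]]]]] := exists_common_isotropic.
have [[bX rxy [r1 r2' r3 r4]] iso] := ci.
have [h3|] := EM (forall w, w \in A -> ev w n1 n3 = 0); last first.
  by move=> /existsNP[w /not_implyP[wA /eqP nz]]; apply: main ci wA nz.
have [h4|] := EM (forall w, w \in A -> ev w n2 n3 = 0); last first.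
  move=> /existsNP[w /not_implyP[wA /eqP nz]].
  have ci' : common_isotropic x y n2 n1 n3 n4.
    split=> //; split=> //; apply: basis_subset bX _ _ => // z.
    by rewrite !inE => /or4P[->|->|->|/or3P[->|->|->]]; rewrite ?orbT.
  exact: main ci' wA nz.
exists x, y, n3, n1, n2, n4; split.
  split=> //; apply: basis_subset bX _ _ => // z.
  by rewrite !inE => /or4P[->|->|->|/or3P[->|->|->]]; rewrite ?orbT.
move=> w wA; have sw := skA wA.
by rewrite (sw n1 n3) (sw n2 n3) h3 // h4 // iso // oppr0.
Qed.

Section Killer.
Variables x y n m1 m2 m3 : W.
Hypothesis ad : adapted x y n m1 m2 m3.
Hypothesis kill : forall w, w \in A -> [/\ ev w n m1 = 0, ev w n m2 = 0 & ev w n m3 = 0].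

(** Otherwise [n] would be orthogonal, for all of A, to the 5-space spanned by n, m1, m2, m3 and s x
    + t y. So w(n, x) and w(n, y) are independent functionals on A. *)
Lemma killer_values s t : (s != 0) || (t != 0) ->
  exists2 w, w \in A & s * ev w n x + t * ev w n y != 0.
Proof.
move=> nz; have [bX rxy _] := ad.
have [z bY] : exists z, basis_of fullv [:: n; m1; m2; m3; s *: x + t *: y; z].
  have [s0|s0] := eqVneq s 0.
    have t0 : t != 0 by move: nz; rewrite s0 eqxx.
    exists x; apply: (basis6_change bX) => //; try by rewrite memv_span // !inE eqxx ?orbT.
    apply: (mem_span6 (c1 := 0) (c2 := 0) (c3 := 0) (c4 := 0) (c5 := t^-1) (c6 := 0)).
    by rewrite s0; apply: co_ext => i; rewrite !coE; field.
  exists y; apply: (basis6_change bX) => //; try by rewrite memv_span // !inE eqxx ?orbT.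
  apply: (mem_span6 (c1 := 0) (c2 := 0) (c3 := 0) (c4 := 0) (c5 := s^-1) (c6 := - (t / s))).
  by apply: co_ext => i; rewrite !coE; field.
have [w /not_implyP[wA nw]] : exists w, ~ (w \in A ->
    [/\ ev w n m1 = 0, ev w n m2 = 0, ev w n m3 = 0 & ev w n (s *: x + t *: y) = 0]).
  by apply/existsNP; apply: no_flag15 bY.
exists w => //; apply: contra_notN nw => /eqP e; have [-> -> ->] := kill wA.
by rewrite !evE e.
Qed.

Lemma killer_basis : exists h1, exists h2, exists h3,
  [/\ basis_of A [:: r; h1; h2; h3], ev h1 n x = 1 /\ ev h1 n y = 0,
      ev h2 n x = 0 /\ ev h2 n y = 1 & ev h3 n x = 0 /\ ev h3 n y = 0].
Proof.
have [bX rxy [rn _ _ _]] := ad.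
have [|w1 w1A] := @killer_values 1 0; first by rewrite oner_eq0.
rewrite mul1r mul0r addr0 => n1.
pose c := ev w1 n y / ev w1 n x.
(* The functional w(n, y) - c w(n, x) vanishes at [w1], so [w2] is independent of [w1] for this pair
   of values. *)
have [|w2 w2A n2] := @killer_values (- c) 1; first by rewrite oner_eq0 orbT.
pose h2 := (- c * ev w2 n x + 1 * ev w2 n y)^-1 *: (w2 - (ev w2 n x / ev w1 n x) *: w1).
have h2x : ev h2 n x = 0 by rewrite /h2 !evE divfK // subrr mulr0.
have h2y : ev h2 n y = 1.
  rewrite /h2 !evE -[RHS](mulVf n2); congr (_ * _); rewrite /c; field; exact: n1.
have h2A : h2 \in A by rewrite memvZ // memvB // memvZ.
clearbody h2; pose h1 := (ev w1 n x)^-1 *: w1 - c *: h2.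
have h1x : ev h1 n x = 1 by rewrite /h1 evDf evNf !evZf h2x mulVf //; ring.
have h1y : ev h1 n y = 0 by rewrite /h1 evDf evNf !evZf h2y /c; field.
have h1A : h1 \in A by rewrite memvB // memvZ.
clearbody h1.
have fr : free [:: h1; h2; r].
  apply/free_seqP => d; rewrite !big_ord_recl big_ord0 /= addr0 => d0.
  have ez u v : ev (d 0%N *: h1 + (d 1%N *: h2 + d 2%N *: r)) u v = 0 by rewrite d0 evE.
  have := (ez n x, ez n y, ez x y); rewrite !evE h1x h1y h2x h2y !rn rxy.
  rewrite !(mulr0, mulr1, addr0, add0r) => -[[d1 d2]]; rewrite d1 d2 !(mul0r, add0r) => d3.
  by case=> [|[|[|]]].
have [||[|z []] // _ bA] := @complete_basis _ _ A _ 1 fr.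
- by apply/span_subvP => v; rewrite !inE => /or3P[] /eqP ->.
- by rewrite dimA.
exists h1, h2, (z - ev z n x *: h1 - ev z n y *: h2); split=> //.
  apply: (basis_change bA) => // v; rewrite !inE => /or4P[] /eqP ->;
    try by rewrite memv_span // !inE eqxx ?orbT.
  set h3 := z - _ - _; have -> : z = h3 + ev z n x *: h1 + ev z n y *: h2.
    by rewrite /h3 addrAC addrNK addrNK.
  by do 2?[apply: memvD]; try apply: memvZ; rewrite memv_span // !inE eqxx ?orbT.
by rewrite !evE h1x h1y h2x h2y; split; ring.
Qed.

End Killer.

End KernelOfRankTwo.

(** * The normal form *)

(** Entries i < j of four forms; with x_0, ..., x_5 the dual basis these are x_0 /\ x_1, - x_0 /\
    x_2 + x_4 /\ x_5, - x_1 /\ x_2 - x_3 /\ x_5 and x_3 /\ x_4. *)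
Definition std_table (K : fieldType) (k i j : nat) : K :=
  match k, i, j with
  | 0%N, 0%N, 1%N => 1
  | 1%N, 0%N, 2%N => - 1
  | 1%N, 4%N, 5%N => 1
  | 2%N, 1%N, 2%N => - 1
  | 2%N, 3%N, 5%N => - 1
  | 3%N, 3%N, 4%N => 1
  | _, _, _ => 0
  end.

Section NormalForm.
Variables (K : fieldType) (F W : vectType K) (E : form_family F W).
Hypothesis nz2 : 2 != 0 :> K.
Variable A : {vspace F}.
Local Notation ev := (ev E).
Local Notation skewsym := (skewsym E).
Local Notation pf := (pf E).
Hypothesis dimW : \dim {:W} = 6%N.
Hypothesis dimA : \dim A = 4%N.
Hypothesis skA : forall w, w \in A -> skewsym w.
Hypothesis pfA : forall w X, w \in A -> basis_of fullv X -> pf w X = 0.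
Hypothesis sqK : sqrt_closed K.
Hypothesis no_iso3 : forall v1 v2 v3 v4 v5 v6,
  basis_of fullv [:: v1; v2; v3; v4; v5; v6] ->
  ~ (forall w, w \in A -> [/\ ev w v1 v2 = 0, ev w v1 v3 = 0 & ev w v2 v3 = 0]).
Hypothesis no_flag15 : forall v1 v2 v3 v4 v5 v6,
  basis_of fullv [:: v1; v2; v3; v4; v5; v6] ->
  ~ (forall w, w \in A ->
       [/\ ev w v1 v2 = 0, ev w v1 v3 = 0, ev w v1 v4 = 0 & ev w v1 v5 = 0]).

(** * Removing the remaining coefficients by shears *)

Section Shears.
Variables (r h1 h2 h3 : F) (x y n l1 l2 l3 : W) (d : K).
Hypothesis bA : basis_of A [:: r; h1; h2; h3].
Hypothesis bW : basis_of fullv [:: x; y; n; l1; l2; l3].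
Hypothesis d0 : d != 0.
Hypothesis rxy : ev r x y = 1.
Hypotheses (rn : forall v, ev r n v = 0) (rl1 : forall v, ev r l1 v = 0).
Hypotheses (rl2 : forall v, ev r l2 v = 0) (rl3 : forall v, ev r l3 v = 0).
Hypotheses (n1 : ev h1 n l1 = 0 /\ ev h1 n l2 = 0 /\ ev h1 n l3 = 0).
Hypotheses (n2 : ev h2 n l1 = 0 /\ ev h2 n l2 = 0 /\ ev h2 n l3 = 0).
Hypotheses (n3 : ev h3 n l1 = 0 /\ ev h3 n l2 = 0 /\ ev h3 n l3 = 0).
Hypotheses (h1n : ev h1 n x = 1 /\ ev h1 n y = 0).
Hypotheses (h2n : ev h2 n x = 0 /\ ev h2 n y = 1).
Hypotheses (h3n : ev h3 n x = 0 /\ ev h3 n y = 0).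
Hypotheses (h1l : ev h1 l1 l2 = 0 /\ ev h1 l1 l3 = 0 /\ ev h1 l2 l3 = d).
Hypotheses (h2l : ev h2 l1 l2 = 0 /\ ev h2 l1 l3 = - d /\ ev h2 l2 l3 = 0).
Hypotheses (h3l : ev h3 l1 l2 = d /\ ev h3 l1 l3 = 0 /\ ev h3 l2 l3 = 0).

Let hA : [/\ r \in A, h1 \in A, h2 \in A & h3 \in A].
Proof. by split; apply: (basis_mem bA); rewrite !inE eqxx ?orbT. Qed.

(** On l1, l2, l3 the form c = c1 h1 + c2 h2 + c3 h3 has kernel vector c1 l1 + c2 l2 + c3 l3, and
    c(n, -) takes the values c1, c2 at x, y. The Pfaffian is thus d times the pairing of this vector
    with c1 y - c2 x. *)
Lemma shear_relations c1 c2 c3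
    (q := fun u => c1 * (c1 * ev h1 u l1 + c2 * ev h2 u l1 + c3 * ev h3 u l1)
     + c2 * (c1 * ev h1 u l2 + c2 * ev h2 u l2 + c3 * ev h3 u l2)
     + c3 * (c1 * ev h1 u l3 + c2 * ev h2 u l3 + c3 * ev h3 u l3)) :
  c1 * q y - c2 * q x = 0.
Proof.
have [_ h1A h2A h3A] := hA.
have cA : c1 *: h1 + c2 *: h2 + c3 *: h3 \in A by rewrite !memvD // memvZ.
apply: (mulfI d0); rewrite mulr0 -[RHS](pfA cA bW) pfE !evDf !evZf.
rewrite (skA h1A n x) (skA h1A n y) (skA h2A n x) (skA h2A n y) (skA h3A n x) (skA h3A n y).
rewrite (proj1 n1) (proj1 (proj2 n1)) (proj2 (proj2 n1)).
rewrite (proj1 n2) (proj1 (proj2 n2)) (proj2 (proj2 n2)).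
rewrite (proj1 n3) (proj1 (proj2 n3)) (proj2 (proj2 n3)).
rewrite (proj1 h1l) (proj1 (proj2 h1l)) (proj2 (proj2 h1l)).
rewrite (proj1 h2l) (proj1 (proj2 h2l)) (proj2 (proj2 h2l)).
rewrite (proj1 h3l) (proj1 (proj2 h3l)) (proj2 (proj2 h3l)).
by rewrite !(proj1 h1n, proj2 h1n, proj1 h2n, proj2 h2n, proj1 h3n, proj2 h3n) /q; ring.
Qed.

(** The relation is cubic in c with nine monomials, hence nine equations on the eighteen values of
    h1, h2, h3 on x, y against the l_j. The nine values left are removed by shears: three parameters
    add multiples of [n] to the l_j, six add multiples of the l_j to x and y. *)
Lemma shear_normal_form : exists X, exists H,
  [/\ basis_of fullv X, size X = 6%N, basis_of A H, size H = 4%N &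
   forall k i j, (k < 4)%N -> (i < j < 6)%N -> ev H`_k X`_i X`_j = std_table K k i j].
Proof.
have [rA h1A h2A h3A] := hA; have R := shear_relations.
have skr := skA rA; have sk1 := skA h1A; have sk2 := skA h2A; have sk3 := skA h3A.
(* In these names [a] stands for x and [b] for y; the digits are the indices of the form and of
   l. *)
have b11 : ev h1 y l1 = 0.
  by apply: (comb3 (s := 1) (t := 0) (r := 0) (R 1 0 0) (R 0 0 0) (R 0 0 0)); ring.
have a22 : ev h2 x l2 = 0.
  by apply: (comb3 (s := - 1) (t := 0) (r := 0) (R 0 1 0) (R 0 0 0) (R 0 0 0)); ring.
have b21 : ev h2 y l1 = ev h1 x l1 - ev h1 y l2.
  apply/eqP; rewrite -subr_eq0; apply/eqP; apply: (half0 nz2).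
  apply: (comb3 (s := 1) (t := - 1) (r := 0) (R 1 1 0) (R 1 (- 1) 0) (R 0 0 0)).
  by rewrite b11 a22; ring.
have b22 : ev h2 y l2 = ev h1 x l2 + ev h2 x l1.
  apply/eqP; rewrite -subr_eq0; apply/eqP; apply: (half0 nz2).
  apply: (comb3 (s := 1) (t := 1) (r := 0) (R 1 1 0) (R 1 (- 1) 0) (R 0 0 0)).
  by rewrite b11 a22; ring.
have b31 : ev h3 y l1 = - ev h1 y l3.
  apply/eqP; rewrite -addr_eq0; apply/eqP; apply: (half0 nz2).
  apply: (comb3 (s := 1) (t := - 1) (r := 0) (R 1 0 1) (R 1 0 (- 1)) (R 0 0 0)).
  by rewrite b11; ring.
have b33 : ev h3 y l3 = 0.
  apply: (half0 nz2).
  apply: (comb3 (s := 1) (t := 1) (r := 0) (R 1 0 1) (R 1 0 (- 1)) (R 0 0 0)).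
  by rewrite b11; ring.
have a32 : ev h3 x l2 = - ev h2 x l3.
  apply/eqP; rewrite -addr_eq0; apply/eqP; apply: (half0 nz2).
  apply: (comb3 (s := - 1) (t := 1) (r := 0) (R 0 1 1) (R 0 1 (- 1)) (R 0 0 0)).
  by rewrite a22; ring.
have a33 : ev h3 x l3 = 0.
  apply: (half0 nz2).
  apply: (comb3 (s := - 1) (t := - 1) (r := 0) (R 0 1 1) (R 0 1 (- 1)) (R 0 0 0)).
  by rewrite a22; ring.
have b32 : ev h3 y l2 = ev h1 x l3 + ev h3 x l1 - ev h2 y l3.
  apply/eqP; rewrite -subr_eq0; apply/eqP.
  apply: (comb3 (s := 1) (t := 0) (r := 0) (R 1 1 1) (R 0 0 0) (R 0 0 0)).
  by rewrite b11 a22 b21 b22 b31 b33 a32 a33; ring.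
clear R.
pose l1' := l1 + ev h1 x l1 *: n.
pose l2' := l2 + ev h2 y l2 *: n.
pose l3' := l3 + (ev h1 x l3 + ev h3 x l1) *: n.
have [l1E l2E l3E] : [/\ l1' = l1 + ev h1 x l1 *: n, l2' = l2 + ev h2 y l2 *: n
   & l3' = l3 + (ev h1 x l3 + ev h3 x l1) *: n] by [].
clearbody l1' l2' l3'.
pose sh z u1 u2 u3 := z + d^-1 *: (u1 *: l1' + u2 *: l2' + u3 *: l3').
have shE z u1 u2 u3 : sh z u1 u2 u3 = z + d^-1 *: (u1 *: l1' + u2 *: l2' + u3 *: l3') by [].
clearbody sh.
have genl h : h \in A -> ev h n l1 = 0 /\ ev h n l2 = 0 /\ ev h n l3 = 0 ->
  [/\ ev h n l1' = 0, ev h n l2' = 0 & ev h n l3' = 0] /\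
  [/\ ev h l1' l2' = ev h l1 l2, ev h l1' l3' = ev h l1 l3 & ev h l2' l3' = ev h l2 l3].
  move=> hAh [e1 [e2 e3]]; have sk := skA hAh.
  rewrite l1E l2E l3E !evE (sk n l1) (sk n l2) e1 e2 e3 (ev_diag nz2 _ sk).
  by split; split; ring.
have genz h z u1 u2 u3 : h \in A -> ev h n l1 = 0 /\ ev h n l2 = 0 /\ ev h n l3 = 0 ->
  [/\ ev h (sh z u1 u2 u3) n = - ev h n z,
      ev h (sh z u1 u2 u3) l1' = ev h z l1 - ev h1 x l1 * ev h n z
         - d^-1 * (u2 * ev h l1 l2 + u3 * ev h l1 l3),
      ev h (sh z u1 u2 u3) l2' = ev h z l2 - ev h2 y l2 * ev h n z
         + d^-1 * (u1 * ev h l1 l2 - u3 * ev h l2 l3) &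
      ev h (sh z u1 u2 u3) l3' = ev h z l3 - (ev h1 x l3 + ev h3 x l1) * ev h n z
         + d^-1 * (u1 * ev h l1 l3 + u2 * ev h l2 l3)].
  move=> hAh e; have sk := skA hAh.
  have [[en1 en2 en3] [e12 e13 e23]] := genl h hAh e.
  have el : ev h z l1' = ev h z l1 - ev h1 x l1 * ev h n z
    /\ ev h z l2' = ev h z l2 - ev h2 y l2 * ev h n z
    /\ ev h z l3' = ev h z l3 - (ev h1 x l3 + ev h3 x l1) * ev h n z.
    by rewrite l1E l2E l3E !evE (sk n z); split; [ring | split; ring].
  have [ez1 [ez2 ez3]] := el.
  rewrite shE !evE (sk n l1') (sk n l2') (sk n l3') (sk n z) en1 en2 en3.
  rewrite (sk l1' l2') (sk l1' l3') (sk l2' l3') e12 e13 e23 !(ev_diag nz2 _ sk) ez1 ez2 ez3.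
  by split; ring.
pose x' := sh x (ev h2 x l3) (ev h3 x l1) (- ev h2 x l1).
pose y' := sh y (- ev h3 y l2) (- ev h1 y l3) (ev h1 y l2).
have [h1nx h1ny] := h1n; have [h2nx h2ny] := h2n; have [h3nx h3ny] := h3n.
have [h1l12 [h1l13 h1l23]] := h1l; have [h2l12 [h2l13 h2l23]] := h2l.
have [h3l12 [h3l13 h3l23]] := h3l.
have := genz _ x (ev h2 x l3) (ev h3 x l1) (- ev h2 x l1) h1A n1.
have := genz _ x (ev h2 x l3) (ev h3 x l1) (- ev h2 x l1) h2A n2.
have := genz _ x (ev h2 x l3) (ev h3 x l1) (- ev h2 x l1) h3A n3.
have := genz _ y (- ev h3 y l2) (- ev h1 y l3) (ev h1 y l2) h1A n1.
have := genz _ y (- ev h3 y l2) (- ev h1 y l3) (ev h1 y l2) h2A n2.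
have := genz _ y (- ev h3 y l2) (- ev h1 y l3) (ev h1 y l2) h3A n3.
rewrite -/x' -/y' h1nx h1ny h2nx h2ny h3nx h3ny h1l12 h1l13 h1l23 h2l12 h2l13 h2l23
  h3l12 h3l13 h3l23 b11 a22 b33 a33.
move=> [Y3n Y31 Y32 Y33] [Y2n Y21 Y22 Y23] [Y1n Y11 Y12 Y13]
  [X3n X31 X32 X33] [X2n X21 X22 X23] [X1n X11 X12 X13].
have zX11 : ev h1 x' l1' = 0 by rewrite X11; ring.
have zX12 : ev h1 x' l2' = 0 by rewrite X12 b22; field.
have zX13 : ev h1 x' l3' = 0 by rewrite X13; field.
have zX21 : ev h2 x' l1' = 0 by rewrite X21; field.
have zX22 : ev h2 x' l2' = 0 by rewrite X22; ring.
have zX23 : ev h2 x' l3' = 0 by rewrite X23; field.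
have zX31 : ev h3 x' l1' = 0 by rewrite X31; field.
have zX32 : ev h3 x' l2' = 0 by rewrite X32 a32; field.
have zX33 : ev h3 x' l3' = 0 by rewrite X33; ring.
have zY11 : ev h1 y' l1' = 0 by rewrite Y11; ring.
have zY12 : ev h1 y' l2' = 0 by rewrite Y12; field.
have zY13 : ev h1 y' l3' = 0 by rewrite Y13; field.
have zY21 : ev h2 y' l1' = 0 by rewrite Y21 b21; field.
have zY22 : ev h2 y' l2' = 0 by rewrite Y22; ring.
have zY23 : ev h2 y' l3' = 0 by rewrite Y23 b32; field.
have zY31 : ev h3 y' l1' = 0 by rewrite Y31 b31; field.
have zY32 : ev h3 y' l2' = 0 by rewrite Y32; field.
have zY33 : ev h3 y' l3' = 0 by rewrite Y33; ring.
have [[g1n1 g1n2 g1n3] [g112 g113 g123]] := genl _ h1A n1.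
have [[g2n1 g2n2 g2n3] [g212 g213 g223]] := genl _ h2A n2.
have [[g3n1 g3n2 g3n3] [g312 g313 g323]] := genl _ h3A n3.
have rl1' v : ev r l1' v = 0 by rewrite l1E !evE rl1 rn; ring.
have rl2' v : ev r l2' v = 0 by rewrite l2E !evE rl2 rn; ring.
have rl3' v : ev r l3' v = 0 by rewrite l3E !evE rl3 rn; ring.
have rxy' : ev r x' y' = 1.
  rewrite /x' /y' !shE !evE !rl1' !rl2' !rl3' !(skr l1' x) !(skr l2' x) !(skr l3' x).
  by rewrite !rl1' !rl2' !rl3' rxy; ring.
have bX : basis_of fullv [:: x'; y'; n; l1'; l2'; d^-1 *: l3'].
  apply: (basis6_change bW) => //.
  - apply: (mem_span6 (c1 := 1) (c2 := 0) (c3 := 0) (c4 := - (d^-1 * ev h2 x l3))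
      (c5 := - (d^-1 * ev h3 x l1)) (c6 := ev h2 x l1)).
    by rewrite /x' shE; apply: co_ext => i; rewrite !coE; field.
  - apply: (mem_span6 (c1 := 0) (c2 := 1) (c3 := 0) (c4 := d^-1 * ev h3 y l2)
      (c5 := d^-1 * ev h1 y l3) (c6 := - ev h1 y l2)).
    by rewrite /y' shE; apply: co_ext => i; rewrite !coE; field.
  - by rewrite memv_span // !inE eqxx ?orbT.
  - apply: (mem_span6 (c1 := 0) (c2 := 0) (c3 := - ev h1 x l1) (c4 := 1) (c5 := 0) (c6 := 0)).
    by rewrite l1E; apply: co_ext => i; rewrite !coE; field.
  - apply: (mem_span6 (c1 := 0) (c2 := 0) (c3 := - ev h2 y l2) (c4 := 0) (c5 := 1) (c6 := 0)).
    by rewrite l2E; apply: co_ext => i; rewrite !coE; field.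
  - apply: (mem_span6 (c1 := 0) (c2 := 0) (c3 := - (ev h1 x l3 + ev h3 x l1)) (c4 := 0)
      (c5 := 0) (c6 := d)).
    by rewrite l3E; apply: co_ext => i; rewrite !coE; field.
clearbody x' y'.
exists [:: x'; y'; n; l1'; l2'; d^-1 *: l3'].
(* Multiples of [r] clear the entries at (x', y'); dividing the third l and the last form by [d]
   turns the entries d into 1. *)
exists [:: r; h1 - ev h1 x' y' *: r; h2 - ev h2 x' y' *: r; d^-1 *: (h3 - ev h3 x' y' *: r)].
split=> //.
  apply: (basis_change bA) => // v; rewrite !inE => /or4P[] /eqP ->.
  - by rewrite memv_span // !inE eqxx.
  - rewrite -[X in X \in _](subrK (ev h1 x' y' *: r)); set w := h1 - _.
    by apply: memvD; try apply: memvZ; rewrite memv_span // !inE eqxx ?orbT.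
  - rewrite -[X in X \in _](subrK (ev h2 x' y' *: r)); set w := h2 - _.
    by apply: memvD; try apply: memvZ; rewrite memv_span // !inE eqxx ?orbT.
  - rewrite -[X in X \in _](subrK (ev h3 x' y' *: r)); set w := h3 - _.
    rewrite -[X in X + _](scalerKV d0); set w' := d^-1 *: w.
    by apply: memvD; apply: memvZ; rewrite memv_span // !inE eqxx ?orbT.
have rv v : [/\ ev r v n = 0, ev r v l1' = 0, ev r v l2' = 0 & ev r v l3' = 0].
  by rewrite (skr n) (skr l1') (skr l2') (skr l3') rn rl1' rl2' rl3' oppr0.
have [rx1 rx2 rx3 rx4] := rv x'; have [ry1 ry2 ry3 ry4] := rv y'.
case=> [|[|[|[|k]]]] // [|[|[|[|[|i]]]]] [|[|[|[|[|[|j]]]]]] //= _;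
  rewrite ?andbF // => _;
  rewrite ?evDf ?evNf ?evZf ?evDf ?evNf ?evZf ?evZr ?evZr ?rxy' ?rx1 ?rx2 ?rx3 ?rx4
    ?ry1 ?ry2 ?ry3 ?ry4 ?rn ?rl1' ?rl2' ?rl3'
    ?X1n ?X2n ?X3n ?Y1n ?Y2n ?Y3n ?zX11 ?zX12 ?zX13 ?zX21 ?zX22 ?zX23 ?zX31 ?zX32 ?zX33
    ?zY11 ?zY12 ?zY13 ?zY21 ?zY22 ?zY23 ?zY31 ?zY32 ?zY33
    ?g1n1 ?g1n2 ?g1n3 ?g2n1 ?g2n2 ?g2n3 ?g3n1 ?g3n2 ?g3n3
    ?g112 ?g113 ?g123 ?g212 ?g213 ?g223 ?g312 ?g313 ?g323
    ?h1l12 ?h1l13 ?h1l23 ?h2l12 ?h2l13 ?h2l23 ?h3l12 ?h3l13 ?h3l23; by field.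
Qed.

End Shears.
(** A skew form h on m1, m2, m3 is a vector p(h) of K^3, and [l h] is its kernel vector, so h(l h',
    l h'') is the determinant of p(h), p(h'), p(h''). Hence the vectors [l h1], [l h2], [l h3] give
    the three forms their standard shape with constant [d]. *)
Lemma exists_normal_form : exists X, exists H,
  [/\ basis_of fullv X, size X = 6%N, basis_of A H, size H = 4%N &
   forall k i j, (k < 4)%N -> (i < j < 6)%N -> ev H`_k X`_i X`_j = std_table K k i j].
Proof.
have [r [rA r0 r2]] := exists_rank2_form nz2 dimW dimA skA pfA sqK no_iso3.
have [x [y [n [m1 [m2 [m3 [ad kill]]]]]]] := exists_common_killer nz2 dimW skA pfA no_iso3 rA r0 r2.
have [h1 [h2 [h3 [bA h1n h2n h3n]]]] := killer_basis dimA no_flag15 rA ad kill.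
have [bX rxy [rn rm1 rm2 rm3]] := ad.
have [h1A h2A h3A] : [/\ h1 \in A, h2 \in A & h3 \in A].
  by split; apply: (basis_mem bA); rewrite !inE eqxx ?orbT.
pose p1 h := ev h m2 m3; pose p2 h := ev h m3 m1; pose p3 h := ev h m1 m2.
pose d := p1 h1 * (p2 h2 * p3 h3 - p3 h2 * p2 h3) - p1 h2 * (p2 h1 * p3 h3 - p3 h1 * p2 h3)
  + p1 h3 * (p2 h1 * p3 h2 - p3 h1 * p2 h2).
(* A relation between the columns would be a bivector of m1, m2, m3 on which all of A vanishes. *)
have d0 : d != 0.
  apply/eqP => d0; have [|v nz vE] := @det3 K (nth 0 [:: p1 h1; p1 h2; p1 h3])
    (nth 0 [:: p2 h1; p2 h2; p2 h3]) (nth 0 [:: p3 h1; p3 h2; p3 h3]).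
    by rewrite -[RHS]d0 /d /=; ring.
  have bY : basis_of fullv [:: n; m1; m2; m3; x; y].
    apply: basis_subset bX _ _ => // z.
    by rewrite !inE => /or4P[->|->|->|/or3P[->|->|->]]; rewrite ?orbT.
  apply: (isotropic_plane nz2 skA no_iso3 bY nz) => w wA; have [-> -> ->] := kill w wA.
  split=> //; have [c0 [c1 [c2 [c3 ->]]]] := basis4_mem bA wA.
  have := (vE 0%N isT, vE 1%N isT, vE 2%N isT) => /= -[[v1 v2] v3].
  rewrite !evE !rm1 !rm2 !rm3; apply: (comb3 (s := c1) (t := c2) (r := c3) v1 v2 v3).
  rewrite /p1 /p2 /p3; ring.
pose l h := p1 h *: m1 + p2 h *: m2 + p3 h *: m3.
have lE h : l h = p1 h *: m1 + p2 h *: m2 + p3 h *: m3 by [].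
have lr h v : ev r (l h) v = 0 by rewrite lE !evE rm1 rm2 rm3; ring.
have ln h h' : h \in A -> ev h n (l h') = 0.
  by move=> /kill[e1 e2 e3]; rewrite lE !evE e1 e2 e3; ring.
have ll h h' h'' : h \in A -> ev h (l h') (l h'') = p1 h * (p2 h' * p3 h'' - p3 h' * p2 h'')
    - p2 h * (p1 h' * p3 h'' - p3 h' * p1 h'') + p3 h * (p1 h' * p2 h'' - p2 h' * p1 h'').
  move=> hA; have sh := skA hA; rewrite !lE !evE !(ev_diag nz2 _ sh).
  by rewrite (sh m3 m1) (sh m1 m2) (sh m2 m3) -/(p1 h) -/(p2 h) -/(p3 h); ring.
clearbody l.
have bY : basis_of fullv [:: x; y; n; l h1; l h2; l h3].
  apply: (basis6_change bX) => //; try by rewrite memv_span // !inE eqxx ?orbT.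
  (* The coefficients are the cofactors of the matrix of the p_i(h_j), divided by [d]. *)
  - apply: (mem_span6 (c1 := 0) (c2 := 0) (c3 := 0) (c4 := (p2 h2 * p3 h3 - p3 h2 * p2 h3) / d)
     (c5 := (p3 h1 * p2 h3 - p2 h1 * p3 h3) / d) (c6 := (p2 h1 * p3 h2 - p3 h1 * p2 h2) / d)).
    by rewrite !lE; apply: co_ext => i; rewrite !coE /d; field.
  - apply: (mem_span6 (c1 := 0) (c2 := 0) (c3 := 0) (c4 := (p3 h2 * p1 h3 - p1 h2 * p3 h3) / d)
     (c5 := (p1 h1 * p3 h3 - p3 h1 * p1 h3) / d) (c6 := (p3 h1 * p1 h2 - p1 h1 * p3 h2) / d)).
    by rewrite !lE; apply: co_ext => i; rewrite !coE /d; field.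
  - apply: (mem_span6 (c1 := 0) (c2 := 0) (c3 := 0) (c4 := (p1 h2 * p2 h3 - p2 h2 * p1 h3) / d)
     (c5 := (p2 h1 * p1 h3 - p1 h1 * p2 h3) / d) (c6 := (p1 h1 * p2 h2 - p2 h1 * p1 h2) / d)).
    by rewrite !lE; apply: co_ext => i; rewrite !coE /d; field.
by apply: (shear_normal_form bA bY d0); rewrite ?ll ?ln //; do ?split; rewrite ?ll ?ln // /d; ring.
Qed.

End NormalForm.

(** * Determinants of endomorphisms *)

Import passmx.

Section Determinant.
Variables (K : fieldType) (W : vectType K).
Implicit Types (g h : 'End(W)) (X : seq W).

Definition lfun_det g : K := \det (mxof (vbasis {:W}) (vbasis {:W}) g).

Let vbW := vbasisP {:W}.

Lemma lfun_detM g h : lfun_det (g \o h)%VF = lfun_det h * lfun_det g.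
Proof. by rewrite /lfun_det (mxof_comp _ _ vbW) det_mulmx. Qed.

Lemma lfun_det1 : lfun_det \1%VF = 1.
Proof. by rewrite /lfun_det (mxof1 (basis_free vbW)) det1. Qed.

Lemma lfun_detZ a g : lfun_det (a *: g) = a ^+ \dim {:W} * lfun_det g.
Proof. by rewrite /lfun_det linearZ /= detZ. Qed.

Lemma lfun_det_lker0 g : (lfun_det g != 0) = (lker g == 0%VS).
Proof.
apply/idP/idP => [dg|kg].
  rewrite -subv0; apply/subvP => u; rewrite memv_ker memv0 => /eqP gu.
  rewrite -(rVof_eq0 vbW); apply/eqP.
  have um : mxof (vbasis {:W}) (vbasis {:W}) g \in unitmx by rewrite unitmxE unitfE.
  apply: (can_inj (mulmxK um)); rewrite mul0mx -(rVof_app _ vbW) gu.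
  exact: linear0.
apply/eqP => dg; have /eqP := lfun_det1.
by rewrite -(lker0_compVf kg) lfun_detM dg mul0r eq_sym oner_eq0.
Qed.

Lemma lfun_detV g : lker g == 0%VS -> lfun_det g^-1%VF = (lfun_det g)^-1.
Proof.
move=> kg; apply: (mulfI (_ : lfun_det g != 0)); first by rewrite lfun_det_lker0.
by rewrite -lfun_detM lker0_compVf // lfun_det1 mulfV // lfun_det_lker0.
Qed.

Definition diag_lfun X (d : nat -> K) : 'End(W) :=
  linfun (sval (linear_of_free X [seq d i *: X`_i | i <- iota 0 (size X)])).

Lemma diag_lfunE X d i : free X -> (i < size X)%N -> diag_lfun X d X`_i = d i *: X`_i.
Proof.
move=> fX lti; rewrite lfunE.
case: (linear_of_free _ _) => f /= /(_ fX); rewrite size_map size_iota => /(_ erefl).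
move/(congr1 (fun s => s`_i)); rewrite (nth_map 0) // => ->.
by rewrite (nth_map 0%N) ?size_iota // nth_iota.
Qed.

Lemma lfun_basis_ext X g h : basis_of fullv X ->
  (forall i, (i < size X)%N -> g X`_i = h X`_i) -> g = h.
Proof.
move=> bX e; apply/(fullv_lfunP _ _ (span_basis bX)) => u /(nthP 0)[i lti <-].
exact: e.
Qed.

Lemma lfun_det_diag X d : basis_of fullv X ->
  lfun_det (diag_lfun X d) = \prod_(i < \dim {:W}) d i.
Proof.
move=> bX; have sX := basis_size bX.
pose tX : (\dim {:W}).-tuple W := tcast sX (in_tuple X).
have tXE : tX = X :> seq W by rewrite val_tcast.
have btX : basis_of fullv tX by rewrite tXE.
pose e := vbasis {:W}.
(* The base changes to [X] and back are inverse, so their determinants cancel. *)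
have comm : mxof e tX \1 *m mxof tX e \1 = 1%:M.
  by rewrite -(mxof_comp _ _ btX) comp_lfun1l (mxof1 (basis_free vbW)).
have -> : diag_lfun X d = (\1 \o (diag_lfun X d \o \1))%VF.
  by rewrite comp_lfun1l comp_lfun1r.
rewrite /lfun_det (mxof_comp _ _ btX) (mxof_comp _ _ btX) !det_mulmx.
rewrite mulrAC -det_mulmx comm det1 mul1r.
have -> : mxof tX tX (diag_lfun X d) = diag_mx (\row_i d i).
  apply/matrixP => i j; rewrite !mxE /= vecof_delta tXE.
  rewrite diag_lfunE ?sX ?(basis_free bX) // linearZ /= -tXE coord_free ?(basis_free btX) //.
  by rewrite mulr_natr.
by rewrite det_diag; apply: eq_bigr => i _; rewrite mxE.
Qed.

Lemma inv_comp g h : lker g == 0%VS -> lker h == 0%VS ->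
  ((g \o h)^-1 = h^-1 \o g^-1)%VF.
Proof.
move=> kg kh; have kgh : lker (g \o h)%VF == 0%VS.
  by rewrite -lfun_det_lker0 lfun_detM mulf_neq0 ?lfun_det_lker0.
apply/lfunP => u; apply: (lker0P kgh).
by rewrite lker0_lfunVK // !comp_lfunE /= !lker0_lfunVK.
Qed.

Lemma inv_lfunE g h : (forall u, g (h u) = u) -> (forall u, h (g u) = u) -> (g^-1 = h)%VF.
Proof.
move=> gh hg; have kg : lker g == 0%VS by apply/lker0P; apply: can_inj hg.
by apply/lfunP => u; apply: (lker0P kg); rewrite gh lker0_lfunVK.
Qed.

End Determinant.

(** * Limits of quadratic curves *)

Section PolynomialCurves.
Variables (K : fieldType) (U : vectType K).
Hypothesis char0 : forall n, (n%:R == 0 :> K) = (n == 0%N).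

Lemma natr_inj0 : injective (fun n => n%:R : K).
Proof.
move=> m n; wlog lemn : m n / (m <= n)%N => [IH|] e.
  by case/orP: (leq_total m n) => le; [|apply/esym]; apply: IH.
apply/eqP; rewrite eqn_leq lemn /= -subn_eq0 -char0 natrB // subr_eq0 e //.
Qed.

(** The points 1, ..., [size q] are more roots than a nonzero [q] can have. *)
Lemma poly_nonzero_eq0 (q : {poly K}) : (forall t, t != 0 -> q.[t] = 0) -> q = 0.
Proof.
move=> q0; apply/eqP; apply: contraT => nz.
pose s := [seq n.+1%:R : K | n <- iota 0 (size q)].
have := max_poly_roots (rs := s) nz; rewrite size_map size_iota ltnn; apply.
  by apply/allP => _ /mapP[n _ ->]; rewrite rootE q0 // char0.
by rewrite map_inj_uniq ?iota_uniq // => m n /natr_inj0[].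
Qed.

Lemma eval_mpoly_curve (p : {mpoly K[\dim {:U}]}) (a b c : U) :
  exists q : {poly K}, forall t, q.[t] = eval_mpoly p (a + t *: b + t ^+ 2 *: c).
Proof.
pose h i : {poly K} := (coord (vbasis {:U}) i a)%:P + (coord (vbasis {:U}) i b)%:P * 'X
  + (coord (vbasis {:U}) i c)%:P * 'X^2.
exists (\sum_(m <- msupp p) (p@_m)%:P * \prod_i h i ^+ m i) => t.
rewrite horner_sum /eval_mpoly mevalE; apply: eq_bigr => m _.
rewrite hornerM hornerC horner_prod; congr (_ * _); apply: eq_bigr => i _.
rewrite horner_exp; congr (_ ^+ _); rewrite /h !hornerE !linearD !linearZ /=; ring.
Qed.

(** An equation of [X] restricts to a polynomial in t vanishing for t != 0, hence also at 0. *)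
Lemma closed_curve_limit (S X : set U) (a b c : U) : zariski_closed_in S X -> S a ->
  (forall t, t != 0 -> X (a + t *: b + t ^+ 2 *: c)) -> X a.
Proof.
move=> [I XE] Sa curve; rewrite XE; split=> // p Ip.
have [q qE] := eval_mpoly_curve p a b c.
have q0 : q = 0.
  apply: poly_nonzero_eq0 => t t0; rewrite qE.
  by have := curve t t0; rewrite XE => -[_ /(_ p Ip)].
by have := qE 0; rewrite q0 horner0 scale0r expr0n scale0r !addr0.
Qed.

(* A quadratic curve [t |-> E0 + t E1 + t ^ 2 E2], given outside of [t = 0], has its
   coefficients recovered by interpolation at 1, -1 and 2. *)
Lemma quadratic_limit (T : Type) (L : T -> U -> K) (S X : set U) (Psi : K -> U)
    (E0 E1 E2 : T -> K) :
    (forall k a u v, L k (a *: u + v) = a * L k u + L k v) ->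
    (forall u v, (forall k, L k u = L k v) -> u = v) ->
    zariski_closed_in S X -> (forall t, t != 0 -> X (Psi t)) ->
    (forall k t, t != 0 -> L k (Psi t) = E0 k + t * E1 k + t ^+ 2 * E2 k) ->
  exists u, (forall k, L k u = E0 k) /\ (S u -> X u).
Proof.
move=> Llin Lsep closed XPsi PsiE.
have L0 k : L k 0 = 0.
  by apply: (addIr (L k 0)); rewrite add0r -{1}(mul1r (L k 0)) -Llin scaler0 add0r.
have LD k u v : L k (u + v) = L k u + L k v by rewrite -[u in LHS]scale1r Llin mul1r.
have LZ k a u : L k (a *: u) = a * L k u by rewrite -[_ *: _]addr0 Llin L0 addr0.
have n2 : (2%:R : K) != 0 by rewrite char0.
have n3 : (3%:R : K) != 0 by rewrite char0.
pose u1 := 2^-1 *: (Psi 1 + (-1) *: Psi (- 1)).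
(* Psi(2), minus 2 E1 = Psi(1) - Psi(-1), minus E0 + E2, is 3 E2. *)
pose u2 := 3^-1 *: (Psi 2 + (-1) *: (Psi 1 + (-1) *: Psi (- 1))
  + (- 2^-1) *: (Psi 1 + Psi (- 1))).
pose u0 := 2^-1 *: (Psi 1 + Psi (- 1)) + (-1) *: u2.
have E k : [/\ L k u0 = E0 k, L k u1 = E1 k & L k u2 = E2 k].
  rewrite /u0 /u1 /u2 !(LD, LZ) !PsiE ?oppr_eq0 ?oner_eq0 //.
  by split; field; rewrite ?n2 ?n3.
clearbody u0 u1 u2; exists u0; split=> [k|Su]; first by have [] := E k.
apply: (closed_curve_limit closed Su (b := u1) (c := u2)) => t t0.
suff -> : u0 + t *: u1 + t ^+ 2 *: u2 = Psi t by exact: XPsi.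
by apply: Lsep => k; rewrite !LD !LZ PsiE //; have [-> -> ->] := E k.
Qed.

End PolynomialCurves.

(** * The space of bilinear forms and the action of [SL] *)

(** Locked and typed in [K] rather than [K^o], so that values are opaque scalars for [ring]. *)
HB.lock Definition app2 (K : fieldType) (W : vectType K) (w : bilform K W) (u v : W) : K :=
  w u v.

Section BilinearForms.
Variables (K : fieldType) (W : vectType K).

Lemma app2_lin_form a (w w' : bilform K W) u v :
  app2 (a *: w + w') u v = a * app2 w u v + app2 w' u v.
Proof. by rewrite app2.unlock !(add_lfunE, scale_lfunE). Qed.

Lemma app2_linl (w : bilform K W) a u u' v :
  app2 w (a *: u + u') v = a * app2 w u v + app2 w u' v.
Proof. by rewrite app2.unlock linearP add_lfunE scale_lfunE. Qed.

Lemma app2_linr (w : bilform K W) a u v v' :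
  app2 w u (a *: v + v') = a * app2 w u v + app2 w u v'.
Proof. by rewrite app2.unlock linearP. Qed.

Lemma app2_ext (w w' : bilform K W) :
  (forall u v, app2 w u v = app2 w' u v) -> w = w'.
Proof.
by rewrite app2.unlock => e; apply/lfunP => u; apply/lfunP => v; apply: e.
Qed.

Definition bil_family : form_family (bilform K W) W :=
  FormFamily app2_lin_form app2_linl app2_linr app2_ext.

Lemma app20f u v : app2 (0 : bilform K W) u v = 0.
Proof. exact: (ev0f bil_family). Qed.

Lemma app2Zf a (w : bilform K W) u v : app2 (a *: w) u v = a * app2 w u v.
Proof. exact: (evZf bil_family). Qed.

Lemma app2Df (w w' : bilform K W) u v : app2 (w + w') u v = app2 w u v + app2 w' u v.
Proof. exact: (evDf bil_family). Qed.

Lemma app2Nf (w : bilform K W) u v : app2 (- w) u v = - app2 w u v.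
Proof. exact: (evNf bil_family). Qed.

Lemma app2Zl (w : bilform K W) a u v : app2 w (a *: u) v = a * app2 w u v.
Proof. exact: (evZl bil_family). Qed.

Lemma app2Zr (w : bilform K W) a u v : app2 w u (a *: v) = a * app2 w u v.
Proof. exact: (evZr bil_family). Qed.

Lemma skewsymP (w : bilform K W) : skew_forms W w <-> skewsym bil_family w.
Proof. by rewrite /skewsym /= app2.unlock; split=> s u v; exact: s. Qed.

Lemma app2_act (g : 'End(W)) w u v :
  app2 (act g w) u v = app2 w (g^-1%VF u) (g^-1%VF v).
Proof. by rewrite app2.unlock actE. Qed.

Lemma app2_wedge (f h : dual K W) u v :
  app2 (wedge f h) u v = (f u : K) * h v - (h u : K) * f v.
Proof. by rewrite app2.unlock wedgeE. Qed.

Lemma SL_comp (g h : 'End(W)) : SL g -> SL h -> SL (g \o h)%VF.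
Proof.
rewrite /SL /= -/(lfun_det g) -/(lfun_det h) -/(lfun_det _) => dg dh.
by rewrite lfun_detM dg dh mulr1.
Qed.

Lemma SL_lker0 (g : 'End(W)) : SL g -> lker g == 0%VS.
Proof. by rewrite -lfun_det_lker0 => dg; rewrite /lfun_det dg oner_eq0. Qed.

Lemma SL_inv (g : 'End(W)) : SL g -> SL g^-1%VF.
Proof.
move=> dg; have := lfun_detV (SL_lker0 dg).
by rewrite /lfun_det dg invr1.
Qed.

End BilinearForms.

Section Tensors.
Variables (K : fieldType) (V W : vectType K).
Implicit Types (phi : 'Hom(V, bilform K W)) (x : V) (u v : W).

Definition app3 phi x u v : K := app2 (phi x) u v.

Lemma app3_lin a phi psi x u v :
  app3 (a *: phi + psi) x u v = a * app3 phi x u v + app3 psi x u v.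
Proof. by rewrite /app3 app2.unlock !(add_lfunE, scale_lfunE). Qed.

Lemma app3_ext phi psi : (forall x u v, app3 phi x u v = app3 psi x u v) -> phi = psi.
Proof. by move=> e; apply/lfunP => x; apply: app2_ext => u v; apply: e. Qed.

Lemma app3_act g phi x u v :
  app3 (act g \o phi)%VF x u v = app3 phi x (g^-1%VF u) (g^-1%VF v).
Proof. by rewrite /app3 comp_lfunE app2_act. Qed.

Lemma tensor_act_comp (g h : 'End(W)) phi : lker g == 0%VS -> lker h == 0%VS ->
  (act (g \o h) \o phi = act g \o (act h \o phi))%VF.
Proof.
by move=> kg kh; apply: app3_ext => x u v; rewrite !app3_act inv_comp // !comp_lfunE.
Qed.

Lemma tensor_act1 phi : (act \1 \o phi = phi)%VF.
Proof.
apply: app3_ext => x u v; rewrite app3_act (inv_lfunE (h := \1%VF)) ?id_lfunE //;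
  by move=> z; rewrite !id_lfunE.
Qed.

End Tensors.

(** * Destabilizing one-parameter subgroups *)

Lemma app2_basis_ext (K : fieldType) (W : vectType K) (X : seq W) (w w' : bilform K W) :
    basis_of fullv X ->
    (forall i j, (i < size X)%N -> (j < size X)%N -> app2 w X`_i X`_j = app2 w' X`_i X`_j) ->
  w = w'.
Proof.
move=> bX e; apply: app2_ext => u v; apply/eqP; rewrite -subr_eq0; apply/eqP; move: u.
apply: (linear_basis0 _ bX) => [a u u'|_ /(nthP 0)[i lti <-]].
  by rewrite !app2_linl; ring.
move: v; apply: (linear_basis0 _ bX) => [a v v'|_ /(nthP 0)[j ltj <-]].
  by rewrite !app2_linr; ring.
by rewrite e // subrr.
Qed.

Section Instability.
Variables (K : fieldType) (W : vectType K).
Hypothesis char0 : forall n, (n%:R == 0 :> K) = (n == 0%N).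
Variables (A : {vspace bilform K W}) (X : seq W) (cls : nat -> nat).
Hypothesis skA : forall w, w \in A -> skew_forms W w.
Hypothesis bX : basis_of fullv X.

(* The weights 0, 1, -1 are encoded by the classes 0, 1, 2. *)
Definition weight_pow (t : K) (c : nat) := match c with 1%N => t | 2%N => t^-1 | _ => 1 end.

(* Indicators of the pairs of classes of total weight 0, 1 and 2. *)
Let cf0 (c c' : nat) : K :=
  match c, c' with 0%N, 0%N | 1%N, 2%N | 2%N, 1%N => 1 | _, _ => 0 end.
Let cf1 (c c' : nat) : K := match c, c' with 0%N, 1%N | 1%N, 0%N => 1 | _, _ => 0 end.
Let cf2 (c c' : nat) : K := match c, c' with 1%N, 1%N => 1 | _, _ => 0 end.

Hypothesis cls_bound : forall i, (cls i <= 2)%N.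
Hypothesis weight_prod : forall t, t != 0 -> \prod_(i < \dim {:W}) weight_pow t (cls i) = 1.
(** The pairs of negative total weight, namely -1 against -1 or 0; their vanishing on A is what
    makes the limit exist. *)
Hypothesis nonneg : forall w i j, w \in A -> (i < size X)%N -> (j < size X)%N ->
  cls i = 2%N -> cls j != 1%N -> app2 w X`_i X`_j = 0.
Variable i0 : nat.
Hypotheses (lti0 : (i0 < size X)%N) (cls_i0 : cls i0 = 1%N).

Let D t := diag_lfun X (fun i => weight_pow t (cls i)).

Let DE t i : (i < size X)%N -> D t X`_i = weight_pow t (cls i) *: X`_i.
Proof. by move=> lti; rewrite /D diag_lfunE // (basis_free bX). Qed.

Let DV t : t != 0 -> ((D t)^-1 = D t^-1)%VF.
Proof.
have comp s : s != 0 -> (D s \o D s^-1 = \1)%VF.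
  move=> s0; apply: (lfun_basis_ext bX) => i lti.
  rewrite comp_lfunE DE // linearZ /= DE // scalerA id_lfunE.
  have -> : weight_pow s^-1 (cls i) * weight_pow s (cls i) = 1.
    by case: (cls i) => [|[|[|k]]] /=; rewrite ?mulr1 ?invrK ?mulVf ?mulfV.
  by rewrite scale1r.
move=> t0; apply: inv_lfunE => u; rewrite -comp_lfunE ?comp ?id_lfunE //.
by rewrite -{2}[t]invrK comp ?invr_eq0 // id_lfunE.
Qed.

Let D_SL t : t != 0 -> SL (D t).
Proof. by move=> t0; rewrite /SL /= -/(lfun_det _) lfun_det_diag // weight_prod. Qed.

Section Tensor.
Variables (V : vectType K) (phi : 'Hom(V, bilform K W)).
Hypothesis phiA : forall x, phi x \in A.

Let Psi t := (act (D t^-1) \o phi)%VF.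

Let PsiE t x i j : t != 0 -> (i < size X)%N -> (j < size X)%N ->
    app3 (Psi t) x X`_i X`_j
      = weight_pow t (cls i) * weight_pow t (cls j) * app3 phi x X`_i X`_j.
Proof.
move=> t0 lti ltj; rewrite app3_act DV ?invr_eq0 // invrK !DE //.
by rewrite /app3 app2Zl app2Zr mulrA.
Qed.

Let skphi x u v : app3 phi x v u = - app3 phi x u v.
Proof. by rewrite /app3; apply: (skewsymP (phi x)).1; apply: skA. Qed.

Let app3_neg x i j : (i < size X)%N -> (j < size X)%N ->
  (cls i = 2%N /\ cls j != 1%N) \/ (cls j = 2%N /\ cls i != 1%N) ->
  app3 phi x X`_i X`_j = 0.
Proof.
move=> lti ltj [[e ne]|[e ne]]; first exact: (nonneg (phiA x) lti ltj e ne).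
by rewrite skphi /app3 (nonneg (phiA x) ltj lti e ne) oppr0.
Qed.

(** Transforming by [D t^-1] multiplies the (i, j) value by t to the total weight, which is 0, 1 or
    2 wherever the value is nonzero. The limit keeps the part of weight 0. The orbit is closed only
    inside the skew tensors, so the limit is also shown to be skew. *)
Lemma unstable_limit : zariski_closed_in (@skew_tensors K W V) (SL_orbit phi) ->
  exists Phi0 : 'Hom(V, bilform K W), SL_orbit phi Phi0 /\
    forall x i j, (i < size X)%N -> (j < size X)%N ->
      app3 Phi0 x X`_i X`_j = cf0 (cls i) (cls j) * app3 phi x X`_i X`_j.
Proof.
move=> closed.
pose I := (V * ('I_(size X) * 'I_(size X)))%type.
pose L (k : I) (psi : 'Hom(V, bilform K W)) := app3 psi k.1 X`_(k.2.1) X`_(k.2.2).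
pose E cf (k : I) := cf (cls k.2.1) (cls k.2.2) * L k phi.
have Llin k a psi psi' : L k (a *: psi + psi') = a * L k psi + L k psi'.
  exact: app3_lin.
have Lsep psi psi' : (forall k, L k psi = L k psi') -> psi = psi'.
  move=> e; apply/lfunP => x; apply: (app2_basis_ext bX) => i j lti ltj.
  exact: (e (x, (Ordinal lti, Ordinal ltj))).
have orbPsi t : t != 0 -> SL_orbit phi (Psi t).
  by move=> t0; exists (D t^-1) => //; apply: D_SL; rewrite invr_eq0.
have PsiL k t : t != 0 -> L k (Psi t) = E cf0 k + t * E cf1 k + t ^+ 2 * E cf2 k.
  move=> t0; rewrite /L PsiE // -/(L k phi) /E.
  have := @app3_neg k.1 _ _ (ltn_ord k.2.1) (ltn_ord k.2.2); rewrite -/(L k phi).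
  have := cls_bound k.2.1; have := cls_bound k.2.2.
  case: (cls k.2.1) => [|[|[|c]]] //; case: (cls k.2.2) => [|[|[|c']]] // _ _ Lk;
    rewrite /cf0 /cf1 /cf2 /=; first [by rewrite Lk; [ring | auto] | by field].
have [Phi0 [LPhi0 orbPhi0]] : exists Phi0 : 'Hom(V, bilform K W),
    (forall k, L k Phi0 = E cf0 k) /\ (skew_tensors Phi0 -> SL_orbit phi Phi0).
  exact: (@quadratic_limit K 'Hom(V, bilform K W) char0 I L (@skew_tensors K W V)
    (SL_orbit phi) Psi (E cf0) (E cf1) (E cf2) Llin Lsep closed orbPsi PsiL).
have Phi0E x i j : (i < size X)%N -> (j < size X)%N ->
      app3 Phi0 x X`_i X`_j = cf0 (cls i) (cls j) * app3 phi x X`_i X`_j.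
  by move=> lti ltj; have := LPhi0 (x, (Ordinal lti, Ordinal ltj)).
exists Phi0; split=> //; apply: orbPhi0 => x; apply/skewsymP => u v.
have Phi0N : app3 Phi0 x v u + app3 Phi0 x u v = 0; last first.
  by apply/eqP; rewrite -addr_eq0; apply/eqP.
have bil2 : forall u v, app3 Phi0 x v u + app3 Phi0 x u v = 0.
  move=> {}u {}v; move: u.
  apply: (linear_basis0 _ bX) => [a u u'|_ /(nthP 0)[i lti <-]].
    by rewrite /app3 app2_linr app2_linl; ring.
  move: v; apply: (linear_basis0 _ bX) => [a v v'|_ /(nthP 0)[j ltj <-]].
    by rewrite /app3 app2_linr app2_linl; ring.
  rewrite !Phi0E // (skphi x X`_i).
  case: (cls i) => [|[|[|c]]]; case: (cls j) => [|[|[|c']]] /=; ring.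
exact: bil2.
Qed.

(** The limit is g phi for some g in SL and is fixed by every [D t], so the conjugates g^-1 D_t g
    stabilize phi. They are distinct: after conjugation back they scale [X_i0], of weight 1, by
    t. *)
Lemma weights_infinite_stabilizer :
  zariski_closed_in (@skew_tensors K W V) (SL_orbit phi) ->
  ~ finite_set (SL_stabilizer phi).
Proof.
move=> /unstable_limit[Phi0 [[g gSL gPhi] Phi0E]] /finite_seqP[s sE].
have kg := SL_lker0 gSL.
have fixD t : t != 0 -> (act (D t) \o Phi0 = Phi0)%VF.
  move=> t0; apply/lfunP => x; apply: (app2_basis_ext bX) => i j lti ltj.
  rewrite -!/(app3 _ _ _ _) app3_act DV // !DE // /app3 app2Zl app2Zr -!/(app3 _ _ _ _).
  rewrite Phi0E //; have := cls_bound i; have := cls_bound j.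
  by case: (cls i) => [|[|[|c]]] //; case: (cls j) => [|[|[|c']]] // _ _;
    rewrite /cf0 /= ?invrK; field.
pose h t := (g^-1 \o (D t \o g))%VF.
have hstab t : t != 0 -> SL_stabilizer phi (h t).
  move=> t0; have kD := SL_lker0 (D_SL t0); split.
    by apply: SL_comp; [exact: SL_inv | apply: SL_comp => //; exact: D_SL].
  have kgV := SL_lker0 (SL_inv gSL).
  have kDg := SL_lker0 (SL_comp (D_SL t0) gSL).
  rewrite /h tensor_act_comp // tensor_act_comp // gPhi fixD // -gPhi.
  by rewrite -tensor_act_comp // lker0_compVf // tensor_act1.
have hinj t t' : h t = h t' -> t = t'.
  move/(congr1 (fun k : 'End(W) => g (k (g^-1%VF X`_i0)))).
  rewrite /h !comp_lfunE !lker0_lfunVK // !DE // cls_i0 /= => /eqP.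
  rewrite -subr_eq0 -scalerBl scaler_eq0 subr_eq0 => /orP[/eqP //|].
  by rewrite (negPf (free_not0 (basis_free bX) _)) // mem_nth.
(* One more stabilizer element than the list [s] has entries. *)
pose r := [seq h n.+1%:R | n <- iota 0 (size s).+1].
have : (size r <= size s)%N.
  apply: uniq_leq_size.
    by rewrite map_inj_uniq ?iota_uniq // => m n /hinj /(natr_inj0 char0) [].
  move=> _ /mapP[n _ ->]; have : SL_stabilizer phi (h n.+1%:R) by apply: hstab; rewrite char0.
  by rewrite sE.
by rewrite size_map size_iota ltnn.
Qed.
End Tensor.

Lemma unstable_of_weights : ~ stable A.
Proof.
move=> [phi [_ imphi orbit_closed fin]].
apply: weights_infinite_stabilizer orbit_closed fin => x.
by have := memv_img phi (memvf x); rewrite imphi.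
Qed.

End Instability.

(** * The two destabilizing weight systems *)

Section StableSystems.
Variables (K : fieldType) (W : vectType K) (A : {vspace bilform K W}).
Hypothesis char0 : forall n, (n%:R == 0 :> K) = (n == 0%N).
Hypothesis dimW : \dim {:W} = 6%N.
Hypothesis skA : forall w, w \in A -> skew_forms W w.
Hypothesis stableA : stable A.
Local Notation ev := (ev (@bil_family K W)).

Lemma big_ord_dimW (c : nat -> K) : \prod_(i < \dim {:W}) c i = \prod_(i < 6) c i.
Proof. by rewrite -(big_mkord xpredT c) dimW big_mkord. Qed.

(** Weight -1 on v1, v2, v3 and 1 on the others: negative pairs lie in the span of v1, v2, v3. *)
Lemma stable_no_iso3 v1 v2 v3 v4 v5 v6 :
  basis_of fullv [:: v1; v2; v3; v4; v5; v6] ->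
  ~ (forall w, w \in A -> [/\ ev w v1 v2 = 0, ev w v1 v3 = 0 & ev w v2 v3 = 0]).
Proof.
move=> bX iso; pose cls i := if (i < 3)%N then 2%N else 1%N.
apply: (@unstable_of_weights K W char0 A _ cls skA bX _ _ _ 3) stableA => //.
- by move=> i; rewrite /cls; case: ifP.
- by move=> t t0; rewrite (big_ord_dimW (fun i => weight_pow t (cls i)))
    !big_ord_recl big_ord0 /=; field.
move=> w i j wA _ _; have [h12 h13 h23] := iso w wA.
have sw := (skewsymP w).1 (skA wA).
have n2 : (2%:R : K) != 0 by rewrite char0.
have diag := ev_diag n2 _ sw; move: sw diag h12 h13 h23; rewrite /skewsym /= => sw diag e12 e13 e23.
case: i => [|[|[|i]]] //; case: j => [|[|[|j]]] //= _ _; rewrite ?diag //.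
all: by rewrite sw ?e12 ?e13 ?e23 oppr0.
Qed.

(** Weight -1 on v1, 1 on v6, 0 elsewhere: negative pairs join v1 to one of v1, ..., v5. *)
Lemma stable_no_flag15 v1 v2 v3 v4 v5 v6 :
  basis_of fullv [:: v1; v2; v3; v4; v5; v6] ->
  ~ (forall w, w \in A ->
       [/\ ev w v1 v2 = 0, ev w v1 v3 = 0, ev w v1 v4 = 0 & ev w v1 v5 = 0]).
Proof.
move=> bX iso; pose cls i := match i with 0%N => 2%N | 5%N => 1%N | _ => 0%N end.
apply: (@unstable_of_weights K W char0 A _ cls skA bX _ _ _ 5) stableA => //.
- by move=> [|[|[|[|[|[|i]]]]]].
- by move=> t t0; rewrite (big_ord_dimW (fun i => weight_pow t (cls i)))
    !big_ord_recl big_ord0 /=; field.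
move=> w i j wA lti ltj; have [h12 h13 h14 h15] := iso w wA.
have sw := (skewsymP w).1 (skA wA).
have n2 : (2%:R : K) != 0 by rewrite char0.
have diag := ev_diag n2 v1 sw.
by case: i lti => [|[|[|[|[|[|i]]]]]] //; case: j ltj => [|[|[|[|[|[|j]]]]]].
Qed.

End StableSystems.

(** * Ranks of forms *)

Section Ranks.
Variables (K : fieldType) (W : vectType K).
Hypothesis n2 : 2%:R != 0 :> K.
Implicit Types (w : bilform K W).
Local Notation fam := (@bil_family K W).

Lemma form_mxE w : form_mx w = \matrix_(i, j) app2 w (vbasis {:W})`_i (vbasis {:W})`_j.
Proof. by rewrite app2.unlock. Qed.

Lemma app2_vecof w (x : 'rV[K]_(\dim {:W})) v :
  app2 w (vecof (vbasis {:W}) x) v = \sum_i x 0 i * app2 w (vbasis {:W})`_i v.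
Proof.
rewrite /vecof; elim/big_rec2: _ => [|i a u _ <-]; first exact: (ev0l fam).
by rewrite app2_linl.
Qed.

Lemma mul_form_mx w x j :
  (x *m form_mx w) 0 j = app2 w (vecof (vbasis {:W}) x) (vbasis {:W})`_j.
Proof. by rewrite app2_vecof form_mxE mxE; apply: eq_bigr => i _; rewrite mxE. Qed.

Lemma form_rank_ker w : skewsym fam w -> (form_rank w < \dim {:W})%N ->
  exists2 u, u != 0 & forall v, app2 w v u = 0.
Proof.
move=> sw /row_ker[x x0 xM]; exists (vecof (vbasis {:W}) x).
  by rewrite (vecof_eq0 (vbasisP _)).
move=> v; rewrite -[app2 _ _ _]opprK; apply/eqP; rewrite oppr_eq0 -(sw v); apply/eqP.
apply: (ev_basis0 (E := fam) (vbasisP _)) => y /(nthP 0)[j ltj <-].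
rewrite size_tuple in ltj.
by have /rowP/(_ (Ordinal ltj)) := xM; rewrite mul_form_mx mxE.
Qed.

(** More vectors than the rank of [w] are dependent modulo its kernel. *)
Lemma form_rank_dependent w m (b : nat -> W) : (form_rank w < m)%N ->
  exists2 c : nat -> K, exists2 i, (i < m)%N & c i != 0
    & forall v, \sum_(i < m) c i * app2 w (b i) v = 0.
Proof.
case: m => [//|m] rw.
pose U : 'M[K]_(m.+1, \dim {:W}) := \matrix_(i, j) rVof (vbasis {:W}) (b i) 0 j.
have [|x x0 xU] := @row_ker _ _ _ (U *m form_mx w).
  exact: leq_ltn_trans (mxrankM_maxr _ _) _.
pose c i := x 0 (inord i); exists c.
  have [i xi] : exists i, x 0 i != 0.
    apply/existsP; apply: contraR x0; rewrite negb_exists => /forallP x0.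
    by apply/eqP/rowP => i; rewrite mxE; apply/eqP; rewrite -[_ == _]negbK.
  by exists i; rewrite // /c inord_val.
have vecU : vecof (vbasis {:W}) (x *m U) = \sum_i x 0 i *: b i.
  rewrite mulmx_sum_row linear_sum; apply: eq_bigr => i _; rewrite linearZ /=; congr (_ *: _).
  rewrite -[RHS](rVofK (vbasisP {:W})); congr vecof.
  by apply/rowP => j; rewrite !mxE.
move=> v.
have -> : \sum_(i < m.+1) c i * app2 w (b i) v = app2 w (vecof (vbasis {:W}) (x *m U)) v.
  rewrite vecU; elim/big_rec2: _ => [|i u a _ ->]; first exact/esym/(ev0l fam).
  by rewrite app2_linl /c inord_val.
move: v; apply: (ev_basis0 (E := fam) (vbasisP _)) => y /(nthP 0)[j ltj <-].
rewrite size_tuple in ltj.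
rewrite /ev /= -[_ `_ j]/((vbasis {:W})`_(Ordinal ltj)) -mul_form_mx -mulmxA xU.
by rewrite mxE.
Qed.

Lemma form_rank2_pf4 w (b : nat -> W) : skewsym fam w -> form_rank w = 2%N ->
  pf4 (fun i j => app2 w (b i) (b j)) 0 1 2 3 = 0.
Proof.
move=> sw rw; have [|c [i lti ci] bw] := @form_rank_dependent w 4 b; first by rewrite rw.
apply/eqP; apply: contraNT ci => nz; apply/eqP; move: i lti.
apply: (pf4_ker _ _ _ nz) => // [j|j k|j ltj].
- exact: (ev_diag n2 _ sw).
- exact: sw.
- rewrite -[RHS]oppr0 -[X in _ = - X](bw (b j)) -sumrN; apply: eq_bigr => k _.
  by rewrite -mulrN; congr (_ * _); exact: sw.
Qed.

(** The matrix is a sum of two products of a column by a row, so its rank is at most 2; vectors with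
    w(u, v) = 1 are independent modulo the kernel, so it is at least 2. *)
Lemma form_rank_rank2 w : rank2 fam w -> w != 0 -> skewsym fam w -> form_rank w = 2%N.
Proof.
move=> [p [q wE]] w0 sw; apply/eqP; rewrite eqn_leq; apply/andP; split.
  pose f u : 'rV[K]_(\dim {:W}) := \row_j app2 w u (vbasis {:W})`_j.
  have -> : form_rank w = \rank ((f p)^T *m f q + (- (f q)^T) *m f p)%R.
    rewrite /form_rank form_mxE; congr (\rank _); apply/matrixP => i j.
    rewrite !mxE !big_ord1 !mxE [LHS]wE /=; ring.
  apply: leq_trans (mxrank_add _ _) _; rewrite -[2%N]/(1 + 1)%N.
  by apply: leq_add; apply: leq_trans (mxrankM_maxl _ _) (rank_leq_col _).
rewrite leqNgt; apply/negP => rw.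
have [wz|[u [v e1]]] := bilinear_eq1 (fun a u v => app2Zl w a u v).
  by case/eqP: w0; apply: app2_ext => u v; rewrite wz app20f.
have [c [i lti ci] bw] := form_rank_dependent (nth 0 [:: u; v]) rw.
have dg z : app2 w z z = 0 by exact: (ev_diag n2 _ sw).
have vu : app2 w v u = - 1 by rewrite -e1; exact: sw.
have := (bw v, bw u); rewrite !big_ord_recl !big_ord0 /= !dg e1 vu.
rewrite !(mulr0, mulr1, mulrN1, addr0, add0r) => -[c0 /eqP]; rewrite oppr_eq0 => /eqP c1.
by case: i lti ci => [|[|i]] //; rewrite ?c0 ?c1 eqxx.
Qed.

(** [Pf] only bounds the rank of some generator w' of the line of [w]; a kernel vector of w' is one
    of [w]. *)
Lemma Pf_pf (A : {vspace bilform K W}) w X : \dim {:W} = 6%N -> proj A `<=` Pf W ->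
  (forall w, w \in A -> skew_forms W w) -> w \in A -> basis_of fullv X -> pf fam w X = 0.
Proof.
move=> dimW A_Pf skA wA bX; have sX : size X = 6%N by rewrite (basis_size bX).
have sw := (skewsymP w).1 (skA w wA).
have [w0|w0] := eqVneq w 0.
  apply: (pf_ker n2 sw bX sX (v := X`_0)).
    by apply: (free_not0 (basis_free bX)); rewrite mem_nth ?sX.
  by move=> u; rewrite w0 /= app20f.
have [|w' [skw' [w'0 rw']] e] := A_Pf <[w]>%VS; first by exists w; [split|].
have [||u u0 ku] := @form_rank_ker w';
  [exact: (skewsymP w').1 | by rewrite dimW (leq_ltn_trans rw')|].
have /vlineP[c wE] : w \in <[w']>%VS by rewrite e memv_line.
apply: (pf_ker n2 sw bX sX u0) => v.
by rewrite wE /= app2Zf ku mulr0.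
Qed.

End Ranks.

(** * The target space *)

Lemma target_span (K : fieldType) (F : vectType K) (s : K) (a b c d : F) :
    s != 0 -> 2%:R != 0 :> K ->
  <<[:: s *: d; s *: (2 *: b); s *: (2 *: c); s *: (d - 2 *: a)]>>%VS = <<[:: a; b; c; d]>>%VS.
Proof.
move=> s0 n2; apply/eqP; rewrite eqEsubv; apply/andP; split; apply/span_subvP => v.
  have [Ma [Mb [Mc Md]]] : a \in <<[:: a; b; c; d]>>%VS /\ b \in <<[:: a; b; c; d]>>%VS /\
    c \in <<[:: a; b; c; d]>>%VS /\ d \in <<[:: a; b; c; d]>>%VS.
    by do !split; rewrite memv_span // !inE eqxx ?orbT.
  by rewrite !inE => /or4P[] /eqP ->; rewrite !memvZ // memvB // memvZ.
set X := [:: s *: d; _; _; _].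
have M v' : v' \in X -> s^-1 *: v' \in <<X>>%VS by move=> vX; rewrite memvZ ?memv_span.
have [Md Mb Mc Me] : [/\ d \in <<X>>%VS, 2 *: b \in <<X>>%VS, 2 *: c \in <<X>>%VS
    & d - 2 *: a \in <<X>>%VS].
  by split; rewrite -[_ \in _](congr1 (fun z => z \in _) (scalerK s0 _)) M // !inE eqxx ?orbT.
rewrite !inE => /or4P[] /eqP -> //.
- rewrite -[a](scalerK n2) memvZ // -[2 *: a](subKr d) memvB //.
- by rewrite -[b](scalerK n2) memvZ.
- by rewrite -[c](scalerK n2) memvZ.
Qed.

HB.lock Definition fv (K : fieldType) (W : vectType K) (f : dual K W) (u : W) : K := f u.

(** * Functionals and the basis of W dual to a basis of its dual *)

Section Functionals.
Variables (K : fieldType) (W : vectType K).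
Implicit Types (f h : dual K W) (u v : W).

Lemma fvD f u v : fv f (u + v) = fv f u + fv f v.
Proof. by rewrite fv.unlock linearD. Qed.
Lemma fvZ f a u : fv f (a *: u) = a * fv f u.
Proof. by rewrite fv.unlock linearZ. Qed.
Lemma fvN f u : fv f (- u) = - fv f u.
Proof. by rewrite fv.unlock linearN. Qed.
Lemma fv0 f : fv f 0 = 0.
Proof. by rewrite fv.unlock linear0. Qed.
Lemma fvDf f h u : fv (f + h) u = fv f u + fv h u.
Proof. by rewrite fv.unlock add_lfunE. Qed.
Lemma fvNf f u : fv (- f) u = - fv f u.
Proof. by rewrite fv.unlock opp_lfunE. Qed.

Lemma fvZf a f u : fv (a *: f) u = a * fv f u.
Proof. by rewrite fv.unlock scale_lfunE. Qed.

Lemma app2_wedge_fv f h u v : app2 (wedge f h) u v = fv f u * fv h v - fv h u * fv f v.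
Proof. by rewrite app2_wedge fv.unlock. Qed.

Lemma dual_separates u : (forall f, fv f u = 0) -> u = 0.
Proof.
move=> fu0; rewrite (coord_vbasis (memvf u)) big1 // => i _.
have lin : linear (coord (vbasis {:W}) i : W -> K^o) by move=> a x y; rewrite linearP.
pose cL := GRing.isLinear.Build K W K^o _ _ lin.
pose c : {linear W -> K^o} := HB.pack (coord (vbasis {:W}) i : W -> K^o) cL.
by have := fu0 (linfun c); rewrite fv.unlock lfunE /= => ->; rewrite scale0r.
Qed.

Lemma exists_dual_basis (e : seq (dual K W)) : basis_of fullv e -> size e = \dim {:W} ->
  exists eps : nat -> W, forall i j, (i < size e)%N -> (j < size e)%N ->
    fv e`_i (eps j) = (i == j)%:R.
Proof.
move=> be se; pose m := size e.
pose ev0 u : 'rV[K]_m := \row_(i < m) fv e`_i u.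
have lin : linear ev0.
  by move=> a u v; apply/rowP => i; rewrite !mxE fvD fvZ.
pose evL := GRing.isLinear.Build K W 'rV[K]_m _ _ lin.
pose evF : {linear W -> 'rV[K]_m} := HB.pack ev0 evL.
pose g := linfun evF.
have gE u i : g u 0 i = fv e`_i u by rewrite lfunE /= mxE.
have kg : lker g = 0%VS.
  apply/eqP; rewrite -subv0; apply/subvP => u; rewrite memv_ker memv0 => /eqP gu.
  apply/eqP/dual_separates => f.
  have : f \in <<e>>%VS by rewrite (span_basis be) memvf.
  case/span_seqP => c ->; elim/big_rec: _ => [|i h _ IH]; first by rewrite fv.unlock zero_lfunE.
  by have /rowP/(_ i) := gu; rewrite gE mxE fvDf IH addr0 fvZf => ->; rewrite mulr0.
have img : limg g = fullv.
  apply/eqP; rewrite eqEdim subvf /= limg_dim_eq ?kg ?capv0 //.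
  by rewrite -se [X in (X <= _)%N]dimvf /dim /= mul1n.
exists (fun j => if insub j is Some j' then g^-1%VF (delta_mx 0 j') else 0).
move=> i j lti ltj; rewrite insubT /=.
have := gE (g^-1%VF (delta_mx 0 (Ordinal ltj))) (Ordinal lti).
rewrite limg_lfunVK ?img ?memvf // mxE eqxx /= => <-; by rewrite -val_eqE.
Qed.

End Functionals.

Section Target.
Variables (K : fieldType) (W : vectType K).
Hypothesis n2 : 2%:R != 0 :> K.
Hypothesis dimW : \dim {:W} = 6%N.
Variables (es : nat -> dual K W) (eps : nat -> W).
Hypothesis es_eps : forall i j, (i < 6)%N -> (j < 6)%N -> fv (es i) (eps j) = (i == j)%:R.

Let a := (wedge (es 0) (es 3) + wedge (es 1) (es 4))%R.
Let b := (wedge (es 0) (es 5) + wedge (es 2) (es 4))%R.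
Let c := (wedge (es 1) (es 5) - wedge (es 2) (es 3))%R.
Let d := wedge (es 0 - es 4) (es 1 + es 3).

(* With [f1 = e1 - e5], [f2 = e2 + e4], [f3 = e3 + e6], [g1 = e1 + e5], [g2 = e2 - e4] and
   [g3 = e6 - e3] the target is spanned by [f1 /\ f2 = d], [f1 /\ f3 + g1 /\ g3 = 2 b],
   [f2 /\ f3 + g2 /\ g3 = 2 c] and [g1 /\ g2 = d - 2 a]; this is the table of the basis of
   [W] dual to [f1, f2, - f3, - g2, g1, g3]. *)
Lemma target_table : exists2 Y : seq W, basis_of fullv Y &
  forall k i j, (k < 4)%N -> (i < j < 6)%N ->
    app2 [:: d; 2 *: b; 2 *: c; d - 2 *: a]`_k Y`_i Y`_j = std_table K k i j.
Proof.
pose h : K := 2^-1.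
pose Y := [:: h *: (eps 0%N - eps 4%N); h *: (eps 1%N + eps 3%N); - h *: (eps 2%N + eps 5%N);
  - h *: (eps 1%N - eps 3%N); h *: (eps 0%N + eps 4%N); h *: (eps 5%N - eps 2%N)].
(* Row i lists the values of [es i] on [Y]. *)
pose T := [:: [:: h; 0; 0; 0; h; 0]; [:: 0; h; 0; - h; 0; 0]; [:: 0; 0; - h; 0; 0; - h];
  [:: 0; h; 0; h; 0; 0]; [:: - h; 0; 0; 0; h; 0]; [:: 0; 0; - h; 0; 0; h]].
have V i j : (i < 6)%N -> (j < 6)%N -> fv (es i) Y`_j = (nth [::] T i)`_j.
  case: i => [|[|[|[|[|[|i]]]]]] //; case: j => [|[|[|[|[|[|j]]]]]] // _ _;
    by rewrite /Y /= !(fvZ, fvD, fvN) !es_eps //=; ring.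
have beps : basis_of fullv [:: eps 0%N; eps 1%N; eps 2%N; eps 3%N; eps 4%N; eps 5%N].
  apply: free_basis; rewrite ?subvf ?dimW //; apply/free_seqP => x.
  rewrite !big_ord_recl big_ord0 /= => x0 i lti.
  have := congr1 (fv (es i)) x0; rewrite !(fvD, fvZ) !fv0 !es_eps //=.
  by case: i lti => [|[|[|[|[|[|i]]]]]] //= _ <-; ring.
have hh : h + h = 1 by rewrite /h; field.
exists Y.
  apply: (basis6_change beps) => //.
  - apply: (mem_span6 (c1 := 1) (c2 := 0) (c3 := 0) (c4 := 0) (c5 := 1) (c6 := 0)).
    by apply: co_ext => i; rewrite !coE /h; field.
  - apply: (mem_span6 (c1 := 0) (c2 := 1) (c3 := 0) (c4 := - 1) (c5 := 0) (c6 := 0)).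
    by apply: co_ext => i; rewrite !coE /h; field.
  - apply: (mem_span6 (c1 := 0) (c2 := 0) (c3 := - 1) (c4 := 0) (c5 := 0) (c6 := - 1)).
    by apply: co_ext => i; rewrite !coE /h; field.
  - apply: (mem_span6 (c1 := 0) (c2 := 1) (c3 := 0) (c4 := 1) (c5 := 0) (c6 := 0)).
    by apply: co_ext => i; rewrite !coE /h; field.
  - apply: (mem_span6 (c1 := - 1) (c2 := 0) (c3 := 0) (c4 := 0) (c5 := 1) (c6 := 0)).
    by apply: co_ext => i; rewrite !coE /h; field.
  - apply: (mem_span6 (c1 := 0) (c2 := 0) (c3 := - 1) (c4 := 0) (c5 := 0) (c6 := 1)).
    by apply: co_ext => i; rewrite !coE /h; field.
have aE u v : app2 a u v = fv (es 0) u * fv (es 3) v - fv (es 3) u * fv (es 0) v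
    + (fv (es 1) u * fv (es 4) v - fv (es 4) u * fv (es 1) v).
  by rewrite app2Df !app2_wedge_fv.
have bE u v : app2 b u v = fv (es 0) u * fv (es 5) v - fv (es 5) u * fv (es 0) v
    + (fv (es 2) u * fv (es 4) v - fv (es 4) u * fv (es 2) v).
  by rewrite app2Df !app2_wedge_fv.
have cE u v : app2 c u v = fv (es 1) u * fv (es 5) v - fv (es 5) u * fv (es 1) v
    - (fv (es 2) u * fv (es 3) v - fv (es 3) u * fv (es 2) v).
  by rewrite app2Df app2Nf !app2_wedge_fv.
have dE u v : app2 d u v = (fv (es 0) u - fv (es 4) u) * (fv (es 1) v + fv (es 3) v)
    - (fv (es 1) u + fv (es 3) u) * (fv (es 0) v - fv (es 4) v).
  by rewrite app2_wedge_fv !fvDf !fvNf.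
clearbody a b c d Y.
move=> k i j ltk /andP[ltij ltj]; have lti := ltn_trans ltij ltj.
case: k ltk => [|[|[|[|k]]]] // _;
  rewrite /= ?app2Df ?app2Nf ?app2Zf ?aE ?bE ?cE ?dE !V // {V aE bE cE dE};
  case: i lti ltij => [|[|[|[|[|[|i]]]]]] // _;
  case: j ltj => [|[|[|[|[|[|j]]]]]] // _ _; rewrite /T /h /=; by field; rewrite ?n2.
Qed.

End Target.

(** * Equivalence and points of rank 2 *)

Section Transport.
Variables (K : fieldType) (W : vectType K).
Hypothesis n2 : 2%:R != 0 :> K.
Hypothesis dimW : \dim {:W} = 6%N.
Hypothesis root6 : forall a : K, exists x, x ^+ 6 = a.
Local Notation fam := (@bil_family K W).

Lemma exists_basis_map (X Y : seq W) : basis_of fullv X -> basis_of fullv Y ->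
  exists2 g : 'End(W), lker g == 0%VS & forall i, (i < 6)%N -> g X`_i = Y`_i.
Proof.
move=> bX bY; have sX := basis_size bX; have sY := basis_size bY.
pose g : 'End(W) := linfun (sval (linear_of_free X Y)).
have gE i : (i < 6)%N -> g X`_i = Y`_i.
  move=> lti; rewrite lfunE; case: (linear_of_free _ _) => f /= /(_ (basis_free bX)).
  rewrite sX sY => /(_ erefl) <-; by rewrite (nth_map 0) // sX dimW.
exists g => //; rewrite -subv0; apply/subvP => u; rewrite memv_ker memv0 => /eqP gu.
have : u \in <<X>>%VS by rewrite (span_basis bX) memvf.
case/span_seqP => c; rewrite sX dimW => uE; apply/eqP.
have c0 i : (i < 6)%N -> c i = 0.
  have /free_seqP := basis_free bY; rewrite sY dimW => /(_ c); apply.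
  rewrite -[RHS]gu uE linear_sum; apply: eq_bigr => k _; by rewrite linearZ /= gE.
by rewrite uE big1 // => i _; rewrite c0 ?scale0r.
Qed.

Lemma act_scale (c : K) (g : 'End(W)) (w : bilform K W) : c != 0 -> lker g == 0%VS ->
  act (c *: g) w = c ^- 2 *: act g w.
Proof.
move=> c0 kg; have gV : (c *: g)^-1%VF = c^-1 *: g^-1%VF.
  by apply: inv_lfunE => u; rewrite !scale_lfunE linearZ /= scalerA ?mulfV ?mulVf //
    scale1r ?lker0_lfunK ?lker0_lfunVK.
apply: app2_ext => u v.
by rewrite app2_act app2Zf app2_act gV !scale_lfunE app2Zl app2Zr -exprVn expr2 mulrA.
Qed.

Lemma SL_scale (g : 'End(W)) : lker g == 0%VS -> exists2 c, c != 0 & SL (c *: g).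
Proof.
move=> kg; have dg : lfun_det g != 0 by rewrite lfun_det_lker0.
have [c cE] := root6 (lfun_det g)^-1; exists c.
  by apply: contraNneq dg => c0; rewrite -invr_eq0 -cE c0 expr0n.
by rewrite /SL /= -/(lfun_det _) lfun_detZ dimW cE mulVf.
Qed.

(** The map from [X] to [Y] matches the two tables; scaling it by s into SL multiplies every form by
    s^-2, which leaves the span unchanged. *)
Lemma table_SL_equivalent (X Y : seq W) (A : {vspace bilform K W}) (H : seq (bilform K W))
    (a b c d : bilform K W) :
    basis_of fullv X -> basis_of fullv Y -> basis_of A H -> size H = 4%N ->
    (forall w, w \in A -> skewsym fam w) ->
    skewsym fam a -> skewsym fam b -> skewsym fam c -> skewsym fam d ->
    (forall k i j, (k < 4)%N -> (i < j < 6)%N -> app2 H`_k X`_i X`_j = std_table K k i j) ->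
    (forall k i j, (k < 4)%N -> (i < j < 6)%N ->
       app2 [:: d; 2 *: b; 2 *: c; d - 2 *: a]`_k Y`_i Y`_j = std_table K k i j) ->
  SL_equivalent A <<[:: a; b; c; d]>>%VS.
Proof.
move=> bX bY bA sH skA ska skb skc skd tH tB.
have [g kg gX] := exists_basis_map bX bY.
have [s s0 SLsg] := SL_scale kg; exists (s *: g) => //.
have gV i : (i < 6)%N -> g^-1%VF Y`_i = X`_i by move=> lti; rewrite -gX // lker0_lfunK.
have actH k : (k < 4)%N ->
    act (s *: g) H`_k = s ^- 2 *: [:: d; 2 *: b; 2 *: c; d - 2 *: a]`_k.
  move=> ltk; rewrite act_scale //; congr (_ *: _).
  have sHk : skewsym fam H`_k by apply: skA; apply: (basis_mem bA); rewrite mem_nth ?sH.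
  apply: (ev_basis_ext (E := fam) n2 bY).
  - by move=> u v /=; rewrite !app2_act; exact: sHk.
  - case: k ltk {sHk} => [|[|[|[|k]]]] //= _.
    + exact: skewZ.
    + exact: skewZ.
    + by apply: skewD => //; apply: skewN; apply: skewZ.
  move=> i j /andP[ltij ltj]; rewrite (basis_size bY) dimW in ltj.
  have lti := ltn_trans ltij ltj.
  by rewrite /= app2_act !gV // tH ?ltij // tB ?ltij.
have s20 : s ^- 2 != 0 by rewrite invr_eq0 expf_neq0.
rewrite -(span_basis bA) limg_span -(target_span a b c d s20 n2); congr (<<_>>)%VS.
case: H sH {bA tH} actH => [|h0 [|h1 [|h2 [|h3 []]]]] //= _ actH.
by rewrite (actH 0%N) // (actH 1%N) // (actH 2%N) // (actH 3%N).
Qed.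

Lemma vline_scale (F : vectType K) (c : K) (w : F) : c != 0 -> (<[c *: w]> = <[w]>)%VS.
Proof.
move=> c0; apply/eqP; rewrite eqEsubv -!memvE memvZ ?memv_line //=.
by rewrite -{1}[w](scalerK c0) memvZ // memv_line.
Qed.

Lemma rank2_of_table (w : bilform K W) (X : seq W) i0 j0 : basis_of fullv X ->
    skewsym fam w -> (i0 < j0 < 6)%N ->
    (forall i j, (i < j < 6)%N -> app2 w X`_i X`_j = ((i == i0) && (j == j0))%:R) ->
  rank2 fam w.
Proof.
move=> bX sw /andP[lt0 ltj0] tw; have lti0 := ltn_trans lt0 ltj0.
have sX : size X = 6%N by rewrite (basis_size bX).
have full i j : (i < 6)%N -> (j < 6)%N -> app2 w X`_i X`_j =
    ((i == i0) && (j == j0))%:R - ((i == j0) && (j == i0))%:R.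
  have ne : i0 == j0 = false by rewrite ltn_eqF.
  move=> lti ltj; case: (ltngtP i j) => [ltij|ltji|->].
  - rewrite tw ?ltij //; case: (i =P j0) => [ij0|_]; last by rewrite subr0.
    by case: (j =P i0) => [ji0|_]; rewrite ?subr0 //; move: ltij; rewrite ij0 ji0 ltnNge ltnW.
  - have -> : app2 w X`_i X`_j = - app2 w X`_j X`_i by exact: sw.
    rewrite tw ?ltji //; case: (i =P i0) => [ii0|_] /=; last by rewrite sub0r andbC.
    case: (j =P j0) => [jj0|_] /=; last by rewrite sub0r andbC.
    by move: ltji; rewrite ii0 jj0 ltnNge ltnW.
  - have -> : app2 w X`_j X`_j = 0 by exact: (ev_diag n2 _ sw).
    by rewrite [in X in _ - X]andbC subrr.
exists X`_i0, X`_j0 => u v /=; apply/eqP; rewrite -subr_eq0; apply/eqP; move: u.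
apply: (linear_basis0 _ bX) => [a u u'|_ /(nthP 0)[i lti <-]].
  by rewrite !app2_linr app2_linl; ring.
move: v; apply: (linear_basis0 _ bX) => [a v v'|_ /(nthP 0)[j ltj <-]].
  by rewrite !app2_linr; ring.
rewrite sX in lti ltj; rewrite !full // !eqxx !(eq_sym i0 j0) (gtn_eqF lt0) /=.
case: (i == i0); case: (i == j0); case: (j == i0); case: (j == j0); rewrite /=; ring.
Qed.

(** In a member of A of rank 2 with coefficients c0, ..., c3, three 4 by 4 sub-Pfaffians of the
    table give c1^2 = 0, c2^2 = 0 and c0 c3 = 0. *)
Lemma Gr2_points (A : {vspace bilform K W}) (X : seq W) (H : seq (bilform K W)) :
    basis_of fullv X -> basis_of A H -> size H = 4%N ->
    (forall w, w \in A -> skewsym fam w) ->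
    (forall k i j, (k < 4)%N -> (i < j < 6)%N -> app2 H`_k X`_i X`_j = std_table K k i j) ->
  exists p q : {vspace bilform K W}, p <> q /\ proj A `&` Gr2 W = [set p; q].
Proof.
move=> bX bA sH skA tH; exists <[H`_0]>%VS, <[H`_3]>%VS.
have HA k : (k < 4)%N -> H`_k \in A by move=> ltk; apply: (basis_mem bA); rewrite mem_nth ?sH.
have skH k : (k < 4)%N -> skewsym fam H`_k by move=> /HA /skA.
have H0 k : (k < 4)%N -> H`_k != 0.
  by move=> ltk; apply: (free_not0 (basis_free bA)); rewrite mem_nth ?sH.
have r0 : rank2 fam H`_0.
  apply: (@rank2_of_table _ X 0 1) => //; first exact: skH.
  move=> i j lij; rewrite tH //; have /andP[ltij ltj] := lij.
  by case: i ltij {lij} => [|[|[|[|[|[|i]]]]]] //; case: j ltj => [|[|[|[|[|[|j]]]]]].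
have r3 : rank2 fam H`_3.
  apply: (@rank2_of_table _ X 3 4) => //; first exact: skH.
  move=> i j lij; rewrite tH //; have /andP[ltij ltj] := lij.
  by case: i ltij {lij} => [|[|[|[|[|[|i]]]]]] //; case: j ltj => [|[|[|[|[|[|j]]]]]].
have point k : (k < 4)%N -> rank2 fam H`_k -> (proj A `&` Gr2 W) <[H`_k]>%VS.
  move=> ltk rk; split; first by exists H`_k => //; split; [exact: HA | exact: H0].
  exists H`_k => //; split; first by apply/skewsymP; apply: skH.
  by apply: form_rank_rank2 => //; [exact: H0 | exact: skH].
split.
  move=> e; have /vlineP[c] : H`_0 \in <[H`_3]>%VS by rewrite -e memv_line.
  move/(congr1 (fun w => app2 w X`_0 X`_1)); rewrite app2Zf !tH //= mulr0 => /eqP.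
  by rewrite oner_eq0.
apply/seteqP; split=> [l|l [->|->]]; [|exact: point|exact: point].
move=> [[w [wA w0] <-] [w' [skw' rw'] e]].
have w'0 : w' != 0.
  by apply: contra_eq_neq rw' => ->; rewrite /form_rank form_mxE (_ : \matrix_(_, _) _ = 0)
    ?mxrank0 //; apply/matrixP => i j; rewrite !mxE app20f.
have w'A : w' \in A.
  have : w' \in <[w]>%VS by rewrite -e memv_line.
  by case/vlineP => c ->; rewrite memvZ.
rewrite -e; have [c0 [c1 [c2 [c3 wE]]]] : exists c0, exists c1, exists c2, exists c3,
    w' = c0 *: H`_0 + c1 *: H`_1 + c2 *: H`_2 + c3 *: H`_3.
  apply: basis4_mem w'A; move: bA sH.
  by case: (H) => [|h0 [|h1 [|h2 [|h3 []]]]].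
have pf0 b := form_rank2_pf4 n2 b ((skewsymP w').1 skw') rw'.
have wv i j : (i < j < 6)%N -> app2 w' X`_i X`_j = c0 * std_table K 0 i j
    + c1 * std_table K 1 i j + c2 * std_table K 2 i j + c3 * std_table K 3 i j.
  by move=> lij; rewrite wE !app2Df !app2Zf !tH.
have sq0 (c : K) : c * c = 0 -> c = 0 by move/eqP; rewrite mulf_eq0 orbb => /eqP.
have c10 : c1 = 0.
  apply: sq0; apply: oppr_inj; rewrite oppr0.
  rewrite -[RHS](pf0 (nth 0 [:: X`_0; X`_2; X`_4; X`_5])) /pf4 /= !wv //=; ring.
have c20 : c2 = 0.
  apply: sq0.
  rewrite -[RHS](pf0 (nth 0 [:: X`_1; X`_2; X`_3; X`_5])) /pf4 /= !wv //=; ring.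
have /eqP : c0 * c3 = 0.
  rewrite -[RHS](pf0 (nth 0 [:: X`_0; X`_1; X`_3; X`_4])) /pf4 /= !wv //= c10 c20; ring.
rewrite c10 c20 !scale0r !addr0 in wE.
rewrite mulf_eq0 => /orP[] /eqP ci0; rewrite ci0 scale0r ?add0r ?addr0 in wE.
  right; rewrite wE vline_scale //; apply: contraNneq w'0 => c30.
  by rewrite wE c30 scale0r.
left; rewrite wE vline_scale //; apply: contraNneq w'0 => c00.
by rewrite wE c00 scale0r.
Qed.

End Transport.

(** The field enters only through characteristic 0, roots of monic quadratics and sixth roots, the
    last for rescaling to determinant 1 in dimension 6. *)
Lemma stable_Pf_space_normal_form (K : fieldType) (W : vectType K)
    (char0 : forall n, (n%:R == 0 :> K) = (n == 0%N)) (sqK : sqrt_closed K)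
    (root6 : forall a : K, exists x, x ^+ 6 = a) (dimW : \dim {:W} = 6%N)
    (e1 e2 e3 e4 e5 e6 : dual K W)
    (basis_e : basis_of fullv [:: e1; e2; e3; e4; e5; e6])
    (A : {vspace bilform K W}) (dimA : \dim A = 4%N)
    (skewA : [set` A] `<=` skew_forms W) (A_Pf : proj A `<=` Pf W) (stableA : stable A) :
  SL_equivalent A
    <<[:: (wedge e1 e4 + wedge e2 e5)%R;
          (wedge e1 e6 + wedge e3 e5)%R;
          (wedge e2 e6 - wedge e3 e4)%R;
          (wedge (e1 - e5) (e2 + e4))%R]>>%VS /\
  exists p q : {vspace bilform K W},
    p <> q /\ proj A `&` Gr2 W = [set p; q].
Proof.
have n2 : 2%:R != 0 :> K by rewrite char0.
have skA w : w \in A -> skewsym (@bil_family K W) w.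
  by move=> wA; apply/skewsymP; apply: skewA.
have pfA w X : w \in A -> basis_of fullv X -> pf (@bil_family K W) w X = 0.
  exact: Pf_pf.
have [X [H [bX sX bA sH tH]]] := exists_normal_form n2 dimW dimA skA pfA sqK
  (stable_no_iso3 char0 dimW skewA stableA) (stable_no_flag15 char0 dimW skewA stableA).
split; last exact: Gr2_points bX bA sH skA tH.
have [|eps epsE] := exists_dual_basis basis_e; first by rewrite dimW.
pose es := nth 0 [:: e1; e2; e3; e4; e5; e6].
have [Y bY tY] := @target_table K W n2 dimW es eps epsE.
have skw f h : skewsym (@bil_family K W) (wedge f h).
  by move=> u v /=; rewrite !app2_wedge_fv; ring.
apply: (table_SL_equivalent n2 dimW root6 bX bY bA sH skA) tH tY.
- by apply: skewD; apply: skw.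
- by apply: skewD; apply: skw.
- by apply: skewD; [apply: skw | apply: skewN; apply: skw].
- exact: skw.
Qed.

Theorem theorem1p1 (R : realType) (W : vectType R[i])
    (dimW : \dim {:W} = 6%N)
    (e1 e2 e3 e4 e5 e6 : dual R[i] W)
    (basis_e : basis_of fullv [:: e1; e2; e3; e4; e5; e6])
    (A : {vspace bilform R[i] W})
    (dimA : \dim A = 4%N)
    (skewA : [set` A] `<=` skew_forms W)
    (A_Pf : proj A `<=` Pf W)
    (stableA : stable A) :
  SL_equivalent A
    <<[:: (wedge e1 e4 + wedge e2 e5)%R;
          (wedge e1 e6 + wedge e3 e5)%R;
          (wedge e2 e6 - wedge e3 e4)%R;
          (wedge (e1 - e5) (e2 + e4))%R]>>%VS /\
  exists p q : {vspace bilform R[i] W},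
    p <> q /\ proj A `&` Gr2 W = [set p; q].
Proof.
apply: (stable_Pf_space_normal_form _ _ _ dimW basis_e dimA skewA A_Pf stableA).
- by move=> n; rewrite Num.Theory.pnatr_eq0.
- move=> p q; have [x xE] := solve_monicpoly (nth (0 : R[i]) [:: q; p]) (isT : 0 < 2)%N.
  by exists x; rewrite xE !big_ord_recl big_ord0 /= addr0 expr0 expr1 mulr1 addrC.
(* The default 0 of [nth] supplies the missing coefficients, so the equation is x^6 = a. *)
- move=> a; have [x xE] := solve_monicpoly (nth (0 : R[i]) [:: a]) (isT : 0 < 6)%N.
  by exists x; rewrite xE !big_ord_recl big_ord0 /= !mul0r !addr0 expr0 mulr1.
Qed.
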